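(* Let $\Sigma$ be a Riemann surface with an immersion $X:\Sigma\to\mathbb{R}^3$ with Gauss map $N$ such that $\langle X(p),N(p)\rangle\neq1$ for all $p\in\Sigma$, locally parameterized, as described in the context, by $X=Y-\frac{2(h+c)}{S}\eta$ with $Y=\pi_-^{-1}\circ g$, $g$ holomorphic with $g'\neq0$, $c$ a nonzero real constant and $h:U\subset\mathbb{R}^2\to\mathbb{R}$ the associated differentiable function. Then $\Sigma$ is an $H_1$-surface if and only if $$h(u,v)=\frac{\langle 1,A(z)\rangle+\langle g(z),B(z)\rangle}{1+|g(z)|^2},\qquad z=u+iv,$$ where $A$ is a holomorphic function and $B$ is a holomorphic function such that $$B(z)=\int\big(A'(z)g(z)-A(z)g'(z)+ic_1g'(z)\big)\,dz,$$ for $c_1$ a real constant.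
   Context: Setting. Identify $\mathbb{R}^2=\mathbb{C}$ and $\mathbb{R}^3=\mathbb{C}\times\mathbb{R}$. For complex-valued functions, $\langle a,b\rangle=\mathrm{Re}(a)\mathrm{Re}(b)+\mathrm{Im}(a)\mathrm{Im}(b)$; in particular $\langle1,A\rangle=\mathrm{Re}\,A$. Let $g:\mathbb{C}\to\mathbb{C}_\infty$ be holomorphic with $g'\neq0$, let $\pi_-^{-1}:\mathbb{C}\to\mathbb{S}^2\setminus\{-e_3\}$ be the inverse of stereographic projection, let $U\subset\mathbb{R}^2$ be open, $T=1+|g|^2$, and $Y=\pi_-^{-1}\circ g=\frac1T(2g,\,2-T):U\to\mathbb{S}^2$. Then $L_{ij}=\langle Y_{,i},Y_{,j}\rangle=\frac{4|g'|^2}{T^2}\delta_{ij}$. An immersion $X:\Sigma\to\mathbb{R}^3$ with $\langle X,N\rangle\neq1$ everywhere can be locally parameterized by $X=Y-\frac{2(h+c)}{S}\eta$, where $c$ is a nonzero real constant, $h:U\to\mathbb{R}$ is a nowhere-vanishing differentiable function, and $$\eta=\nabla_Lh+hY,\qquad \nabla_L h=\frac{T^2}{4|g'|^2}(h_{,1}Y_{,1}+h_{,2}Y_{,2}),\qquad S=\langle\eta,\eta\rangle=|\nabla_Lh|^2+h^2;$$ in these coordinates the Gauss map is $N=Y-\frac{2h}{S}\eta$. Curvatures. Let $\Psi=\langle X,N\rangle$, $R=\frac{1-|X|^2}{2(\Psi-1)}$ (radius function of the sphere congruence having $\Sigma$ and the unit sphere as envelopes; one has $h=-\frac{c}{R+1}$),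 let $k_1,k_2$ be the principal curvatures (eigenvalues of $-dN$), $s_i=\frac{1+k_i}{1-k_iR}$, and $H_S=\frac12(s_1+s_2)$ (spherical mean curvature). $\Sigma$ is an $H_1$-surface if $H_S=0$.
   Formalization: The formula for h with holomorphic A, B is asserted on every simply connected open subset of each parameter domain U, not on all of an arbitrary open U, where A and B may be multivalued (e.g. g=z, A=1+log z on an annulus). *)

(* Defs.v *)
From Stdlib Require Export Reals.
From Coquelicot Require Export Coquelicot.
Set Implicit Arguments.
Open Scope R_scope.

(* Coquelicot's C is the product R * R, so a point z = u + iv of R^2 = C is
   literally the pair (u, v); likewise R^3 = C x R. *)
Definition R3 : Type := (C * R)%type.

Definition inner2 (a b : C) : R := Re a * Re b + Im a * Im b.
Definition inner3 (x y : R3) : R := inner2 (fst x) (fst y) + snd x * snd y.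
Definition add3 (x y : R3) : R3 := ((fst x + fst y)%C, snd x + snd y).
Definition scal3 (a : R) (x : R3) : R3 := ((RtoC a * fst x)%C, a * snd x).
Definition sub3 (x y : R3) : R3 := add3 x (scal3 (-1) y).
Definition zero3 : R3 := (RtoC 0, 0).

Definition D1 (f : C -> R) (z : C) : R := Derive (fun t => f (t, snd z)) (fst z).
Definition D2 (f : C -> R) (z : C) : R := Derive (fun t => f (fst z, t)) (snd z).

Fixpoint Ck (k : nat) (U : C -> Prop) (f : C -> R) : Prop :=
  match k with
  | O => forall z, U z -> continuous f z
  | S k' =>
      (forall z, U z -> ex_derive (fun t => f (t, snd z)) (fst z) /\
                        ex_derive (fun t => f (fst z, t)) (snd z)) /\
      Ck k' U (D1 f) /\ Ck k' U (D2 f)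
  end.

Definition smooth (U : C -> Prop) (f : C -> R) : Prop := forall k, Ck k U f.

Definition smooth2 (U : C -> Prop) (f : C -> C) : Prop :=
  smooth U (fun z => Re (f z)) /\ smooth U (fun z => Im (f z)).

Definition smooth3 (U : C -> Prop) (F : C -> R3) : Prop :=
  smooth2 U (fun z => fst (F z)) /\ smooth U (fun z => snd (F z)).

Definition partial1 (F : C -> R3) (z : C) : R3 :=
  ((D1 (fun w => Re (fst (F w))) z, D1 (fun w => Im (fst (F w))) z),
   D1 (fun w => snd (F w)) z).
Definition partial2 (F : C -> R3) (z : C) : R3 :=
  ((D2 (fun w => Re (fst (F w))) z, D2 (fun w => Im (fst (F w))) z),
   D2 (fun w => snd (F w)) z).

Definition diff3 (F : C -> R3) (z : C) (v : R * R) : R3 :=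
  add3 (scal3 (fst v) (partial1 F z)) (scal3 (snd v) (partial2 F z)).

Definition holomorphic (U : C -> Prop) (f : C -> C) : Prop :=
  forall z, U z -> @ex_derive C_AbsRing C_NormedModule f z.

(* Paths and homotopies are parametrized by [0,1]; asking for continuity on the
   whole of R (resp. R * R) is no restriction, since a continuous map on [0,1]
   (resp. [0,1]^2) extends by clamping its arguments. *)
Definition simply_connected (V : C -> Prop) : Prop :=
  (forall a b, V a -> V b ->
     exists gam : R -> C, (forall t, continuous gam t) /\
       (forall t, 0 <= t <= 1 -> V (gam t)) /\ gam 0 = a /\ gam 1 = b) /\
  (forall gam : R -> C, (forall t, continuous gam t) ->
     (forall t, 0 <= t <= 1 -> V (gam t)) -> gam 0 = gam 1 ->
     exists H : R * R -> C, (forall p, continuous H p) /\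
       (forall s t, 0 <= s <= 1 -> 0 <= t <= 1 -> V (H (s, t))) /\
       (forall t, 0 <= t <= 1 -> H (0, t) = gam t /\ H (1, t) = gam 0) /\
       (forall s, 0 <= s <= 1 -> H (s, 0) = gam 0 /\ H (s, 1) = gam 0)).

(* For injective phi : U -> S and psi : V -> S: the overlap is open in U and
   the transition map psi^-1 o phi satisfies the regularity reg there. *)
Definition compatible (S : Type) (reg : (C -> Prop) -> (C -> C) -> Prop)
    (U : C -> Prop) (phi : C -> S) (V : C -> Prop) (psi : C -> S) : Prop :=
  let W := fun z => U z /\ exists w, V w /\ psi w = phi z in
  open W /\
  exists tau : C -> C, reg W tau /\
    forall z, W z -> V (tau z) /\ psi (tau z) = phi z.

(* A Riemann surface given by its local parametrizations (inverse charts),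
   which also determine the topology. *)
Record RiemannSurface : Type := {
  carrier :> Type;
  chart : Type;
  chart_dom : chart -> C -> Prop;
  chart_par : chart -> C -> carrier;
  chart_open : forall i, open (chart_dom i);
  chart_inj : forall i z w, chart_dom i z -> chart_dom i w ->
    chart_par i z = chart_par i w -> z = w;
  chart_cover : forall p, exists i z, chart_dom i z /\ chart_par i z = p;
  chart_holo : forall i j,
    compatible holomorphic (chart_dom i) (chart_par i) (chart_dom j) (chart_par j);
  chart_hausdorff : forall p q, p <> q ->
    exists i j (V W : C -> Prop), open V /\ open W /\
      (forall z, V z -> chart_dom i z) /\ (forall z, W z -> chart_dom j z) /\
      (exists z, V z /\ chart_par i z = p) /\
      (exists w, W w /\ chart_par j w = q) /\
      (forall z w, V z -> W w -> chart_par i z <> chart_par j w)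
}.

Section Surfaces.
Variable Sigma : RiemannSurface.

Definition immersion (X : Sigma -> R3) : Prop :=
  forall i : chart Sigma,
    smooth3 (chart_dom Sigma i) (fun z => X (chart_par Sigma i z)) /\
    forall z v, chart_dom Sigma i z ->
      diff3 (fun w => X (chart_par Sigma i w)) z v = zero3 -> v = (0, 0).

Definition gauss_map (X N : Sigma -> R3) : Prop :=
  forall i : chart Sigma,
    smooth3 (chart_dom Sigma i) (fun z => N (chart_par Sigma i z)) /\
    forall z, chart_dom Sigma i z ->
      inner3 (N (chart_par Sigma i z)) (N (chart_par Sigma i z)) = 1 /\
      forall v, inner3 (diff3 (fun w => X (chart_par Sigma i w)) z v)
                       (N (chart_par Sigma i z)) = 0.

(* k1, k2 are the eigenvalues, with multiplicity, of -dN at p: the tangent plane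
   at p has a basis of eigenvectors v1, v2 with -dN(vj) = kj dX(vj) (-dN is
   self-adjoint, hence diagonalizable). *)
Definition principal_curvatures (X N : Sigma -> R3) (p : Sigma) (k1 k2 : R) : Prop :=
  exists (i : chart Sigma) (z : C), chart_dom Sigma i z /\ chart_par Sigma i z = p /\
    let dX := diff3 (fun w => X (chart_par Sigma i w)) z in
    let dN := diff3 (fun w => N (chart_par Sigma i w)) z in
    exists v1 v2 : R * R,
      fst v1 * snd v2 - snd v1 * fst v2 <> 0 /\
      scal3 (-1) (dN v1) = scal3 k1 (dX v1) /\
      scal3 (-1) (dN v2) = scal3 k2 (dX v2).

Definition radius_function (X N : Sigma -> R3) (p : Sigma) : R :=
  (1 - inner3 (X p) (X p)) / (2 * (inner3 (X p) (N p) - 1)).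

(* When <X,N> <> 1 and X, N admit the local parametrization below,
   1 - k R never vanishes. *)
Definition spherical_curvature (r k : R) : R := (1 + k) / (1 - k * r).

Definition spherical_mean_curvature (r k1 k2 : R) : R :=
  / 2 * (spherical_curvature r k1 + spherical_curvature r k2).

Definition is_H1_surface (X N : Sigma -> R3) : Prop :=
  forall p, exists k1 k2, principal_curvatures X N p k1 k2 /\
    spherical_mean_curvature (radius_function X N p) k1 k2 = 0.

End Surfaces.

Section LocalFormulas.
Variables (g : C -> C) (h : C -> R).

Definition Tfun (z : C) : R := 1 + Cmod (g z) ^ 2.

Definition Yfun (z : C) : R3 :=
  scal3 (/ Tfun z) ((RtoC 2 * g z)%C, 2 - Tfun z).

Definition gradL (z : C) : R3 :=
  scal3 (Tfun z ^ 2 / (4 * Cmod (C_derive g z) ^ 2))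
    (add3 (scal3 (D1 h z) (partial1 Yfun z)) (scal3 (D2 h z) (partial2 Yfun z))).

Definition eta (z : C) : R3 := add3 (gradL z) (scal3 (h z) (Yfun z)).

Definition Sfun (z : C) : R := inner3 (eta z) (eta z).

Definition local_X (c : R) (z : C) : R3 :=
  sub3 (Yfun z) (scal3 (2 * (h z + c) / Sfun z) (eta z)).

Definition local_N (z : C) : R3 :=
  sub3 (Yfun z) (scal3 (2 * h z / Sfun z) (eta z)).

End LocalFormulas.

Record LocalData (S : Type) : Type := {
  ld_dom : C -> Prop;
  ld_par : C -> S;
  ld_g : C -> C;
  ld_h : C -> R;
  ld_c : R
}.

(* The parametrization is only required to be a diffeomorphism onto an open
   subset of Sigma; holomorphic ones are a particular case. *)
Record local_parametrization (Sigma : RiemannSurface) (X N : Sigma -> R3)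
    (P : LocalData Sigma) : Prop := {
  lp_open : open (ld_dom P);
  lp_inj : forall z w, ld_dom P z -> ld_dom P w -> ld_par P z = ld_par P w -> z = w;
  lp_diffeo : forall i : chart Sigma,
    compatible smooth2 (ld_dom P) (ld_par P)
      (chart_dom Sigma i) (chart_par Sigma i) /\
    compatible smooth2 (chart_dom Sigma i) (chart_par Sigma i)
      (ld_dom P) (ld_par P);
  lp_g_holo : holomorphic (ld_dom P) (ld_g P);
  lp_g_deriv : forall z, ld_dom P z -> C_derive (ld_g P) z <> RtoC 0;
  lp_h_smooth : smooth (ld_dom P) (ld_h P);
  lp_h_nz : forall z, ld_dom P z -> ld_h P z <> 0;
  lp_c_nz : ld_c P <> 0;
  lp_X : forall z, ld_dom P z -> X (ld_par P z) = local_X (ld_g P) (ld_h P) (ld_c P) z;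
  lp_N : forall z, ld_dom P z -> N (ld_par P z) = local_N (ld_g P) (ld_h P) z
}.

(* The indefinite integral is expressed by saying that B is a holomorphic
   primitive of the integrand. *)
Definition has_holomorphic_data (V : C -> Prop) (g : C -> C) (h : C -> R) : Prop :=
  exists (A B : C -> C) (c1 : R),
    holomorphic V A /\ holomorphic V B /\
    (forall z, V z ->
       @is_derive C_AbsRing C_NormedModule B z
         (C_derive A z * g z - A z * C_derive g z + Ci * RtoC c1 * C_derive g z)%C) /\
    (forall z, V z ->
       h z = (inner2 (RtoC 1) (A z) + inner2 (g z) (B z)) / (1 + Cmod (g z) ^ 2)).

(* Main.v *)
(* Put eta_i for the partial derivatives of eta, and E = 4 |g'|^2 / T^2.  From <eta, Y> = h and
   <eta, Y_i> = h_i one gets that eta_i is tangent to the sphere and that <eta_i, Y_j> is symmetric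
   with trace Laplacian(h) + 2 E h.  Up to the reflection in the plane orthogonal to eta, dX and dN
   are dY - (2 (h + c) / S) d(eta) and dY - (2 h / S) d(eta), so the spherical curvatures are 2 h / S
   times the eigenvalues of d(eta) relative to dY, and H_S = 0 amounts to Laplacian(h) + 2 E h = 0.

   For f = T h and w = g(z), the equation makes 2 f_{ww} / T holomorphic.  Integrating it
   successively against dw gives M, A and B; the constants of integration are fixed by
   f_{w conj(w)} = Re(w M - A) and 2 f_w = T M - conj(w) A + conj(B), and the equation itself then reads
   f = Re(A + conj(w) B).  The constant c_1 can be absorbed in A.

   Primitives on a simply connected domain come from a discrete form of homotopy invariance: the
   integrals over the edges of a fine grid on the square of the homotopy cancel cell by cell. *)
Require Import Defs.
From Stdlib Require Import Lra Lia Classical ClassicalEpsilon.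
Set Implicit Arguments.
Unset Strict Implicit.
Set Bullet Behavior "Strict Subproofs".

(** * Functions of class C^k on open subsets of the plane *)

(** The constant c drops out for the following reason. Once the common reflection is undone, dN v =
    - k dX v reads (1 + k) dY v = (2h/S + 2k(h + c)/S) d(eta) v. Since R = -(h + c)/h, the bracket
    equals (2h/S)(1 - kR), so the quotient defining the spherical curvature appears by itself, and
    only h and g remain in the equation. The obstacle that shapes the rest is regularity.
    [holomorphic] only asserts one complex derivative, and no Cauchy integral theory is invoked: g
    is shown to be smooth from X and N, given A and B are bootstrapped from the formula for h, and
    constructed ones are smooth because their integrands are. After that, all computations use
    formal rules for the pair of derivatives in z and conj(z), treated as independent variables. *)

Lemma open_slice1 (U : C -> Prop) (z : C) :
  open U -> U z -> locally (fst z) (fun t => U (t, snd z)).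
Proof.
  intros HU Hz; destruct (HU z Hz) as [e He].
  exists e; intros t Ht; apply He; split; [exact Ht | apply ball_center].
Qed.

Lemma open_slice2 (U : C -> Prop) (z : C) :
  open U -> U z -> locally (snd z) (fun t => U (fst z, t)).
Proof.
  intros HU Hz; destruct (HU z Hz) as [e He].
  exists e; intros t Ht; apply He; split; [apply ball_center | exact Ht].
Qed.

Lemma open_locally_2d (U : C -> Prop) (P : R -> R -> Prop) (z : C) :
  open U -> U z -> (forall x y, U (x, y) -> P x y) ->
  locally_2d P (fst z) (snd z).
Proof.
  intros HU Hz HP; destruct (HU z Hz) as [e He].
  exists e; intros x y Hx Hy; apply HP, He; split; [exact Hx | exact Hy].
Qed.

(** Existence and value of both partial derivatives travel together, so that the derivatives of a
    compound expression are assembled by rules and read off once at the end with [partials_D]. *)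
Definition partials (f : C -> R) (z : C) (a b : R) : Prop :=
  is_derive (fun t => f (t, snd z)) (fst z) a /\
  is_derive (fun t => f (fst z, t)) (snd z) b.

Lemma partials_D (f : C -> R) z a b :
  partials f z a b -> D1 f z = a /\ D2 f z = b.
Proof. intros [H1 H2]; split; apply is_derive_unique; assumption. Qed.

Lemma partials_ext (U : C -> Prop) (f g : C -> R) z a b :
  open U -> U z -> (forall w, U w -> f w = g w) ->
  partials f z a b -> partials g z a b.
Proof.
  intros HU Hz E [H1 H2]; split.
  - eapply is_derive_ext_loc; [| exact H1].
    generalize (open_slice1 HU Hz); apply filter_imp; intros t; apply E.
  - eapply is_derive_ext_loc; [| exact H2].
    generalize (open_slice2 HU Hz); apply filter_imp; intros t; apply E.
Qed.

Lemma D_ext (U : C -> Prop) (f g : C -> R) z :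
  open U -> U z -> (forall w, U w -> f w = g w) ->
  D1 f z = D1 g z /\ D2 f z = D2 g z.
Proof.
  intros HU Hz E; split; apply Derive_ext_loc.
  - generalize (open_slice1 HU Hz); apply filter_imp; intros t; apply E.
  - generalize (open_slice2 HU Hz); apply filter_imp; intros t; apply E.
Qed.

Lemma Ck_partials k (U : C -> Prop) (f : C -> R) z :
  Ck (S k) U f -> U z -> partials f z (D1 f z) (D2 f z).
Proof.
  intros [H _] Hz; destruct (H z Hz) as [H1 H2]; split; apply Derive_correct; assumption.
Qed.

Lemma continuous_ext_open (U : C -> Prop) (f g : C -> R) z :
  open U -> U z -> (forall w, U w -> f w = g w) -> continuous f z -> continuous g z.
Proof.
  intros HU Hz E; apply continuous_ext_loc.
  exact (filter_imp _ _ (fun w Hw => E w Hw) (HU z Hz)).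
Qed.

Lemma Ck_ext k (U : C -> Prop) (f g : C -> R) :
  open U -> (forall w, U w -> f w = g w) -> Ck k U f -> Ck k U g.
Proof.
  intros HU; revert f g; induction k as [|k IH]; intros f g E H.
  - intros z Hz; eapply continuous_ext_open; eauto.
  - destruct H as [H [H1 H2]]; split; [| split].
    + intros z Hz; destruct (Ck_partials (k := k) (conj H (conj H1 H2)) Hz) as [P1 P2].
      destruct (partials_ext HU Hz E (conj P1 P2)) as [Q1 Q2].
      split; eexists; eassumption.
    + apply (IH (D1 f)); [| exact H1]; intros w Hw; apply (D_ext HU Hw E).
    + apply (IH (D2 f)); [| exact H2]; intros w Hw; apply (D_ext HU Hw E).
Qed.

(** This drives the inductions on k: explicit formulas for the derivatives replace [D1 f] and
    [D2 f], which agree with them on U only. *)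
Lemma Ck_intro k (U : C -> Prop) (f f1 f2 : C -> R) :
  open U -> (forall z, U z -> partials f z (f1 z) (f2 z)) ->
  Ck k U f1 -> Ck k U f2 -> Ck (S k) U f.
Proof.
  intros HU H H1 H2; split; [| split].
  - intros z Hz; destruct (H z Hz) as [P1 P2]; split; eexists; eassumption.
  - apply (@Ck_ext k U f1); auto; intros w Hw; symmetry; apply (partials_D (H w Hw)).
  - apply (@Ck_ext k U f2); auto; intros w Hw; symmetry; apply (partials_D (H w Hw)).
Qed.

(** [D1] and [D2] are total operators that do not depend on the domain, so [Ck] is a condition at
    each point separately and W may be any set containing z. *)
Lemma Ck_local k (U : C -> Prop) (f : C -> R) :
  (forall z, U z -> exists W : C -> Prop, W z /\ Ck k W f) -> Ck k U f.
Proof.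
  revert f; induction k as [|k IH]; intros f H.
  - intros z Hz; destruct (H z Hz) as [W [Wz HW]]; apply HW, Wz.
  - split; [| split].
    + intros z Hz; destruct (H z Hz) as [W [Wz HW]]; apply HW, Wz.
    + apply IH; intros z Hz; destruct (H z Hz) as [W [Wz HW]]; exists W; split; [auto | apply HW].
    + apply IH; intros z Hz; destruct (H z Hz) as [W [Wz HW]]; exists W; split; [auto | apply HW].
Qed.

Lemma Ck_sub k (U W : C -> Prop) (f : C -> R) :
  (forall z, W z -> U z) -> Ck k U f -> Ck k W f.
Proof. intros S H; apply Ck_local; intros z Hz; exists U; auto. Qed.

Lemma smooth_sub (U W : C -> Prop) (f : C -> R) :
  (forall z, W z -> U z) -> smooth U f -> smooth W f.
Proof. intros S H k; eapply Ck_sub; eauto. Qed.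

Lemma continuous_continuity_2d (f : C -> R) z :
  continuous f z <-> continuity_2d_pt (fun x y => f (x, y)) (fst z) (snd z).
Proof.
  rewrite continuity_2d_pt_filterlim; destruct z as [x y]; simpl.
  split; apply filterlim_ext; intros [a b]; reflexivity.
Qed.

(** Continuous partial derivatives give a total differential; the chain rule [partials_comp] and the
    continuity of C^1 functions both rest on it. *)
Lemma Ck_differentiable (U : C -> Prop) (f : C -> R) z :
  open U -> Ck 1 U f -> U z ->
  differentiable_pt_lim (fun x y => f (x, y)) (fst z) (snd z) (D1 f z) (D2 f z).
Proof.
  intros HU [H [H1 H2]] Hz.
  destruct z as [x y]; apply filterdiff_differentiable_pt_lim.
  apply (is_derive_filterdiff (fun x y => f (x, y)) x y (fun x y => D1 f (x, y))).
  - generalize (HU _ Hz); apply filter_imp; intros [a b] Hab.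
    apply Derive_correct, (H (a, b) Hab).
  - apply Derive_correct, (H (x, y) Hz).
  - apply continuous_ext with (D1 f); [intros [a b]; reflexivity | apply H1, Hz].
Qed.

Lemma Ck1_continuous (U : C -> Prop) (f : C -> R) z :
  open U -> Ck 1 U f -> U z -> continuous f z.
Proof.
  intros HU H Hz; apply continuous_continuity_2d, differentiable_continuity_pt.
  eexists; eexists; apply (Ck_differentiable HU H Hz).
Qed.

Lemma Ck_S k (U : C -> Prop) (f : C -> R) : open U -> Ck (S k) U f -> Ck k U f.
Proof.
  intros HU; revert f; induction k as [|k IH]; intros f H.
  - intros z Hz; eapply Ck1_continuous; eauto.
  - destruct H as [H [H1 H2]]; split; [exact H |]; split; apply IH; assumption.
Qed.

Lemma Ck_const k (U : C -> Prop) (c : R) : open U -> Ck k U (fun _ => c).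
Proof.
  intros HU; revert c; induction k as [|k IH]; intros c.
  - intros z _; apply continuous_const.
  - apply (@Ck_intro k U _ (fun _ => 0) (fun _ => 0)); auto.
    intros z _; split; apply @is_derive_const.
Qed.

Lemma partials_plus f g z a b a' b' :
  partials f z a b -> partials g z a' b' ->
  partials (fun w => f w + g w) z (a + a') (b + b').
Proof. intros [H1 H2] [H3 H4]; split; apply @is_derive_plus; assumption. Qed.

Lemma partials_opp f z a b :
  partials f z a b -> partials (fun w => - f w) z (- a) (- b).
Proof. intros [H1 H2]; split; apply @is_derive_opp; assumption. Qed.

Lemma partials_mult f g z a b a' b' :
  partials f z a b -> partials g z a' b' ->
  partials (fun w => f w * g w) z (a * g z + f z * a') (b * g z + f z * b').
Proof.
  rewrite (surjective_pairing z); intros [H1 H2] [H3 H4]; split.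
  - apply (is_derive_mult (fun t => f (t, snd z)) (fun t => g (t, snd z))); auto.
    intros; apply Rmult_comm.
  - apply (is_derive_mult (fun t => f (fst z, t)) (fun t => g (fst z, t))); auto.
    intros; apply Rmult_comm.
Qed.

Lemma partials_inv f z a b :
  partials f z a b -> f z <> 0 ->
  partials (fun w => / f w) z (- a * (/ f z * / f z)) (- b * (/ f z * / f z)).
Proof.
  rewrite (surjective_pairing z); intros [H1 H2] H0; split.
  - replace (- a * (/ f (fst z, snd z) * / f (fst z, snd z)))
      with (- a / f (fst z, snd z) ^ 2) by (simpl in *; field; exact H0).
    apply (is_derive_inv (fun t => f (t, snd z))); assumption.
  - replace (- b * (/ f (fst z, snd z) * / f (fst z, snd z)))
      with (- b / f (fst z, snd z) ^ 2) by (simpl in *; field; exact H0).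
    apply (is_derive_inv (fun t => f (fst z, t))); assumption.
Qed.

Lemma Ck_plus k (U : C -> Prop) (f g : C -> R) :
  open U -> Ck k U f -> Ck k U g -> Ck k U (fun w => f w + g w).
Proof.
  intros HU; revert f g; induction k as [|k IH]; intros f g Hf Hg.
  - intros z Hz; apply @continuous_plus; auto.
  - apply (@Ck_intro k U _ (fun w => D1 f w + D1 g w) (fun w => D2 f w + D2 g w)); auto.
    + intros z Hz; apply partials_plus; eapply Ck_partials; eauto.
    + apply IH; [apply Hf | apply Hg].
    + apply IH; [apply Hf | apply Hg].
Qed.

Lemma Ck_opp k (U : C -> Prop) (f : C -> R) :
  open U -> Ck k U f -> Ck k U (fun w => - f w).
Proof.
  intros HU; revert f; induction k as [|k IH]; intros f Hf.
  - intros z Hz; apply @continuous_opp; auto.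
  - apply (@Ck_intro k U _ (fun w => - D1 f w) (fun w => - D2 f w)); auto.
    + intros z Hz; apply partials_opp; eapply Ck_partials; eauto.
    + apply IH; apply Hf.
    + apply IH; apply Hf.
Qed.

Lemma Ck_mult k (U : C -> Prop) (f g : C -> R) :
  open U -> Ck k U f -> Ck k U g -> Ck k U (fun w => f w * g w).
Proof.
  intros HU; revert f g; induction k as [|k IH]; intros f g Hf Hg.
  - intros z Hz; apply @continuous_mult; auto.
  - apply (@Ck_intro k U _ (fun w => D1 f w * g w + f w * D1 g w)
             (fun w => D2 f w * g w + f w * D2 g w)); auto.
    + intros z Hz; apply partials_mult; eapply Ck_partials; eauto.
    + apply Ck_plus; auto; apply IH; (apply Hf || apply Hg || apply Ck_S; assumption).
    + apply Ck_plus; auto; apply IH; (apply Hf || apply Hg || apply Ck_S; assumption).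
Qed.

Lemma Ck_inv k (U : C -> Prop) (f : C -> R) :
  open U -> Ck k U f -> (forall z, U z -> f z <> 0) -> Ck k U (fun w => / f w).
Proof.
  intros HU; revert f; induction k as [|k IH]; intros f Hf H0.
  - intros z Hz; apply (continuous_comp f Rinv); auto.
    apply continuous_Rinv; auto.
  - apply (@Ck_intro k U _ (fun w => - D1 f w * (/ f w * / f w))
             (fun w => - D2 f w * (/ f w * / f w))); auto.
    + intros z Hz; apply partials_inv; auto; eapply Ck_partials; eauto.
    + apply Ck_mult; auto; [apply Ck_opp; auto; apply Hf |].
      apply Ck_mult; auto; apply IH; auto; apply Ck_S; auto.
    + apply Ck_mult; auto; [apply Ck_opp; auto; apply Hf |].
      apply Ck_mult; auto; apply IH; auto; apply Ck_S; auto.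
Qed.

Lemma partials_comp (U : C -> Prop) (f : C -> R) (tau : C -> C) z a b a' b' :
  open U -> Ck 1 U f -> U (tau z) ->
  partials (fun w => Re (tau w)) z a b -> partials (fun w => Im (tau w)) z a' b' ->
  partials (fun w => f (tau w)) z
    (D1 f (tau z) * a + D2 f (tau z) * a') (D1 f (tau z) * b + D2 f (tau z) * b').
Proof.
  intros HU Hf Hz [H1 H2] [H3 H4].
  pose proof (Ck_differentiable HU Hf Hz) as D.
  assert (E : forall w, f (tau w) = (fun x y => f (x, y)) (Re (tau w)) (Im (tau w)))
    by (intros w; unfold Re, Im; simpl; now rewrite <- surjective_pairing).
  destruct z as [x y]; simpl in *; split.
  - eapply is_derive_ext; [intros t; symmetry; apply E |].
    apply is_derive_Reals.
    apply (derivable_pt_lim_comp_2d (fun x y => f (x, y))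
      (fun t => Re (tau (t, y))) (fun t => Im (tau (t, y)))); [exact D | |];
    apply is_derive_Reals; assumption.
  - eapply is_derive_ext; [intros t; symmetry; apply E |].
    apply is_derive_Reals.
    apply (derivable_pt_lim_comp_2d (fun x y => f (x, y))
      (fun t => Re (tau (x, t))) (fun t => Im (tau (x, t)))); [exact D | |];
    apply is_derive_Reals; assumption.
Qed.

Lemma Ck_comp k (U W : C -> Prop) (f : C -> R) (tau : C -> C) :
  open U -> open W -> (forall z, W z -> U (tau z)) ->
  Ck k U f -> Ck k W (fun w => Re (tau w)) -> Ck k W (fun w => Im (tau w)) ->
  Ck k W (fun w => f (tau w)).
Proof.
  intros HU HW HT; revert f; induction k as [|k IH]; intros f Hf H1 H2.
  - intros z Hz.
    apply continuous_ext with (fun w => f (Re (tau w), Im (tau w))).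
    { intros w; unfold Re, Im; now rewrite <- surjective_pairing. }
    apply (continuous_comp_2 (fun w => Re (tau w)) (fun w => Im (tau w)) (fun x y => f (x, y))).
    + apply H1, Hz.
    + apply H2, Hz.
    + apply continuous_ext with f; [intros [x y]; reflexivity |].
      unfold Re, Im; rewrite <- surjective_pairing; apply Hf, HT, Hz.
  - assert (L : forall n, Ck (S n) U f -> Ck 1 U f).
    { induction n; auto; intros; apply IHn, Ck_S; auto. }
    apply (@Ck_intro k W _
      (fun w => D1 f (tau w) * D1 (fun w => Re (tau w)) w + D2 f (tau w) * D1 (fun w => Im (tau w)) w)
      (fun w => D1 f (tau w) * D2 (fun w => Re (tau w)) w + D2 f (tau w) * D2 (fun w => Im (tau w)) w)); auto.
    + intros z Hz; apply (@partials_comp U); eauto; eapply Ck_partials; eauto.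
    + apply Ck_plus; auto; apply Ck_mult; auto; try apply H1; try apply H2;
      apply IH; try apply Hf; apply Ck_S; auto.
    + apply Ck_plus; auto; apply Ck_mult; auto; try apply H1; try apply H2;
      apply IH; try apply Hf; apply Ck_S; auto.
Qed.

Lemma D1_D2_comm (U : C -> Prop) (f : C -> R) z :
  open U -> Ck 2 U f -> U z -> D1 (D2 f) z = D2 (D1 f) z.
Proof.
  intros HU Hf Hz; pose proof Hf as [H [H1 H2]].
  assert (C1 := proj1 (proj2 H1)); assert (C2 := proj2 (proj2 H1)).
  assert (C3 := proj1 (proj2 H2)).
  apply (Schwarz (fun x y => f (x, y)) (fst z) (snd z)).
  - apply (open_locally_2d HU Hz); intros x y Hxy.
    destruct (H _ Hxy) as [E1 E2], (proj1 H1 _ Hxy) as [E3 E4], (proj1 H2 _ Hxy) as [E5 E6].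
    exact (conj E1 (conj E2 (conj E5 E4))).
  - exact (proj1 (continuous_continuity_2d (D1 (D2 f)) z) (C3 z Hz)).
  - exact (proj1 (continuous_continuity_2d (D2 (D1 f)) z) (C2 z Hz)).
Qed.

(** * Wirtinger derivatives *)

(* dF = a dz + b dconj(z) at z, that is F_x = a + b and F_y = i (a - b). *)
Definition wirtinger (F : C -> C) (z a b : C) : Prop :=
  partials (fun w => Re (F w)) z (Re (a + b)) (Re (Ci * (a - b))) /\
  partials (fun w => Im (F w)) z (Im (a + b)) (Im (Ci * (a - b))).

(** Together with [dzb]: the operators (F_x - i F_y)/2 and (F_x + i F_y)/2 in components.
    Differences are written as sums with an opposite, and halves as products, so that the rules for
    [partials] apply to [dz F] and [dzb F] syntactically. *)
Definition dz (F : C -> C) (z : C) : C :=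
  ((D1 (fun w => Re (F w)) z + D2 (fun w => Im (F w)) z) * / 2,
   (D1 (fun w => Im (F w)) z + - D2 (fun w => Re (F w)) z) * / 2).

Definition dzb (F : C -> C) (z : C) : C :=
  ((D1 (fun w => Re (F w)) z + - D2 (fun w => Im (F w)) z) * / 2,
   (D1 (fun w => Im (F w)) z + D2 (fun w => Re (F w)) z) * / 2).

Definition Ck2 (k : nat) (U : C -> Prop) (F : C -> C) : Prop :=
  Ck k U (fun z => Re (F z)) /\ Ck k U (fun z => Im (F z)).

Lemma partials_eq f z a b a' b' :
  partials f z a b -> a = a' -> b = b' -> partials f z a' b'.
Proof. now intros H <- <-. Qed.

Lemma wirtinger_eq F z a b a' b' :
  wirtinger F z a b -> a = a' -> b = b' -> wirtinger F z a' b'.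
Proof. now intros H <- <-. Qed.

Lemma wirtinger_unique F z a b : wirtinger F z a b -> dz F z = a /\ dzb F z = b.
Proof.
  intros [H1 H2]; apply partials_D in H1 as [E1 E2]; apply partials_D in H2 as [E3 E4].
  unfold dz, dzb; rewrite E1, E2, E3, E4; destruct a as [a1 a2], b as [b1 b2]; simpl.
  split; apply injective_projections; simpl; field.
Qed.

Lemma Ck2_wirtinger k (U : C -> Prop) F z :
  Ck2 (S k) U F -> U z -> wirtinger F z (dz F z) (dzb F z).
Proof.
  intros [H1 H2] Hz; split.
  - apply (partials_eq (Ck_partials H1 Hz)); unfold dz, dzb; simpl; field.
  - apply (partials_eq (Ck_partials H2 Hz)); unfold dz, dzb; simpl; field.
Qed.

Lemma wirtinger_ext (U : C -> Prop) F G z a b :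
  open U -> U z -> (forall w, U w -> F w = G w) -> wirtinger F z a b -> wirtinger G z a b.
Proof.
  intros HU Hz E [H1 H2]; split.
  - apply (partials_ext HU Hz (f := fun w => Re (F w))); auto; intros w Hw; now rewrite (E w Hw).
  - apply (partials_ext HU Hz (f := fun w => Im (F w))); auto; intros w Hw; now rewrite (E w Hw).
Qed.

Lemma partials_const c z : partials (fun _ => c) z 0 0.
Proof. split; apply @is_derive_const. Qed.

Lemma wirtinger_const c z : wirtinger (fun _ => c) z 0 0.
Proof. split; apply (partials_eq (partials_const _ _)); simpl; ring. Qed.

Lemma wirtinger_plus F G z a b a' b' :
  wirtinger F z a b -> wirtinger G z a' b' ->
  wirtinger (fun w => F w + G w)%C z (a + a') (b + b').
Proof.
  intros [H1 H2] [H3 H4]; split.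
  - apply (partials_eq (partials_plus H1 H3)); simpl; ring.
  - apply (partials_eq (partials_plus H2 H4)); simpl; ring.
Qed.

Lemma wirtinger_opp F z a b :
  wirtinger F z a b -> wirtinger (fun w => - F w)%C z (- a) (- b).
Proof.
  intros [H1 H2]; split.
  - apply (partials_eq (partials_opp H1)); simpl; ring.
  - apply (partials_eq (partials_opp H2)); simpl; ring.
Qed.

Lemma wirtinger_minus F G z a b a' b' :
  wirtinger F z a b -> wirtinger G z a' b' ->
  wirtinger (fun w => F w - G w)%C z (a - a') (b - b').
Proof. intros HF HG; apply (wirtinger_plus HF (wirtinger_opp HG)). Qed.

Lemma wirtinger_conj F z a b :
  wirtinger F z a b -> wirtinger (fun w => Cconj (F w)) z (Cconj b) (Cconj a).
Proof.
  intros [H1 H2]; split.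
  - apply (partials_eq H1); simpl; ring.
  - apply (partials_eq (partials_opp H2)); simpl; ring.
Qed.

Lemma wirtinger_mult F G z a b a' b' :
  wirtinger F z a b -> wirtinger G z a' b' ->
  wirtinger (fun w => F w * G w)%C z (a * G z + F z * a') (b * G z + F z * b').
Proof.
  intros [H1 H2] [H3 H4]; split.
  - apply (partials_eq (partials_plus (partials_mult H1 H3)
             (partials_opp (partials_mult H2 H4)))); simpl; unfold Re, Im; ring.
  - apply (partials_eq (partials_plus (partials_mult H1 H4)
             (partials_mult H2 H3))); simpl; unfold Re, Im; ring.
Qed.

Lemma partials_fun f g z a b :
  (forall w, f w = g w) -> partials f z a b -> partials g z a b.
Proof.
  intros E [H1 H2]; split;
    (eapply is_derive_ext; [intros t; apply E | assumption]).
Qed.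

Lemma C_sqnorm_neq_0 (x : C) : x <> 0 -> Re x * Re x + Im x * Im x <> 0.
Proof.
  intros Hx E; apply Hx; destruct x as [u v]; simpl in E.
  apply injective_projections; simpl; nra.
Qed.

Lemma Cinv_alt (x : C) :
  (/ x)%C = (Re x * / (Re x * Re x + Im x * Im x), - Im x * / (Re x * Re x + Im x * Im x)).
Proof.
  unfold Cinv, Rdiv, Re, Im; simpl; rewrite !Rmult_1_r; reflexivity.
Qed.

Lemma wirtinger_inv F z a b :
  wirtinger F z a b -> F z <> 0 ->
  wirtinger (fun w => / F w)%C z (- a / (F z * F z)) (- b / (F z * F z)).
Proof.
  intros [H1 H2] H0.
  assert (N := C_sqnorm_neq_0 H0).
  assert (Q := partials_inv (partials_plus (partials_mult H1 H1) (partials_mult H2 H2)) N).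
  split.
  - apply (partials_fun (fun w => eq_sym (f_equal Re (Cinv_alt (F w))))); simpl.
    apply (partials_eq (partials_mult H1 Q)); destruct (F z) as [u v], a as [a1 a2], b as [b1 b2];
      simpl in *; field; (split; [| exact N]);
      replace (_ + _) with ((u * u + v * v) * (u * u + v * v)) by ring;
      apply Rmult_integral_contrapositive; split; exact N.
  - apply (partials_fun (fun w => eq_sym (f_equal Im (Cinv_alt (F w))))); simpl.
    apply (partials_eq (partials_mult (partials_opp H2) Q)); destruct (F z) as [u v], a as [a1 a2], b as [b1 b2];
      simpl in *; field; (split; [| exact N]);
      replace (_ + _) with ((u * u + v * v) * (u * u + v * v)) by ring;
      apply Rmult_integral_contrapositive; split; exact N.
Qed.

Lemma Ck2_ext k (U : C -> Prop) F G :
  open U -> (forall w, U w -> F w = G w) -> Ck2 k U F -> Ck2 k U G.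
Proof.
  intros HU E [H1 H2]; split.
  - apply (@Ck_ext k U (fun z => Re (F z))); auto; intros w Hw; now rewrite (E w Hw).
  - apply (@Ck_ext k U (fun z => Im (F z))); auto; intros w Hw; now rewrite (E w Hw).
Qed.

Lemma Ck2_S k (U : C -> Prop) F : open U -> Ck2 (S k) U F -> Ck2 k U F.
Proof. intros HU [H1 H2]; split; apply Ck_S; assumption. Qed.

Lemma Ck2_const k (U : C -> Prop) c : open U -> Ck2 k U (fun _ => c).
Proof. intros HU; split; apply Ck_const; assumption. Qed.

Lemma Ck2_real k (U : C -> Prop) f : open U -> Ck k U f -> Ck2 k U (fun z => RtoC (f z)).
Proof. intros HU H; split; [exact H | apply (Ck_const k 0 HU)]. Qed.

Lemma Ck2_plus k (U : C -> Prop) F G :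
  open U -> Ck2 k U F -> Ck2 k U G -> Ck2 k U (fun z => F z + G z)%C.
Proof. intros HU [H1 H2] [H3 H4]; split; simpl; apply Ck_plus; assumption. Qed.

Lemma Ck2_opp k (U : C -> Prop) F : open U -> Ck2 k U F -> Ck2 k U (fun z => - F z)%C.
Proof. intros HU [H1 H2]; split; simpl; apply Ck_opp; assumption. Qed.

Lemma Ck2_minus k (U : C -> Prop) F G :
  open U -> Ck2 k U F -> Ck2 k U G -> Ck2 k U (fun z => F z - G z)%C.
Proof. intros HU H1 H2; apply Ck2_plus; auto; apply Ck2_opp; auto. Qed.

Lemma Ck2_conj k (U : C -> Prop) F : open U -> Ck2 k U F -> Ck2 k U (fun z => Cconj (F z)).
Proof. intros HU [H1 H2]; split; [exact H1 |]; apply Ck_opp; assumption. Qed.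

Lemma Ck2_mult k (U : C -> Prop) F G :
  open U -> Ck2 k U F -> Ck2 k U G -> Ck2 k U (fun z => F z * G z)%C.
Proof.
  intros HU [H1 H2] [H3 H4]; split; simpl.
  - apply Ck_plus; auto; [| apply Ck_opp; auto]; apply Ck_mult; assumption.
  - apply Ck_plus; auto; apply Ck_mult; assumption.
Qed.

Lemma Ck2_inv k (U : C -> Prop) F :
  open U -> Ck2 k U F -> (forall z, U z -> F z <> 0) -> Ck2 k U (fun z => / F z)%C.
Proof.
  intros HU [H1 H2] H0.
  assert (Q : Ck k U (fun z => / (Re (F z) * Re (F z) + Im (F z) * Im (F z)))).
  { apply Ck_inv; auto.
    - apply Ck_plus; auto; apply Ck_mult; auto.
    - intros z Hz; apply C_sqnorm_neq_0, H0, Hz. }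
  split.
  - apply (Ck_ext (f := fun z => Re (F z) * / (Re (F z) * Re (F z) + Im (F z) * Im (F z)))); auto.
    + intros w _; now rewrite Cinv_alt.
    + apply Ck_mult; auto.
  - apply (Ck_ext (f := fun z => - Im (F z) * / (Re (F z) * Re (F z) + Im (F z) * Im (F z)))); auto.
    + intros w _; now rewrite Cinv_alt.
    + apply Ck_mult; auto; apply Ck_opp; auto.
Qed.

Lemma Ck2_div k (U : C -> Prop) F G :
  open U -> Ck2 k U F -> Ck2 k U G -> (forall z, U z -> G z <> 0) ->
  Ck2 k U (fun z => F z / G z)%C.
Proof. intros HU H1 H2 H0; apply Ck2_mult; auto; apply Ck2_inv; auto. Qed.

Lemma Ck2_dz k (U : C -> Prop) F : open U -> Ck2 (S k) U F -> Ck2 k U (dz F).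
Proof.
  intros HU [[_ [H1 H2]] [_ [H3 H4]]]; split; unfold dz; simpl;
    apply Ck_mult; auto using Ck_const, Ck_plus, Ck_opp.
Qed.

Lemma Ck2_dzb k (U : C -> Prop) F : open U -> Ck2 (S k) U F -> Ck2 k U (dzb F).
Proof.
  intros HU [[_ [H1 H2]] [_ [H3 H4]]]; split; unfold dzb; simpl;
    apply Ck_mult; auto using Ck_const, Ck_plus, Ck_opp.
Qed.

Lemma Ck2_intro k (U : C -> Prop) F a b :
  open U -> (forall z, U z -> wirtinger F z (a z) (b z)) ->
  Ck2 k U a -> Ck2 k U b -> Ck2 (S k) U F.
Proof.
  intros HU H [A1 A2] [B1 B2]; split.
  - apply (Ck_intro (f1 := fun z => Re (a z) + Re (b z))
                    (f2 := fun z => - (Im (a z) + - Im (b z)))); auto using Ck_plus, Ck_opp.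
    intros z Hz; destruct (H z Hz) as [H1 _]; apply (partials_eq H1); simpl; unfold Re, Im; ring.
  - apply (Ck_intro (f1 := fun z => Im (a z) + Im (b z))
                    (f2 := fun z => Re (a z) + - Re (b z))); auto using Ck_plus, Ck_opp.
    intros z Hz; destruct (H z Hz) as [_ H1]; apply (partials_eq H1); simpl; unfold Re, Im; ring.
Qed.

Lemma dz_ext (U : C -> Prop) F G z :
  open U -> U z -> (forall w, U w -> F w = G w) -> dz F z = dz G z /\ dzb F z = dzb G z.
Proof.
  intros HU Hz E; unfold dz, dzb.
  destruct (@D_ext U (fun w => Re (F w)) (fun w => Re (G w)) z) as [-> ->]; auto.
  { intros w Hw; now rewrite E. }
  destruct (@D_ext U (fun w => Im (F w)) (fun w => Im (G w)) z) as [-> ->]; auto.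
  intros w Hw; now rewrite E.
Qed.

Lemma dz_dzb_comm (U : C -> Prop) F z :
  open U -> Ck2 2 U F -> U z -> dz (dzb F) z = dzb (dz F) z.
Proof.
  intros HU [HR HI] Hz.
  assert (K1 : forall f, Ck 2 U f -> Ck 1 U (D1 f) /\ Ck 1 U (D2 f)) by (intros f Hf; apply Hf).
  destruct (K1 _ HR) as [R1 R2], (K1 _ HI) as [I1 I2]; clear K1.
  apply (fun H => Ck_partials H Hz) in R1, R2, I1, I2.
  assert (SR := D1_D2_comm HU HR Hz); assert (SI := D1_D2_comm HU HI Hz).
  rewrite <- SR in R1; rewrite <- SI in I1.
  set (re := fun w => Re (F w)) in *; set (im := fun w => Im (F w)) in *.
  assert (K := fun c => partials_const c z).
  assert (A1 := partials_D (partials_mult (partials_plus R1 I2) (K (/ 2)))).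
  assert (A2 := partials_D (partials_mult (partials_plus I1 (partials_opp R2)) (K (/ 2)))).
  assert (B1 := partials_D (partials_mult (partials_plus R1 (partials_opp I2)) (K (/ 2)))).
  assert (B2 := partials_D (partials_mult (partials_plus I1 R2) (K (/ 2)))).
  unfold dz at 1; unfold dzb at 3; simpl.
  unfold dz, dzb; simpl; fold re im.
  destruct A1 as [-> ->], A2 as [-> ->], B1 as [-> ->], B2 as [-> ->].
  apply injective_projections; simpl; ring.
Qed.

Definition laplacian (f : C -> R) (z : C) : R := D1 (D1 f) z + D2 (D2 f) z.

Lemma dzb_dz_laplacian (U : C -> Prop) F z :
  open U -> Ck2 2 U F -> U z ->
  dzb (dz F) z =
  (laplacian (fun w => Re (F w)) z / 4, laplacian (fun w => Im (F w)) z / 4).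
Proof.
  intros HU [HR HI] Hz.
  assert (K1 : forall f, Ck 2 U f -> Ck 1 U (D1 f) /\ Ck 1 U (D2 f)) by (intros f Hf; apply Hf).
  destruct (K1 _ HR) as [R1 R2], (K1 _ HI) as [I1 I2]; clear K1.
  apply (fun H => Ck_partials H Hz) in R1, R2, I1, I2.
  assert (SR := D1_D2_comm HU HR Hz); assert (SI := D1_D2_comm HU HI Hz).
  rewrite <- SR in R1; rewrite <- SI in I1.
  set (re := fun w => Re (F w)) in *; set (im := fun w => Im (F w)) in *.
  assert (K := fun c => partials_const c z).
  assert (A1 := partials_D (partials_mult (partials_plus R1 I2) (K (/ 2)))).
  assert (A2 := partials_D (partials_mult (partials_plus I1 (partials_opp R2)) (K (/ 2)))).
  unfold dzb; simpl; unfold dz; simpl; fold re im.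
  destruct A1 as [-> ->], A2 as [-> ->]; unfold laplacian.
  apply injective_projections; simpl; field.
Qed.

(** * Complex derivatives and the Cauchy-Riemann equations *)

Lemma is_derive_norm (K : AbsRing) (V : NormedModule K) (f : K -> V) x l :
  is_derive f x l <->
  forall eps : posreal, locally x (fun y =>
    norm (minus (minus (f y) (f x)) (scal (minus y x) l)) <= eps * norm (minus y x)).
Proof.
  split.
  - intros [_ H]; apply (H x); intros P HP; exact HP.
  - intros H; split; [apply is_linear_scal_l |].
    (* The little-o condition is asked at every limit point y of the neighbourhood filter of x, and
       x is the only one. *)
    intros y Hy eps; rewrite <- (is_filter_lim_locally_unique x y Hy); apply H.
Qed.

Lemma C_is_derive_partials (F : C -> C) z l :
  @is_derive C_AbsRing C_NormedModule F z l -> wirtinger F z l 0.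
Proof.
  rewrite is_derive_norm; intros H.
  (* [locally_C] exchanges neighbourhoods for the modulus with those of the product R * R, in which
     horizontal and vertical increments can be isolated. *)
  assert (X : forall eps : posreal, exists d : posreal, forall w : C, @ball C_UniformSpace z d w ->
    Cmod (F w - F z - (w - z) * l)%C <= eps * Cmod (w - z)%C).
  { intros eps; destruct (proj2 (locally_C z _) (H eps)) as [d Hd]; exists d; exact Hd. }
  clear H; destruct z as [x y].
  assert (X1 : forall eps : posreal, exists d : posreal, forall t, Rabs (t - x) < d ->
    Cmod (F (t, y) - F (x, y) - RtoC (t - x) * l)%C <= eps * Rabs (t - x)).
  { intros eps; destruct (X eps) as [d Hd]; exists d; intros t Ht.
    assert (B : @ball C_UniformSpace (x, y) d (t, y)) by (split; [exact Ht | apply ball_center]).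
    specialize (Hd _ B).
    replace ((t, y) - (x, y))%C with (RtoC (t - x)) in Hd
      by (apply injective_projections; simpl; ring).
    rewrite Cmod_R in Hd; exact Hd. }
  assert (X2 : forall eps : posreal, exists d : posreal, forall t, Rabs (t - y) < d ->
    Cmod (F (x, t) - F (x, y) - Ci * RtoC (t - y) * l)%C <= eps * Rabs (t - y)).
  { intros eps; destruct (X eps) as [d Hd]; exists d; intros t Ht.
    assert (B : @ball C_UniformSpace (x, y) d (x, t)) by (split; [apply ball_center | exact Ht]).
    specialize (Hd _ B).
    replace ((x, t) - (x, y))%C with (Ci * RtoC (t - y))%C in Hd
      by (apply injective_projections; simpl; ring).
    rewrite (Cmod_mult Ci), Cmod_R in Hd; replace (Cmod Ci) with 1 in Hd;
      [rewrite Rmult_1_l in Hd; exact Hd |].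
    unfold Cmod; simpl; replace (0 * (0 * 1) + 1 * (1 * 1)) with 1 by ring; now rewrite sqrt_1. }
  clear X.
  assert (cre : forall u : C, Rabs (fst u) <= Cmod u)
    by (intros u; eapply Rle_trans; [apply Rmax_l | apply Rmax_Cmod]).
  assert (cim : forall u : C, Rabs (snd u) <= Cmod u)
    by (intros u; eapply Rle_trans; [apply Rmax_r | apply Rmax_Cmod]).
  split; split; simpl; apply is_derive_norm; intros eps.
  - destruct (X1 eps) as [d Hd]; exists d; intros t Ht.
    eapply Rle_trans; [| apply (Hd t Ht)]; eapply Rle_trans; [right | apply cre].
    apply f_equal; unfold minus, plus, opp, scal, mult; simpl; unfold mult; simpl; unfold Re, Im; ring.
  - destruct (X2 eps) as [d Hd]; exists d; intros t Ht.
    eapply Rle_trans; [| apply (Hd t Ht)]; eapply Rle_trans; [right | apply cre].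
    apply f_equal; unfold minus, plus, opp, scal, mult; simpl; unfold mult; simpl; unfold Re, Im; ring.
  - destruct (X1 eps) as [d Hd]; exists d; intros t Ht.
    eapply Rle_trans; [| apply (Hd t Ht)]; eapply Rle_trans; [right | apply cim].
    apply f_equal; unfold minus, plus, opp, scal, mult; simpl; unfold mult; simpl; unfold Re, Im; ring.
  - destruct (X2 eps) as [d Hd]; exists d; intros t Ht.
    eapply Rle_trans; [| apply (Hd t Ht)]; eapply Rle_trans; [right | apply cim].
    apply f_equal; unfold minus, plus, opp, scal, mult; simpl; unfold mult; simpl; unfold Re, Im; ring.
Qed.

Lemma C_derive_wirtinger (U : C -> Prop) F z :
  holomorphic U F -> U z -> wirtinger F z (C_derive F z) 0.
Proof.
  intros H Hz; destruct (H z Hz) as [l Hl].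
  rewrite (is_C_derive_unique _ _ _ Hl); apply C_is_derive_partials, Hl.
Qed.

Lemma Ck2_is_C_derive (U : C -> Prop) F z a :
  open U -> Ck2 1 U F -> U z -> wirtinger F z a 0 ->
  @is_derive C_AbsRing C_NormedModule F z a.
Proof.
  intros HU [HR HI] Hz [W1 W2].
  assert (D1 := Ck_differentiable HU HR Hz); assert (D2 := Ck_differentiable HU HI Hz).
  destruct (partials_D W1) as [E1 E2], (partials_D W2) as [E3 E4].
  rewrite E1, E2 in D1; rewrite E3, E4 in D2; clear E1 E2 E3 E4 W1 W2.
  apply is_derive_norm; intros eps.
  (* Half of eps for each of Re and Im, whose errors are added through |p| <= |Re p| + |Im p|. *)
  assert (He : 0 < eps / 2) by (destruct eps; simpl; lra).
  destruct (D1 (mkposreal _ He)) as [d1 H1], (D2 (mkposreal _ He)) as [d2 H2].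
  apply locally_C.
  exists (mkposreal _ (Rmin_pos _ _ (cond_pos d1) (cond_pos d2))).
  intros [u v] [Hu Hv]; simpl in Hu, Hv.
  destruct z as [x y]; simpl in *.
  change (Rabs (u - x) < Rmin d1 d2) in Hu; change (Rabs (v - y) < Rmin d1 d2) in Hv.
  specialize (H1 u v (Rlt_le_trans _ _ _ Hu (Rmin_l _ _)) (Rlt_le_trans _ _ _ Hv (Rmin_l _ _))).
  specialize (H2 u v (Rlt_le_trans _ _ _ Hu (Rmin_r _ _)) (Rlt_le_trans _ _ _ Hv (Rmin_r _ _))).
  change (Cmod (F (u, v) - F (x, y) - ((u, v) - (x, y)) * a)%C <= eps * Cmod ((u, v) - (x, y))%C).
  assert (M : Rmax (Rabs (u - x)) (Rabs (v - y)) <= Cmod ((u, v) - (x, y))%C)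
    by apply (Rmax_Cmod ((u, v) - (x, y))%C).
  apply (Rmult_le_compat_l (eps / 2)) in M; [| lra].
  assert (T : forall p : C, Cmod p <= Rabs (Re p) + Rabs (Im p)).
  { intros [p q]; simpl; apply Rsqr_incr_0_var.
    - unfold Cmod; simpl; rewrite Rsqr_sqrt by nra.
      unfold Rsqr; pose proof (Rabs_pos p); pose proof (Rabs_pos q).
      assert (Rabs p * Rabs p = p * p) by (rewrite <- Rabs_mult; apply Rabs_right; nra).
      assert (Rabs q * Rabs q = q * q) by (rewrite <- Rabs_mult; apply Rabs_right; nra).
      nra.
    - pose proof (Rabs_pos p); pose proof (Rabs_pos q); lra. }
  eapply Rle_trans; [apply T |].
  match goal with |- Rabs ?A + Rabs ?B <= _ =>
    match type of H1 with Rabs ?A' <= _ => replace A with A' by (simpl; unfold Re, Im; ring) end;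
    match type of H2 with Rabs ?B' <= _ => replace B with B' by (simpl; unfold Re, Im; ring) end
  end.
  lra.
Qed.

Lemma holomorphic_Ck2_0 (U : C -> Prop) F : holomorphic U F -> Ck2 0 U F.
Proof.
  intros H; assert (X : forall z, U z -> continuous F z).
  { intros z Hz; assert (Y := ex_derive_continuous F z (H z Hz)).
    intros P HP; apply locally_C, (Y P HP). }
  split; intros z Hz.
  - apply (continuous_comp F fst); [apply (X z Hz) | apply continuous_fst].
  - apply (continuous_comp F snd); [apply (X z Hz) | apply continuous_snd].
Qed.

(** * Closed forms on squares *)

Definition closed_form (V : C -> Prop) (u v : C -> R) : Prop :=
  open V /\ Ck 1 V u /\ Ck 1 V v /\ forall z, V z -> D2 u z = D1 v z.

(* The integral of u dx + v dy along the horizontal, then vertical path from p to q. *)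
Definition elbow (u v : C -> R) (p q : C) : R :=
  RInt (fun t => u (t, snd p)) (fst p) (fst q) +
  RInt (fun t => v (fst q, t)) (snd p) (snd q).

Lemma between_in_ball (c : R) (e : R) a b t :
  Rabs (a - c) < e -> Rabs (b - c) < e -> Rmin a b <= t <= Rmax a b -> Rabs (t - c) < e.
Proof.
  intros Ha Hb; apply Rabs_lt_between' in Ha; apply Rabs_lt_between' in Hb.
  intros Ht; apply Rabs_lt_between'; revert Ht; unfold Rmin, Rmax.
  destruct (Rle_dec a b); lra.
Qed.

Lemma in_ball (c : C) (e : posreal) x y :
  Rabs (x - fst c) < e -> Rabs (y - snd c) < e -> ball c e (x, y).
Proof. intros H1 H2; split; assumption. Qed.

Lemma continuous_slice1 (f : C -> R) x y :
  continuous f (x, y) -> continuous (fun t => f (t, y)) x.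
Proof.
  intros H; apply (continuous_comp_2 (fun t => t) (fun _ => y) (fun a b => f (a, b))).
  - apply continuous_id.
  - apply continuous_const.
  - apply continuous_ext with f; [intros [a b]; reflexivity | exact H].
Qed.

Lemma continuous_slice2 (f : C -> R) x y :
  continuous f (x, y) -> continuous (fun t => f (x, t)) y.
Proof.
  intros H; apply (continuous_comp_2 (fun _ => x) (fun t => t) (fun a b => f (a, b))).
  - apply continuous_const.
  - apply continuous_id.
  - apply continuous_ext with f; [intros [a b]; reflexivity | exact H].
Qed.

(** Balls of R * R are squares for the maximum distance, so the corner of the path stays in the ball
    and the fundamental theorem of calculus applies to each leg. *)
Lemma elbow_diff (u v f : C -> R) c (e : posreal) p q :
  (forall w, ball c e w -> continuous u w /\ continuous v w /\ partials f w (u w) (v w)) ->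
  ball c e p -> ball c e q -> elbow u v p q = f q - f p.
Proof.
  intros H [Hp1 Hp2] [Hq1 Hq2]; destruct p as [px py], q as [qx qy]; simpl in *.
  assert (E1 : RInt (fun t => u (t, py)) px qx = f (qx, py) - f (px, py)).
  { apply is_RInt_unique; apply (is_RInt_derive (fun t => f (t, py)) (fun t => u (t, py))).
    - intros t Ht; apply (H (t, py)), in_ball; auto.
      eapply between_in_ball; [exact Hp1 | exact Hq1 | exact Ht].
    - intros t Ht; apply continuous_slice1, (H (t, py)), in_ball; auto.
      eapply between_in_ball; [exact Hp1 | exact Hq1 | exact Ht]. }
  assert (E2 : RInt (fun t => v (qx, t)) py qy = f (qx, qy) - f (qx, py)).
  { apply is_RInt_unique; apply (is_RInt_derive (fun t => f (qx, t)) (fun t => v (qx, t))).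
    - intros t Ht; apply (H (qx, t)), in_ball; auto.
      eapply between_in_ball; [exact Hp2 | exact Hq2 | exact Ht].
    - intros t Ht; apply continuous_slice2, (H (qx, t)), in_ball; auto.
      eapply between_in_ball; [exact Hp2 | exact Hq2 | exact Ht]. }
  unfold elbow; simpl; rewrite E1, E2; ring.
Qed.

Lemma ex_RInt_slice (f : R -> R) a b :
  (forall t, Rmin a b <= t <= Rmax a b -> continuous f t) -> ex_RInt f a b.
Proof. apply @ex_RInt_continuous. Qed.

Lemma locally_Rabs (c : R) (e : posreal) x :
  Rabs (x - c) < e -> locally x (fun y => Rabs (y - c) < e).
Proof.
  intros H; exists (mkposreal (e - Rabs (x - c)) (proj2 (Rlt_0_minus _ _) H)).
  intros y Hy; change (Rabs (y - x) < e - Rabs (x - c)) in Hy.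
  replace (y - c) with ((y - x) + (x - c)) by ring.
  eapply Rle_lt_trans; [apply Rabs_triang | lra].
Qed.

Lemma ball_open (c : C) (e : posreal) : open (fun w : C => ball c e w).
Proof.
  intros [x y] [H1 H2].
  destruct (locally_Rabs H1) as [d1 D1], (locally_Rabs H2) as [d2 D2].
  exists (mkposreal _ (Rmin_pos _ _ (cond_pos d1) (cond_pos d2))).
  intros [a b] [Ha Hb]; split; simpl in *.
  - apply D1; eapply Rlt_le_trans; [exact Ha | apply Rmin_l].
  - apply D2; eapply Rlt_le_trans; [exact Hb | apply Rmin_r].
Qed.

Lemma Rabs_center (c : R) (e : posreal) : Rabs (c - c) < e.
Proof. rewrite Rminus_diag, Rabs_R0; apply cond_pos. Qed.

(* Poincare's lemma on a square. *)
Lemma elbow_partials V u v c (e : posreal) z :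
  closed_form V u v -> (forall w, ball c e w -> V w) -> ball c e z ->
  partials (elbow u v c) z (u z) (v z).
Proof.
  intros [HV [Hu [Hv Huv]]] HB [Hz1 Hz2].
  destruct c as [cx cy], z as [x y]; simpl in Hz1, Hz2.
  assert (IB : forall a b, Rabs (a - cx) < e -> Rabs (b - cy) < e -> V (a, b))
    by (intros a b Ha Hb; apply HB; split; assumption).
  assert (Cu : forall w, V w -> continuous u w) by (intros w Hw; eapply Ck1_continuous; eauto).
  assert (Cv : forall w, V w -> continuous v w) by (intros w Hw; eapply Ck1_continuous; eauto).
  assert (Zx := Rabs_center cx e); assert (Zy := Rabs_center cy e).
  assert (RV : forall a b, Rabs (a - cx) < e -> Rabs (b - cy) < e ->
             ex_RInt (fun t => v (a, t)) cy b).
  { intros a b Ha Hb; apply ex_RInt_slice; intros t Ht; apply continuous_slice2, Cv, IB; auto.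
    eapply between_in_ball; [exact Zy | exact Hb | exact Ht]. }
  assert (RU : forall a, Rabs (a - cx) < e -> ex_RInt (fun t => u (t, cy)) cx a).
  { intros a Ha; apply ex_RInt_slice; intros t Ht; apply continuous_slice1, Cu, IB; auto.
    eapply between_in_ball; [exact Zx | exact Ha | exact Ht]. }
  split; simpl.
  (* The horizontal leg contributes u (x, cy). The vertical leg, differentiated under the integral
     sign, contributes the integral of v_x = u_y in y, which is the missing difference. *)
  - replace (u (x, y)) with (u (x, cy) + (u (x, y) - u (x, cy))) by ring.
    apply (is_derive_plus (fun a => RInt (fun t => u (t, cy)) cx a) (fun a => RInt (fun t => v (a, t)) cy y)).
    + apply (is_derive_RInt (fun t => u (t, cy)) _ cx).
      * generalize (locally_Rabs Hz1); apply filter_imp; intros a Ha; apply (@RInt_correct R_CompleteNormedModule), RU, Ha.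
      * apply continuous_slice1, Cu, IB; auto.
    + replace (u (x, y) - u (x, cy)) with (RInt (fun t => Derive (fun a => v (a, t)) x) cy y).
      * apply (is_derive_RInt_param (fun a t => v (a, t))).
        -- generalize (locally_Rabs Hz1); apply filter_imp; intros a Ha t Ht.
           apply (proj1 Hv (a, t)), IB; auto; eapply between_in_ball; [exact Zy | exact Hz2 | exact Ht].
        -- intros t Ht; refine (proj1 (continuous_continuity_2d (D1 v) (x, t)) _).
           apply (proj1 (proj2 Hv)), IB; auto.
           eapply between_in_ball; [exact Zy | exact Hz2 | exact Ht].
        -- generalize (locally_Rabs Hz1); apply filter_imp; intros a Ha; apply RV; auto.
      * apply is_RInt_unique, (is_RInt_ext (fun t => D2 u (x, t))).
        { intros t Ht; apply (Huv (x, t)), IB; auto.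
          eapply between_in_ball; [exact Zy | exact Hz2 | lra]. }
        apply (is_RInt_derive (fun t => u (x, t)) (fun t => D2 u (x, t))).
        -- intros t Ht; apply Derive_correct, (proj1 Hu (x, t)), IB; auto.
           eapply between_in_ball; [exact Zy | exact Hz2 | exact Ht].
        -- intros t Ht; apply continuous_slice2, (proj2 (proj2 Hu)), IB; auto.
           eapply between_in_ball; [exact Zy | exact Hz2 | exact Ht].
  - replace (v (x, y)) with (0 + v (x, y)) by ring.
    apply (is_derive_plus (fun _ => RInt (fun t => u (t, cy)) cx x) (fun b => RInt (fun t => v (x, t)) cy b)).
    + apply @is_derive_const.
    + apply (is_derive_RInt (fun t => v (x, t)) _ cy).
      * generalize (locally_Rabs Hz2); apply filter_imp; intros a Ha; apply (@RInt_correct R_CompleteNormedModule), RV; auto.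
      * apply continuous_slice2, Cv, IB; auto.
Qed.

(** The single primitive [elbow u v c] based at the centre evaluates all three terms. *)
Lemma elbow_cocycle V u v c (e : posreal) p q r :
  closed_form V u v -> (forall w, ball c e w -> V w) ->
  ball c e p -> ball c e q -> ball c e r ->
  elbow u v p q + elbow u v q r = elbow u v p r.
Proof.
  intros HF HB Hp Hq Hr.
  assert (X : forall w, ball c e w ->
    continuous u w /\ continuous v w /\ partials (elbow u v c) w (u w) (v w)).
  { intros w Hw; split; [| split].
    - eapply Ck1_continuous; [apply HF | apply HF | auto].
    - eapply Ck1_continuous; [apply HF | apply HF | auto].
    - eapply elbow_partials; eauto. }
  rewrite (elbow_diff X Hp Hq), (elbow_diff X Hq Hr), (elbow_diff X Hp Hr); ring.
Qed.

Lemma elbow_refl u v p : elbow u v p p = 0.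
Proof. unfold elbow; rewrite !RInt_point; apply Rplus_0_l. Qed.

(** * Sums along polygons and homotopies *)

Lemma lebesgue_number (V : C -> Prop) (H : R * R -> C) :
  open V -> (forall p, continuous H p) ->
  (forall s t, 0 <= s <= 1 -> 0 <= t <= 1 -> V (H (s, t))) ->
  exists d : posreal, forall s t, 0 <= s <= 1 -> 0 <= t <= 1 ->
    exists (c : C) (e : posreal), (forall w, ball c e w -> V w) /\
      forall s' t', Rabs (s' - s) < d -> Rabs (t' - t) < d -> ball c e (H (s', t')).
Proof.
  intros HV HH HI.
  (* The factor 2 makes room for two displacements: from (a, b) to (s, t), then from (s, t) to (s',
     t'). *)
  set (Q := fun a b (d : posreal) => exists e : posreal,
    (forall w, ball (H (a, b)) e w -> V w) /\
    forall s t, Rabs (s - a) < 2 * d -> Rabs (t - b) < 2 * d -> ball (H (a, b)) e (H (s, t))).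
  assert (X : forall a b, exists d : posreal, 0 <= a <= 1 -> 0 <= b <= 1 -> Q a b d).
  { intros a b; destruct (classic (0 <= a <= 1 /\ 0 <= b <= 1)) as [[Ha Hb] | N].
    - destruct (HV _ (HI a b Ha Hb)) as [e He].
      destruct (HH (a, b) _ (locally_ball (H (a, b)) e)) as [d Hd].
      exists (mkposreal (d / 2) (is_pos_div_2 d)); intros _ _; exists e; split; [exact He |].
      simpl; intros s t Hs Ht; apply Hd; split.
      + change (Rabs (s - a) < d); lra.
      + change (Rabs (t - b) < d); lra.
    - exists (mkposreal 1 Rlt_0_1); tauto. }
  (* Compactness takes a total function of radii, hence the choice here and the dummy radius 1 off
     the unit square. *)
  set (delta := fun a b => proj1_sig (constructive_indefinite_description _ (X a b))).
  assert (Hdelta : forall a b, 0 <= a <= 1 -> 0 <= b <= 1 -> Q a b (delta a b))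
    by (intros a b; exact (proj2_sig (constructive_indefinite_description _ (X a b)))).
  destruct (compactness_value_2d 0 1 0 1 delta) as [d Hd].
  exists d; intros s t Hs Ht.
  destruct (NNPP _ (Hd s t Hs Ht)) as [a [b [Ha [Hb [Hsa [Htb Hdd]]]]]].
  destruct (Hdelta a b Ha Hb) as [e [HB He]].
  exists (H (a, b)), e; split; [exact HB |].
  intros s' t' Hs' Ht'; apply He.
  - replace (s' - a) with ((s' - s) + (s - a)) by ring.
    eapply Rle_lt_trans; [apply Rabs_triang | lra].
  - replace (t' - b) with ((t' - t) + (t - b)) by ring.
    eapply Rle_lt_trans; [apply Rabs_triang | lra].
Qed.

Fixpoint rsum (n : nat) (a : nat -> R) : R :=
  match n with O => 0 | S m => rsum m a + a m end.

Lemma rsum_ext n a b : (forall j, (j < n)%nat -> a j = b j) -> rsum n a = rsum n b.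
Proof.
  induction n as [|n IH]; intros E; simpl; [reflexivity |].
  rewrite IH by (intros j Hj; apply E; lia); now rewrite (E n) by lia.
Qed.

Lemma rsum_zero n a : (forall j, (j < n)%nat -> a j = 0) -> rsum n a = 0.
Proof.
  induction n as [|n IH]; intros E; simpl; [reflexivity |].
  rewrite IH by (intros j Hj; apply E; lia); rewrite (E n) by lia; ring.
Qed.

Lemma rsum_block n k a :
  rsum (n * k) a = rsum n (fun m => rsum k (fun l => a (m * k + l)%nat)).
Proof.
  induction n as [|n IH]; simpl; [reflexivity |].
  rewrite <- IH, Nat.add_comm; generalize (n * k)%nat; intros p.
  clear; induction k as [|k IH]; simpl; [rewrite Nat.add_0_r; ring |].
  rewrite Nat.add_succ_r; simpl; rewrite IH; ring.
Qed.

Lemma frac_bounds j n : (j <= n)%nat -> (0 < n)%nat -> 0 <= INR j / INR n <= 1.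
Proof.
  intros Hj Hn; assert (0 < INR n) by (apply lt_0_INR; lia).
  apply le_INR in Hj; split.
  - apply Rdiv_le_0_compat; [apply pos_INR | assumption].
  - apply Rmult_le_reg_r with (INR n); [assumption |]; unfold Rdiv.
    rewrite Rmult_assoc, Rinv_l by lra; lra.
Qed.

Lemma frac_step j n : (0 < n)%nat -> INR (S j) / INR n - INR j / INR n = / INR n.
Proof.
  intros Hn; assert (0 < INR n) by (apply lt_0_INR; lia).
  rewrite S_INR; field; lra.
Qed.

(* The difference between consecutive row sums telescopes over the cells of the grid, each of
   which is mapped into a ball contained in V. *)
Lemma homotopy_sum_zero V u v (H : R * R -> C) :
  closed_form V u v -> (forall p, continuous H p) ->
  (forall s t, 0 <= s <= 1 -> 0 <= t <= 1 -> V (H (s, t))) ->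
  (forall t, 0 <= t <= 1 -> H (1, t) = H (1, 0)) ->
  (forall s, 0 <= s <= 1 -> H (s, 0) = H (0, 0) /\ H (s, 1) = H (0, 0)) ->
  exists d : posreal, forall n, (0 < n)%nat -> / INR n < d ->
    rsum n (fun j => elbow u v (H (0, INR j / INR n)) (H (0, INR (S j) / INR n))) = 0.
Proof.
  intros HF HH HI H1 H2.
  destruct (lebesgue_number (proj1 HF) HH HI) as [d Hd]; exists d; intros n Hn Hnd.
  assert (Pn : 0 < / INR n) by (apply Rinv_0_lt_compat, lt_0_INR; lia).
  set (P := fun i j => H (INR i / INR n, INR j / INR n)).
  (* Both ways around a cell equal the elbow along its diagonal, by two uses of the cocycle rule. *)
  assert (Cell : forall i j, (i < n)%nat -> (j < n)%nat ->
    elbow u v (P i j) (P i (S j)) + elbow u v (P i (S j)) (P (S i) (S j)) =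
    elbow u v (P i j) (P (S i) j) + elbow u v (P (S i) j) (P (S i) (S j))).
  { intros i j Hi Hj.
    destruct (Hd (INR i / INR n) (INR j / INR n)) as [c [e [HB He]]].
    { apply frac_bounds; lia. } { apply frac_bounds; lia. }
    assert (Z : forall x, Rabs (x - x) < d) by (intros x; apply Rabs_center).
    assert (St : forall k, Rabs (INR (S k) / INR n - INR k / INR n) < d)
      by (intros k; rewrite frac_step by exact Hn; rewrite Rabs_right; lra).
    rewrite (@elbow_cocycle V u v c e), (@elbow_cocycle V u v c e); auto; apply He; auto. }
  assert (Row : forall i, (i < n)%nat -> forall m, (m <= n)%nat ->
    rsum m (fun j => elbow u v (P i j) (P i (S j))) + elbow u v (P i m) (P (S i) m) =
    elbow u v (P i O) (P (S i) O) + rsum m (fun j => elbow u v (P (S i) j) (P (S i) (S j)))).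
  { intros i Hi m; induction m as [|m IH]; intros Hm; simpl; [ring |].
    specialize (Cell i m Hi Hm); specialize (IH ltac:(lia)); lra. }
  assert (B0 : forall i, (i <= n)%nat -> P i O = H (0, 0)).
  { intros i Hi; unfold P; replace (INR 0 / INR n) with 0 by (simpl; unfold Rdiv; ring).
    apply H2, frac_bounds; lia. }
  assert (Bn : forall i, (i <= n)%nat -> P i n = H (0, 0)).
  { intros i Hi; unfold P; replace (INR n / INR n) with 1
      by (field; apply Rgt_not_eq, lt_0_INR; lia).
    apply H2, frac_bounds; lia. }
  assert (All : forall i, (i <= n)%nat ->
    rsum n (fun j => elbow u v (P O j) (P O (S j))) =
    rsum n (fun j => elbow u v (P i j) (P i (S j)))).
  { intros i; induction i as [|i IH]; intros Hi; [reflexivity |].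
    rewrite IH by lia; specialize (Row i ltac:(lia) n ltac:(lia)).
    (* The homotopy fixes the base point, so the vertical edges left at both ends of a row join a
       point to itself. *)
    rewrite !B0, !Bn, !elbow_refl in Row by lia; lra. }
  transitivity (rsum n (fun j => elbow u v (P O j) (P O (S j)))).
  { apply rsum_ext; intros j _; unfold P.
    replace (INR 0 / INR n) with 0 by (simpl; unfold Rdiv; ring); reflexivity. }
  rewrite (All n) by lia; apply rsum_zero; intros j Hj; unfold P.
  replace (INR n / INR n) with 1 by (field; apply Rgt_not_eq, lt_0_INR; lia).
  rewrite (H1 (INR j / INR n)), (H1 (INR (S j) / INR n)) by (apply frac_bounds; lia).
  apply elbow_refl.
Qed.

Definition near (V : C -> Prop) (p q : C) : Prop :=
  exists (c : C) (e : posreal), (forall w, ball c e w -> V w) /\ ball c e p /\ ball c e q.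

Definition clamp (x : R) : R := Rmax 0 (Rmin 1 x).

Lemma clamp_low x : x <= 0 -> clamp x = 0.
Proof.
  intros Hx; unfold clamp; rewrite Rmin_right by lra; now rewrite Rmax_left by lra.
Qed.

Lemma clamp_mid x : 0 <= x <= 1 -> clamp x = x.
Proof.
  intros Hx; unfold clamp; rewrite Rmin_right by lra; now rewrite Rmax_right by lra.
Qed.

Lemma clamp_high x : 1 <= x -> clamp x = 1.
Proof.
  intros Hx; unfold clamp; rewrite Rmin_left by lra; now rewrite Rmax_right by lra.
Qed.

Lemma continuous_clamp x : continuous clamp x.
Proof.
  intros P [e He]; exists e; intros y Hy; apply He.
  change (Rabs (y - x) < e) in Hy; change (Rabs (clamp y - clamp x) < e).
  eapply Rle_lt_trans; [| exact Hy].
  unfold clamp, Rmin; destruct (Rle_dec 1 y), (Rle_dec 1 x);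
    unfold Rmax; repeat (match goal with |- context [Rle_dec ?a ?b] => destruct (Rle_dec a b) end);
    unfold Rabs; repeat (match goal with |- context [Rcase_abs ?a] => destruct (Rcase_abs a) end);
    lra.
Qed.

(* The piecewise linear function with value f j at the integer j, for 0 <= j <= n. *)
Definition polyline (f : nat -> R) (n : nat) (x : R) : R :=
  f O + rsum n (fun j => clamp (x - INR j) * (f (S j) - f j)).

(** At [INR m + th] the terms below m are saturated and telescope to [f m], the term m contributes
    the fraction th of its increment, and the later ones vanish. *)
Lemma polyline_value f n m th :
  (m < n)%nat -> 0 <= th <= 1 -> polyline f n (INR m + th) = f m + th * (f (S m) - f m).
Proof.
  intros Hm Hth; unfold polyline.
  assert (A : forall k, (k <= m)%nat ->
    f O + rsum k (fun j => clamp (INR m + th - INR j) * (f (S j) - f j)) = f k).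
  { induction k as [|k IH]; intros Hk; simpl; [ring |].
    rewrite <- Rplus_assoc, IH by lia; rewrite clamp_high; [ring |].
    apply le_INR in Hk; rewrite S_INR in Hk; lra. }
  assert (B : forall k, f O + rsum (S m + k)
    (fun j => clamp (INR m + th - INR j) * (f (S j) - f j)) = f m + th * (f (S m) - f m)).
  { induction k as [|k IH].
    - rewrite Nat.add_0_r; simpl; rewrite <- Rplus_assoc, A by lia.
      replace (INR m + th - INR m) with th by ring; now rewrite clamp_mid.
    - rewrite Nat.add_succ_r; cbn [rsum]; rewrite <- Rplus_assoc, IH, clamp_low; [ring |].
      rewrite plus_INR, S_INR; pose proof (pos_INR k); lra. }
  replace n with (S m + (n - S m))%nat by lia; apply B.
Qed.

Lemma continuous_polyline f n (a x : R) : continuous (fun t => polyline f n (a * t)) x.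
Proof.
  unfold polyline; apply @continuous_plus; [apply continuous_const |].
  induction n as [|n IH]; simpl; [apply continuous_const |].
  apply @continuous_plus; [exact IH |].
  apply (continuous_mult (fun t => clamp (a * t - INR n)) (fun _ => f (S n) - f n)).
  - apply (continuous_comp (fun t => a * t - INR n) clamp); [| apply continuous_clamp].
    apply (ex_derive_continuous (fun t => a * t - INR n)); auto_derive; exact I.
  - apply continuous_const.
Qed.

Lemma continuous_pair (S : UniformSpace) (f g : S -> R) t :
  continuous f t -> continuous g t -> continuous (fun s => (f s, g s) : C) t.
Proof.
  intros Hf Hg P [e He].
  generalize (Hf _ (locally_ball (f t) e)) (Hg _ (locally_ball (g t) e)).
  unfold filtermap; intros A B; refine (filter_imp _ _ _ (filter_and _ _ A B)).
  intros s [A' B']; apply He; split; assumption.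
Qed.

(** The fraction may equal 1, which accommodates the right end point x = n with m = n - 1. *)
Lemma nat_frac n x : (0 < n)%nat -> 0 <= x <= INR n ->
  exists m th, (m < n)%nat /\ 0 <= th <= 1 /\ x = INR m + th.
Proof.
  induction n as [|n IH]; intros Hn Hx; [lia |].
  destruct (Nat.eq_dec n 0) as [-> | N].
  - exists O, x; simpl in *; repeat split; try lia; lra.
  - destruct (Rle_dec x (INR n)) as [L | G].
    + destruct (IH ltac:(lia) (conj (proj1 Hx) L)) as [m [th [A [B E]]]]; exists m, th; auto.
    + exists n, (x - INR n); rewrite S_INR in Hx; repeat split; try lia; lra.
Qed.

Lemma ball_segment (c p q : C) (e : posreal) th :
  ball c e p -> ball c e q -> 0 <= th <= 1 ->
  ball c e (fst p + th * (fst q - fst p), snd p + th * (snd q - snd p)).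
Proof.
  assert (X : forall a x y : R, Rabs (x - a) < e -> Rabs (y - a) < e -> 0 <= th <= 1 ->
    Rabs (x + th * (y - x) - a) < e).
  { intros a x y Hx Hy Ht; apply Rabs_def2 in Hx as [X1 X2]; apply Rabs_def2 in Hy as [Y1 Y2].
    destruct (Rle_dec x y) as [L | L]; apply Rabs_def1; nra. }
  intros [P1 P2] [Q1 Q2] Ht; split; apply X; assumption.
Qed.

(** The polygon is turned into a genuine loop, so that simple connectedness supplies a homotopy. The
    first row of the grid sum then consists of samples of that loop, and has to be matched with the
    given sides. *)
Lemma polygon_sum_zero V u v n (P : nat -> C) :
  closed_form V u v -> simply_connected V -> (0 < n)%nat ->
  (forall j, (j < n)%nat -> near V (P j) (P (S j))) -> P n = P O ->
  rsum n (fun j => elbow u v (P j) (P (S j))) = 0.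
Proof.
  intros HF [_ HS] Hn HP HC.
  set (gam := fun t => (polyline (fun j => fst (P j)) n (INR n * t),
                        polyline (fun j => snd (P j)) n (INR n * t)) : C).
  assert (Val : forall m th t, (m < n)%nat -> 0 <= th <= 1 -> INR n * t = INR m + th ->
    gam t = (fst (P m) + th * (fst (P (S m)) - fst (P m)),
             snd (P m) + th * (snd (P (S m)) - snd (P m)))).
  { intros m th t Hm Hth E; unfold gam; rewrite E, !polyline_value by assumption; reflexivity. }
  assert (Pn : 0 < INR n) by (apply lt_0_INR; lia).
  assert (G0 : gam 0 = P O).
  { rewrite (Val O 0) by (try lia; simpl; lra); rewrite (surjective_pairing (P O)); simpl; f_equal; ring. }
  assert (G1 : gam 1 = P O).
  { rewrite <- HC; destruct n as [|m]; [lia |].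
    rewrite (Val m 1) by (try lia; try rewrite S_INR; lra); rewrite (surjective_pairing (P (S m))); simpl; f_equal; ring. }
  destruct (HS gam) as [H [CH [VH [Ht Hs]]]].
  { intros t; apply continuous_pair; apply continuous_polyline. }
  { intros t Ht; destruct (@nat_frac n (INR n * t) Hn) as [m [th [A [B E]]]]; [nra |].
    rewrite (Val m th t A B E); destruct (HP m A) as [c [e [HB [B1 B2]]]].
    apply HB, ball_segment; assumption. }
  { now rewrite G0, G1. }
  destruct (homotopy_sum_zero HF CH VH) as [d Hd].
  { intros t Hu; rewrite (proj2 (Ht t Hu)), (proj2 (Ht 0 ltac:(lra))); reflexivity. }
  { intros s Hu; destruct (Hs s Hu) as [-> ->], (Hs 0 ltac:(lra)) as [-> _]; auto. }
  (* The sides may be too long for the mesh d, so each is cut into k pieces. The pieces of a side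
     lie in one square of V, and the cocycle rule reassembles them into the elbow of the whole
     side. *)
  destruct (archimed_cor1 d (cond_pos d)) as [k [Hk1 Hk0]].
  assert (Pk : 0 < INR k) by (apply lt_0_INR; lia).
  assert (Pnk : 0 < INR (n * k)) by (apply lt_0_INR; nia).
  assert (L : / INR (n * k) < d).
  { eapply Rle_lt_trans; [| exact Hk1]; apply Rinv_le_contravar; [assumption |].
    apply le_INR; nia. }
  rewrite <- (Hd (n * k)%nat ltac:(nia) L), rsum_block.
  apply rsum_ext; intros m Hm.
  destruct (HP m Hm) as [c [e [HB [B1 B2]]]].
  assert (Sample : forall l, (l <= k)%nat ->
    H (0, INR (m * k + l) / INR (n * k)) =
    (fst (P m) + INR l / INR k * (fst (P (S m)) - fst (P m)),
     snd (P m) + INR l / INR k * (snd (P (S m)) - snd (P m)))).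
  { intros l Hl; rewrite (proj1 (Ht _ (frac_bounds (n := (n * k)%nat) (j := (m * k + l)%nat) ltac:(nia) ltac:(nia)))).
    apply Val; [assumption | apply frac_bounds; assumption |].
    rewrite plus_INR, !mult_INR; field; lra. }
  assert (InB : forall l, (l <= k)%nat -> ball c e (H (0, INR (m * k + l) / INR (n * k)))).
  { intros l Hl; rewrite Sample by assumption; apply ball_segment; auto; apply frac_bounds; assumption. }
  assert (S0 : H (0, INR (m * k + 0) / INR (n * k)) = P m).
  { rewrite Sample by lia; rewrite (surjective_pairing (P m)); simpl; f_equal; unfold Rdiv; ring. }
  assert (Sk : H (0, INR (m * k + k) / INR (n * k)) = P (S m)).
  { rewrite Sample by lia; rewrite (surjective_pairing (P (S m))); simpl; f_equal; field; lra. }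
  assert (T : forall l, (l <= k)%nat ->
    rsum l (fun i => elbow u v (H (0, INR (m * k + i) / INR (n * k)))
                       (H (0, INR (S (m * k + i)) / INR (n * k)))) =
    elbow u v (P m) (H (0, INR (m * k + l) / INR (n * k)))).
  { induction l as [|l IH]; intros Hl; cbn [rsum].
    - rewrite S0; now rewrite elbow_refl.
    - rewrite IH by lia; rewrite Nat.add_succ_r; apply (elbow_cocycle (c := c) (e := e) HF HB); auto.
      + apply InB; lia.
      + rewrite <- Nat.add_succ_r; apply InB; lia. }
  now rewrite T, Sk by lia.
Qed.

(** * Closed forms on simply connected domains *)

(** The last argument is the integral along some polygon from p. As a relation between end point and
    value it makes concatenation and reversal plain inductions, and the primitive is the value
    reached from a base point. *)
Inductive chain (V : C -> Prop) (u v : C -> R) (p : C) : C -> R -> Prop :=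
| chain_nil : chain V u v p p 0
| chain_snoc q r s : chain V u v p q s -> near V q r -> chain V u v p r (s + elbow u v q r).

Lemma near_sym V p q : near V p q -> near V q p.
Proof. intros [c [e [HB [Hp Hq]]]]; exists c, e; auto. Qed.

Lemma chain_app V u v p q r s t :
  chain V u v p q s -> chain V u v q r t -> chain V u v p r (s + t).
Proof.
  intros H1; induction 1 as [| q' r' t H2 IH N].
  - now rewrite Rplus_0_r.
  - rewrite <- Rplus_assoc; now constructor.
Qed.

Lemma elbow_anti V u v p q : closed_form V u v -> near V p q -> elbow u v q p = - elbow u v p q.
Proof.
  intros HF [c [e [HB [Hp Hq]]]].
  assert (E := elbow_cocycle HF HB Hp Hq Hp); rewrite elbow_refl in E; lra.
Qed.

Lemma chain_rev V u v p q s : closed_form V u v -> chain V u v p q s -> chain V u v q p (- s).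
Proof.
  intros HF; induction 1 as [| q r s H IH N].
  - rewrite Ropp_0; constructor.
  - rewrite Ropp_plus_distr, Rplus_comm; apply chain_app with q; [| exact IH].
    rewrite <- (elbow_anti HF N), <- (Rplus_0_l (elbow u v r q)).
    constructor; [constructor | now apply near_sym].
Qed.

Lemma chain_polygon V u v p q s :
  chain V u v p q s -> exists n (P : nat -> C), P O = p /\ P n = q /\
    (forall j, (j < n)%nat -> near V (P j) (P (S j))) /\
    s = rsum n (fun j => elbow u v (P j) (P (S j))).
Proof.
  induction 1 as [| q r s H IH N].
  - exists O, (fun _ => p); simpl; repeat split; intros; lia.
  - destruct IH as [n [P [H0 [Hn [HP Hs]]]]].
    exists (S n), (fun m => if (m <=? n)%nat then P m else r).
    assert (L : forall j, (j <= n)%nat -> (j <=? n)%nat = true) by (intros; now apply Nat.leb_le).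
    assert (G : (S n <=? n)%nat = false) by (apply Nat.leb_gt; lia).
    repeat split.
    + now rewrite L by lia.
    + now rewrite G.
    + intros j Hj; destruct (Nat.eq_dec j n) as [-> | Nj].
      * now rewrite L, G, Hn by lia.
      * rewrite !L by lia; apply HP; lia.
    + cbn [rsum]; rewrite L, G, Hn by lia; f_equal.
      rewrite Hs; apply rsum_ext; intros j Hj; now rewrite !L by lia.
Qed.

Lemma chain_closed V u v p s :
  closed_form V u v -> simply_connected V -> chain V u v p p s -> s = 0.
Proof.
  intros HF HS H; destruct (chain_polygon H) as [n [P [H0 [Hn [HP ->]]]]].
  destruct n as [|n]; [reflexivity |].
  apply (@polygon_sum_zero V u v (S n) P); auto; [lia | now rewrite Hn, H0].
Qed.

Lemma chain_unique V u v p q s t :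
  closed_form V u v -> simply_connected V ->
  chain V u v p q s -> chain V u v p q t -> s = t.
Proof.
  intros HF HS H1 H2; assert (E := chain_closed HF HS (chain_app H1 (chain_rev HF H2))); lra.
Qed.

Lemma chain_exists V u v p q :
  open V -> simply_connected V -> V p -> V q -> exists s, chain V u v p q s.
Proof.
  intros HV [HS _] Hp Hq; destruct (HS p q Hp Hq) as [gam [CG [VG [<- <-]]]].
  (* The path is viewed as a map of the square that ignores its first coordinate. *)
  destruct (@lebesgue_number V (fun x => gam (snd x))) as [d Hd].
  - exact HV.
  - intros x; apply (continuous_comp snd gam); [| apply CG].
    destruct x; apply continuous_snd.
  - intros s t _ Ht; apply VG, Ht.
  - destruct (archimed_cor1 d (cond_pos d)) as [n [Hn1 Hn0]].
    assert (Pn : 0 < / INR n) by (apply Rinv_0_lt_compat, lt_0_INR; lia).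
    assert (X : forall m, (m <= n)%nat -> exists s, chain V u v (gam 0) (gam (INR m / INR n)) s).
    { induction m as [|m IH]; intros Hm.
      - exists 0; replace (INR 0 / INR n) with 0 by (simpl; unfold Rdiv; ring); constructor.
      - destruct (IH ltac:(lia)) as [s Hs]; eexists; constructor; [exact Hs |].
        destruct (Hd 0 (INR m / INR n)) as [c [e [HB He]]].
        { lra. } { apply frac_bounds; lia. }
        exists c, e; split; [exact HB | split].
        + apply (He 0 (INR m / INR n)); apply Rabs_center.
        + apply (He 0 (INR (S m) / INR n)); [apply Rabs_center |].
          rewrite frac_step by lia; rewrite Rabs_right; lra. }
    destruct (X n ltac:(lia)) as [s Hs]; exists s.
    now replace (INR n / INR n) with 1 in Hs by (field; apply Rgt_not_eq, lt_0_INR; lia).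
Qed.

(** The primitive f is the value of any chain from a base point, well defined by [chain_unique]. On
    a square around z it equals f z plus [elbow u v z], whose partial derivatives are known. *)
Theorem closed_form_exact V u v :
  closed_form V u v -> simply_connected V ->
  exists f, forall z, V z -> partials f z (u z) (v z).
Proof.
  intros HF HS; destruct (classic (exists a, V a)) as [[a Ha] | N].
  (* [simply_connected] admits the empty set, which offers no base point. *)
  2: { exists (fun _ => 0); intros z Hz; destruct N; now exists z. }
  assert (X : forall z, exists s, V z -> chain V u v a z s).
  { intros z; destruct (classic (V z)) as [Hz | Nz]; [| exists 0; tauto].
    destruct (chain_exists u v (proj1 HF) HS Ha Hz) as [s Hs]; now exists s. }
  set (f := fun z => proj1_sig (constructive_indefinite_description _ (X z))).
  assert (Hf : forall z, V z -> chain V u v a z (f z))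
    by (intros z; exact (proj2_sig (constructive_indefinite_description _ (X z)))).
  exists f; intros z Hz.
  destruct (proj1 HF z Hz) as [e He].
  apply (partials_ext (@ball_open z e) (@ball_center C_UniformSpace z e)
    (f := fun w => f z + elbow u v z w)).
  - intros w Ww; apply (chain_unique HF HS (p := a) (q := w)).
    + constructor; [apply Hf, Hz |].
      exists z, e; split; [exact He | split; [apply ball_center | exact Ww]].
    + apply Hf, He, Ww.
  - apply (@partials_eq _ z (0 + u z) (0 + v z)); [| ring | ring].
    apply (partials_plus (partials_const (f z) z)).
    apply (elbow_partials HF He), ball_center.
Qed.

(** A chain for the zero form serves as a string of squares leading from a to z, and f is constant
    on each of them. *)
Lemma partials_zero_constant V f a z :
  open V -> simply_connected V -> (forall w, V w -> partials f w 0 0) ->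
  V a -> V z -> f z = f a.
Proof.
  intros HV HS Hf Ha Hz.
  destruct (chain_exists (fun _ => 0) (fun _ => 0) HV HS Ha Hz) as [s Hs].
  clear Hz; induction Hs as [| q r s H IH [c [e [HB [Hq Hr]]]]]; [reflexivity |].
  rewrite <- IH.
  assert (E := @elbow_diff (fun _ => 0) (fun _ => 0) f c e q r).
  rewrite <- (Rplus_0_r (f q)); apply (Rplus_eq_reg_l (- f q)).
  transitivity (f r - f q); [ring |]; rewrite <- E; auto.
  - unfold elbow; rewrite !RInt_const; unfold scal; simpl; unfold mult; simpl; ring.
  - intros w Hw; split; [apply continuous_const | split; [apply continuous_const | auto]].
Qed.

Lemma wirtinger_zero_constant V F :
  open V -> simply_connected V -> (forall w, V w -> wirtinger F w 0 0) ->
  exists k : C, forall z, V z -> F z = k.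
Proof.
  intros HV HS HF; destruct (classic (exists a, V a)) as [[a Ha] | N].
  2: { exists (0 : C); intros z Hz; destruct N; now exists z. }
  exists (F a); intros z Hz; apply injective_projections.
  - apply (@partials_zero_constant V (fun w => Re (F w))); auto.
    intros w Hw; apply (partials_eq (proj1 (HF w Hw))); simpl; ring.
  - apply (@partials_zero_constant V (fun w => Im (F w))); auto.
    intros w Hw; apply (partials_eq (proj2 (HF w Hw))); simpl; ring.
Qed.

Definition smoothC (V : C -> Prop) (F : C -> C) : Prop := forall k, Ck2 k V F.

Lemma smoothC_intro V F a b :
  open V -> (forall z, V z -> wirtinger F z (a z) (b z)) ->
  smoothC V a -> smoothC V b -> smoothC V F.
Proof. intros HV HF Ha Hb k; apply Ck2_S; auto; apply (Ck2_intro HV HF); auto. Qed.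

(* f dz = (p dx - q dy) + i (q dx + p dy) for f = p + i q, and both forms are closed by the
   Cauchy-Riemann equations. *)
Theorem holomorphic_primitive V f :
  open V -> simply_connected V -> smoothC V f -> (forall z, V z -> dzb f z = 0) ->
  exists F, smoothC V F /\ forall z, V z -> wirtinger F z (f z) 0.
Proof.
  intros HV HS Hf H0; destruct (Hf 1%nat) as [HR HI].
  assert (CR : forall z, V z ->
    D1 (fun w => Re (f w)) z = D2 (fun w => Im (f w)) z /\
    D2 (fun w => Re (f w)) z = - D1 (fun w => Im (f w)) z).
  { intros z Hz; specialize (H0 z Hz); unfold dzb in H0; injection H0; intros; split; lra. }
  destruct (@closed_form_exact V (fun w => Re (f w)) (fun w => - Im (f w))) as [P HP].
  - split; [| split; [| split]]; auto using Ck_opp.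
    intros z Hz; rewrite (proj2 (CR z Hz)); symmetry.
    apply (partials_D (partials_opp (Ck_partials HI Hz))).
  - exact HS.
  - destruct (@closed_form_exact V (fun w => Im (f w)) (fun w => Re (f w))) as [Q HQ].
    + split; [| split; [| split]]; auto.
      intros z Hz; symmetry; apply (CR z Hz).
    + exact HS.
    + exists (fun z => (P z, Q z)).
      assert (W : forall z, V z -> wirtinger (fun z => (P z, Q z)) z (f z) 0).
      { intros z Hz; split; simpl.
        - apply (partials_eq (HP z Hz)); simpl; unfold Re, Im; ring.
        - apply (partials_eq (HQ z Hz)); simpl; unfold Re, Im; ring. }
      split; [| exact W].
      apply (smoothC_intro HV W Hf); intros k; apply (Ck2_const k 0 HV).
Qed.

(** * The equation on the round sphere *)

Lemma C_two_neq_0 : (2 : C) <> 0.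
Proof. intros H; injection H; lra. Qed.

Lemma Cmult_cancel_l (c a b : C) : c <> 0 -> (c * a = c * b)%C -> a = b.
Proof.
  intros Hc H; transitivity (c * a / c)%C; [field; exact Hc |].
  rewrite H; field; exact Hc.
Qed.

Lemma Cconj_neq_0 (c : C) : c <> 0 -> Cconj c <> 0.
Proof. intros Hc H; apply Hc; rewrite <- (Cconj_conj c), H; unfold Cconj; simpl; now rewrite Ropp_0. Qed.

Lemma Cconj_R (x : R) : Cconj x = x.
Proof. unfold Cconj; simpl; now rewrite Ropp_0. Qed.

Lemma Cconj_half : Cconj (/ 2) = (/ 2)%C.
Proof. rewrite <- RtoC_inv by lra; apply Cconj_R. Qed.

Lemma smoothC_ext V F G :
  open V -> (forall w, V w -> F w = G w) -> smoothC V F -> smoothC V G.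
Proof. intros HV E H k; apply (Ck2_ext HV E), H. Qed.

Lemma smoothC_const V c : open V -> smoothC V (fun _ => c).
Proof. intros HV k; apply Ck2_const, HV. Qed.

Lemma smoothC_plus V F G :
  open V -> smoothC V F -> smoothC V G -> smoothC V (fun z => F z + G z)%C.
Proof. intros HV H1 H2 k; apply Ck2_plus; auto. Qed.

Lemma smoothC_minus V F G :
  open V -> smoothC V F -> smoothC V G -> smoothC V (fun z => F z - G z)%C.
Proof. intros HV H1 H2 k; apply Ck2_minus; auto. Qed.

Lemma smoothC_mult V F G :
  open V -> smoothC V F -> smoothC V G -> smoothC V (fun z => F z * G z)%C.
Proof. intros HV H1 H2 k; apply Ck2_mult; auto. Qed.

Lemma smoothC_div V F G :
  open V -> smoothC V F -> smoothC V G -> (forall z, V z -> G z <> 0) ->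
  smoothC V (fun z => F z / G z)%C.
Proof. intros HV H1 H2 H0 k; apply Ck2_div; auto. Qed.

Lemma smoothC_conj V F : open V -> smoothC V F -> smoothC V (fun z => Cconj (F z)).
Proof. intros HV H1 k; apply Ck2_conj; auto. Qed.

Lemma smoothC_dz V F : open V -> smoothC V F -> smoothC V (dz F).
Proof. intros HV H1 k; apply Ck2_dz; auto. Qed.

Lemma smoothC_dzb V F : open V -> smoothC V F -> smoothC V (dzb F).
Proof. intros HV H1 k; apply Ck2_dzb; auto. Qed.

Lemma smoothC_wirtinger V F z : smoothC V F -> V z -> wirtinger F z (dz F z) (dzb F z).
Proof. intros H Hz; apply (Ck2_wirtinger (H 1%nat) Hz). Qed.

(** This is how an identity on V gets differentiated: both sides are derived by the rules and the
    results compared. *)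
Lemma wirtinger_ext_eq V F G z a b a' b' :
  open V -> V z -> (forall w, V w -> F w = G w) ->
  wirtinger F z a b -> wirtinger G z a' b' -> a = a' /\ b = b'.
Proof.
  intros HV Hz E HF HG; apply (wirtinger_ext HV Hz E) in HF.
  destruct (wirtinger_unique HF) as [<- <-], (wirtinger_unique HG) as [<- <-]; auto.
Qed.

Lemma wirtinger_dz_holo V F z :
  open V -> smoothC V F -> (forall w, V w -> dzb F w = 0) -> V z ->
  wirtinger (dz F) z (dz (dz F) z) 0.
Proof.
  intros HV HF H0 Hz.
  apply (wirtinger_eq (smoothC_wirtinger (smoothC_dz HV HF) Hz)); [reflexivity |].
  rewrite <- (dz_dzb_comm HV (HF 2%nat) Hz).
  rewrite (proj1 (dz_ext HV Hz (F := dzb F) (G := fun _ => 0) H0)).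
  apply (wirtinger_unique (wirtinger_const 0 z)).
Qed.

(** Smoothness is bundled, and the conditions are stated through [dz] and [dzb], so that g can be
    differentiated repeatedly by the Wirtinger rules. *)
Definition conformal_map (V : C -> Prop) (g : C -> C) : Prop :=
  open V /\ smoothC V g /\ (forall z, V z -> dzb g z = 0) /\ (forall z, V z -> dz g z <> 0).

(** [Tfun] as a polynomial in g and conj(g), the form to which the Wirtinger rules apply. *)
Definition Tc (g : C -> C) (z : C) : C := (1 + g z * Cconj (g z))%C.

Lemma Tc_real g z : Tc g z = RtoC (1 + (Re (g z) * Re (g z) + Im (g z) * Im (g z))).
Proof. unfold Tc; apply injective_projections; unfold Re, Im; simpl; ring. Qed.

Lemma Tc_neq_0 g z : Tc g z <> 0.
Proof. rewrite Tc_real; intros H; injection H; nra. Qed.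

Lemma Tc_conj g z : Cconj (Tc g z) = Tc g z.
Proof. rewrite Tc_real; apply Cconj_R. Qed.

Ltac conj_push :=
  repeat rewrite ?Cplus_conj, ?Cminus_conj, ?Cmult_conj, ?Copp_conj, ?Cconj_conj, ?Cconj_half,
    ?Cconj_R, ?Tc_conj.

Lemma conformal_wirtinger V g z : conformal_map V g -> V z ->
  wirtinger g z (dz g z) 0 /\ wirtinger (dz g) z (dz (dz g) z) 0 /\
  wirtinger (Tc g) z (dz g z * Cconj (g z)) (g z * Cconj (dz g z)).
Proof.
  intros [HV [Hg [H0 _]]] Hz.
  assert (W : wirtinger g z (dz g z) 0)
    by (apply (wirtinger_eq (smoothC_wirtinger Hg Hz)); auto).
  split; [exact W | split].
  - now apply (wirtinger_dz_holo HV Hg H0).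
  - apply (wirtinger_eq (wirtinger_plus (wirtinger_const 1 z)
             (wirtinger_mult W (wirtinger_conj W)))); rewrite ?Cconj_R; ring.
Qed.

Lemma Tc_smooth V g : conformal_map V g -> smoothC V (Tc g).
Proof.
  intros [HV [Hg _]]; apply smoothC_plus; auto; [now apply smoothC_const |].
  apply smoothC_mult; auto; now apply smoothC_conj.
Qed.

(* In the coordinate w = g(z) this reads T f_{w conj(w)} = 2 Re(w f_w) - f, the
   equation (Laplacian + 2) h = 0 on the round sphere for f = T h. *)
Definition sphere_equation (g f : C -> C) (z : C) : Prop :=
  (Tc g z * dzb (dz f) z =
   g z * Cconj (dz g z) * dz f z + Cconj (g z) * dz g z * dzb f z
   - dz g z * Cconj (dz g z) * f z)%C.

Lemma sphere_equation_solve V g f :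
  conformal_map V g -> simply_connected V -> smoothC V f ->
  (forall z, V z -> Cconj (f z) = f z) -> (forall z, V z -> sphere_equation g f z) ->
  exists A B A', smoothC V A /\ smoothC V B /\
    (forall z, V z -> wirtinger A z (A' z) 0) /\
    (forall z, V z -> wirtinger B z (A' z * g z - A z * dz g z) 0) /\
    (forall z, V z ->
       f z = (A z + Cconj (A z) + (Cconj (g z) * B z + g z * Cconj (B z))) / 2)%C.
Proof.
  intros HG HS Hf Rf PDE; pose proof HG as [HV [Hg [Hg0 Hg1]]].
  assert (ST := Tc_smooth HG).
  set (g1 := dz g) in *; set (T := Tc g) in *.
  assert (Sg1 : smoothC V g1) by now apply smoothC_dz.
  assert (N1 := Hg1); assert (NT : forall z, V z -> T z <> 0) by (intros; apply Tc_neq_0).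
  assert (Nc1 : forall z, V z -> Cconj (g1 z) <> 0) by (intros; now apply Cconj_neq_0, N1).
  (* Derivatives in the coordinate w = g(z), along which d/dw is d/dz divided by g': [q1] is f_w,
     [q2] is f_{ww} and [p] is f_{w conj(w)}. *)
  set (q1 := fun z => (dz f z / g1 z)%C).
  assert (Sq1 : smoothC V q1) by (apply smoothC_div; auto; now apply smoothC_dz).
  set (q2 := fun z => (dz q1 z / g1 z)%C).
  assert (Sq2 : smoothC V q2) by (apply smoothC_div; auto; now apply smoothC_dz).
  set (p := fun z => (dzb q1 z / Cconj (g1 z))%C).
  assert (Sp : smoothC V p)
    by (apply smoothC_div; auto; [now apply smoothC_dzb | now apply smoothC_conj]).
  assert (Wg : forall z, V z -> wirtinger g z (g1 z) 0)
    by (intros z Hz; exact (proj1 (conformal_wirtinger HG Hz))).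
  assert (Wg1 : forall z, V z -> wirtinger g1 z (dz g1 z) 0)
    by (intros z Hz; exact (proj1 (proj2 (conformal_wirtinger HG Hz)))).
  assert (WT : forall z, V z -> wirtinger T z (g1 z * Cconj (g z)) (g z * Cconj (g1 z)))
    by (intros z Hz; exact (proj2 (proj2 (conformal_wirtinger HG Hz)))).
  assert (Wgc : forall z, V z -> wirtinger (fun w => Cconj (g w)) z 0 (Cconj (g1 z))).
  { intros z Hz; apply (wirtinger_eq (wirtinger_conj (Wg z Hz))); rewrite ?Cconj_R; reflexivity. }
  assert (Wg1c : forall z, V z -> wirtinger (fun w => Cconj (g1 w)) z 0 (Cconj (dz g1 z))).
  { intros z Hz; apply (wirtinger_eq (wirtinger_conj (Wg1 z Hz))); rewrite ?Cconj_R; reflexivity. }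
  assert (Wq1 : forall z, V z -> wirtinger q1 z (q2 z * g1 z) (p z * Cconj (g1 z))).
  { intros z Hz; apply (wirtinger_eq (smoothC_wirtinger Sq1 Hz)).
    - unfold q2; field; auto.
    - unfold p; field; auto. }
  assert (Fz : forall z, V z -> dz f z = (q1 z * g1 z)%C) by (intros; unfold q1; field; auto).
  assert (Fzb : forall z, V z -> dzb f z = Cconj (q1 z * g1 z)%C).
  { intros z Hz; rewrite <- Fz by exact Hz.
    apply (wirtinger_ext_eq HV Hz (fun w Hw => eq_sym (Rf w Hw)) (smoothC_wirtinger Hf Hz)
             (wirtinger_conj (smoothC_wirtinger Hf Hz))). }
  assert (Wf : forall z, V z -> wirtinger f z (q1 z * g1 z) (Cconj (q1 z * g1 z)%C)).
  { intros z Hz; apply (wirtinger_eq (smoothC_wirtinger Hf Hz)); auto. }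
  assert (Fzzb : forall z, V z -> dzb (dz f) z = (p z * Cconj (g1 z) * g1 z)%C).
  { intros z Hz; transitivity (p z * Cconj (g1 z) * g1 z + q1 z * 0)%C; [| ring].
    apply (wirtinger_ext_eq HV Hz Fz (smoothC_wirtinger (smoothC_dz HV Hf) Hz)
             (wirtinger_mult (Wq1 z Hz) (Wg1 z Hz))). }
  (* The equation in the coordinate w: T p = w f_w + conj(w f_w) - f. It makes p real, and at the
     end it is solved for f. *)
  assert (E : forall z, V z -> (T z * p z)%C = (g z * q1 z + Cconj (g z) * Cconj (q1 z) - f z)%C).
  { intros z Hz; assert (X := PDE z Hz); unfold sphere_equation in X; fold g1 T in X.
    rewrite Fzzb, Fzb, Fz, Cmult_conj in X by exact Hz.
    apply (Cmult_cancel_l (c := g1 z * Cconj (g1 z))%C); [now apply Cmult_neq_0; auto |].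
    transitivity (T z * (p z * Cconj (g1 z) * g1 z))%C; [ring | rewrite X; ring]. }
  assert (Rp : forall z, V z -> Cconj (p z) = p z).
  { intros z Hz; apply (Cmult_cancel_l (c := T z)); [auto |].
    rewrite (E z Hz); replace (T z) with (Cconj (T z)) by apply Tc_conj.
    rewrite <- Cmult_conj, (E z Hz), Cminus_conj, Cplus_conj, !Cmult_conj, !Cconj_conj, Rf by exact Hz; ring. }
  assert (Wp := fun z Hz => smoothC_wirtinger (z := z) Sp Hz).
  (* Differentiating E in w cancels the terms f_w and conj(w) p and leaves T p_w = w f_{ww}. *)
  assert (Pz : forall z, V z -> (T z * dz p z)%C = (g z * g1 z * q2 z)%C).
  { intros z Hz.
    destruct (wirtinger_ext_eq HV Hz E (wirtinger_mult (WT z Hz) (Wp z Hz))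
      (wirtinger_minus (wirtinger_plus (wirtinger_mult (Wg z Hz) (Wq1 z Hz))
         (wirtinger_mult (Wgc z Hz) (wirtinger_conj (Wq1 z Hz)))) (Wf z Hz))) as [X _].
    rewrite Cmult_conj, Cconj_conj, Rp in X by exact Hz.
    transitivity (g1 z * Cconj (g z) * p z + T z * dz p z - g1 z * Cconj (g z) * p z)%C; [ring |].
    rewrite X; ring. }
  assert (Pzb : forall z, V z -> dzb p z = Cconj (dz p z)).
  { intros z Hz; apply (wirtinger_ext_eq HV Hz (fun w Hw => eq_sym (Rp w Hw)) (Wp z Hz)
             (wirtinger_conj (Wp z Hz))). }
  (* Both sides are the third derivative f_{w w conj(w)} up to the same factors, by commutation of
     mixed derivatives. *)
  assert (Q2b : forall z, V z -> (dzb q2 z * g1 z = dz p z * Cconj (g1 z))%C).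
  { intros z Hz.
    assert (X := dz_dzb_comm HV (Sq1 2%nat) Hz).
    assert (X1 : dz (dzb q1) z = (dz p z * Cconj (g1 z) + p z * 0)%C).
    { apply (wirtinger_ext_eq HV Hz (F := dzb q1) (G := fun w => p w * Cconj (g1 w))%C
        (fun w Hw => proj2 (wirtinger_unique (Wq1 w Hw)))
        (smoothC_wirtinger (smoothC_dzb HV Sq1) Hz) (wirtinger_mult (Wp z Hz) (Wg1c z Hz))). }
    assert (X2 : dzb (dz q1) z = (dzb q2 z * g1 z + q2 z * 0)%C).
    { apply (wirtinger_ext_eq HV Hz (F := dz q1) (G := fun w => q2 w * g1 w)%C
        (fun w Hw => proj1 (wirtinger_unique (Wq1 w Hw)))
        (smoothC_wirtinger (smoothC_dz HV Sq1) Hz)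
        (wirtinger_mult (smoothC_wirtinger Sq2 Hz) (Wg1 z Hz))). }
    rewrite X1, X2 in X; transitivity (dzb q2 z * g1 z + q2 z * 0)%C; [ring |].
    rewrite <- X; ring. }
  set (Q := fun z => (2 * q2 z / T z)%C).
  assert (SQ : smoothC V Q)
    by (apply smoothC_div; auto; apply smoothC_mult; auto; now apply smoothC_const).
  assert (TQ : forall z, V z -> (T z * Q z = 2 * q2 z)%C) by (intros; unfold Q; field; auto).
  (* The conj(w)-derivative of T Q = 2 f_{ww} is w Q + T Q_{conj(w)} = 2 p_w. Multiplying by T and
     using T p_w = w f_{ww} gives Q_{conj(w)} = 0. *)
  assert (WQ : forall z, V z -> wirtinger Q z (dz Q z) 0).
  { intros z Hz; apply (wirtinger_eq (smoothC_wirtinger SQ Hz)); [reflexivity |].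
    destruct (wirtinger_ext_eq HV Hz TQ (wirtinger_mult (WT z Hz) (smoothC_wirtinger SQ Hz))
      (wirtinger_mult (wirtinger_const 2 z) (smoothC_wirtinger Sq2 Hz))) as [_ X].
    apply (Cmult_cancel_l (c := (T z * g1 z)%C)); [now apply Cmult_neq_0; auto |].
    transitivity ((g z * Cconj (g1 z) * Q z + T z * dzb Q z) * g1 z
                  - g z * Cconj (g1 z) * g1 z * Q z)%C; [ring |].
    rewrite X.
    transitivity (2 * (dzb q2 z * g1 z) - g z * Cconj (g1 z) * g1 z * Q z)%C; [ring |].
    rewrite (Q2b z Hz).
    apply (Cmult_cancel_l (c := T z)); [auto |].
    transitivity (2 * Cconj (g1 z) * (T z * dz p z) - g z * Cconj (g1 z) * g1 z * (T z * Q z))%C; [ring |].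
    rewrite (Pz z Hz), (TQ z Hz); ring. }
  destruct (@holomorphic_primitive V (fun z => Q z * g1 z)%C HV HS) as [M [SM WM]].
  { now apply smoothC_mult. }
  { intros z Hz; apply (wirtinger_unique (a := (dz Q z * g1 z + Q z * dz g1 z)%C)).
    apply (wirtinger_eq (wirtinger_mult (WQ z Hz) (Wg1 z Hz))); ring. }
  destruct (@holomorphic_primitive V (fun z => M z * g1 z)%C HV HS) as [A0 [SA0 WA0]].
  { now apply smoothC_mult. }
  { intros z Hz; apply (wirtinger_unique (a := (Q z * g1 z * g1 z + M z * dz g1 z)%C)).
    apply (wirtinger_eq (wirtinger_mult (WM z Hz) (Wg1 z Hz))); ring. }
  (* With M_w = Q and (A0)_w = M, the function w M - A0 has w-derivative w Q, which is 2 p_w. Hence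
     p and its real part differ by a constant. *)
  destruct (@wirtinger_zero_constant V
    (fun z => p z - (g z * M z - A0 z + Cconj (g z * M z - A0 z)) * / 2)%C HV HS) as [k Hk].
  { intros z Hz.
    assert (X := wirtinger_minus (wirtinger_mult (Wg z Hz) (WM z Hz)) (WA0 z Hz)).
    apply (wirtinger_eq (wirtinger_minus (Wp z Hz) (wirtinger_mult
      (wirtinger_plus X (wirtinger_conj X)) (wirtinger_const (/ 2) z)))).
    - apply (Cmult_cancel_l (c := (2 * T z)%C)); [now apply Cmult_neq_0; auto using C_two_neq_0 |].
      transitivity (2 * (T z * dz p z) - g z * g1 z * (T z * Q z))%C.
      + conj_push; field; exact C_two_neq_0.
      + rewrite (Pz z Hz), (TQ z Hz); ring.
    - rewrite (Pzb z Hz).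
      apply (Cmult_cancel_l (c := (2 * T z)%C)); [now apply Cmult_neq_0; auto using C_two_neq_0 |].
      transitivity (2 * Cconj (T z * dz p z) - Cconj (g z * g1 z * (T z * Q z)))%C.
      + unfold T; conj_push; field; exact C_two_neq_0.
      + rewrite (Pz z Hz), (TQ z Hz); conj_push; ring. }
  (* The constant k is real because p is, so subtracting it from A0 adds exactly k to Re(w M -
     A0). *)
  set (A := fun z => (A0 z - k)%C).
  assert (Pk : forall z, V z -> p z = ((g z * M z - A z + Cconj (g z * M z - A z)) * / 2)%C).
  { intros z Hz; assert (X := Hk z Hz).
    assert (Ck : Cconj k = k).
    { rewrite <- X, Cminus_conj, Cmult_conj, Cplus_conj, Cconj_conj, (Rp z Hz).
      rewrite Cconj_half; ring. }
    assert (X' : p z = (k + (g z * M z - A0 z + Cconj (g z * M z - A0 z)) * / 2)%C)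
      by (rewrite <- X; ring).
    rewrite X'; unfold A; conj_push; rewrite Ck; field; exact C_two_neq_0. }
  assert (SA : smoothC V A) by (apply smoothC_minus; auto; now apply smoothC_const).
  assert (WA : forall z, V z -> wirtinger A z (M z * g1 z) 0).
  { intros z Hz; apply (wirtinger_eq (wirtinger_minus (WA0 z Hz) (wirtinger_const k z))); ring. }
  destruct (@holomorphic_primitive V (fun z => (g z * M z - A z) * g1 z)%C HV HS) as [B0 [SB0 WB0]].
  { apply smoothC_mult; auto; apply smoothC_minus; auto; now apply smoothC_mult. }
  { intros z Hz; refine (proj2 (wirtinger_unique (wirtinger_eq (wirtinger_mult (wirtinger_minus
      (wirtinger_mult (Wg z Hz) (WM z Hz)) (WA z Hz)) (Wg1 z Hz)) eq_refl _))); ring. }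
  (* The w-derivative vanishes by T Q = 2 f_{ww}, the conj(w)-derivative by the formula for p. The
     resulting constant b enters through conj(B), so B0 is corrected by 2 conj(b). *)
  destruct (@wirtinger_zero_constant V
    (fun z => q1 z - (M z * T z - Cconj (g z) * A z + Cconj (B0 z)) * / 2)%C HV HS) as [b Hb].
  { intros z Hz.
    apply (wirtinger_eq (wirtinger_minus (Wq1 z Hz) (wirtinger_mult (wirtinger_plus
      (wirtinger_minus (wirtinger_mult (WM z Hz) (WT z Hz)) (wirtinger_mult (Wgc z Hz) (WA z Hz)))
      (wirtinger_conj (WB0 z Hz))) (wirtinger_const (/ 2) z)))).
    - apply (Cmult_cancel_l (c := 2)); [exact C_two_neq_0 |].
      transitivity (2 * q2 z * g1 z - T z * Q z * g1 z)%C.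
      + conj_push; field; exact C_two_neq_0.
      + rewrite (TQ z Hz); ring.
    - rewrite (Pk z Hz); conj_push; field; exact C_two_neq_0. }
  exists A, (fun z => B0 z + 2 * Cconj b)%C, (fun z => M z * g1 z)%C.
  split; [exact SA | split; [| split; [exact WA | split]]].
  - apply smoothC_plus; auto; now apply smoothC_const.
  - intros z Hz; apply (wirtinger_eq (wirtinger_plus (WB0 z Hz) (wirtinger_const _ z))); fold g1; ring.
  - intros z Hz.
    assert (Q1 : q1 z = (b + (M z * T z - Cconj (g z) * A z + Cconj (B0 z)) * / 2)%C)
      by (rewrite <- (Hb z Hz); ring).
    transitivity (g z * q1 z + Cconj (g z) * Cconj (q1 z) - T z * p z)%C;
      [rewrite (E z Hz); ring |].
    rewrite Q1, (Pk z Hz).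
    unfold T; conj_push; unfold Tc; field; exact C_two_neq_0.
Qed.

(* A is only complex differentiable, but A' = (2 f_z + conj g g' A - g' conj B) / T and
   B' = A' g - A g' express the derivatives through A, B and smooth functions. *)
Lemma holomorphic_data_smooth V g A B A' f :
  conformal_map V g -> smoothC V f -> holomorphic V A -> holomorphic V B ->
  (forall z, V z -> wirtinger A z (A' z) 0) ->
  (forall z, V z -> wirtinger B z (A' z * g z - A z * dz g z) 0) ->
  (forall z, V z ->
     f z = ((A z + Cconj (A z) + (Cconj (g z) * B z + g z * Cconj (B z))) * / 2)%C) ->
  smoothC V A /\ smoothC V B /\ smoothC V A' /\
  forall z, V z -> dz f z = ((A' z * Tc g z - Cconj (g z) * dz g z * A z + dz g z * Cconj (B z)) * / 2)%C.
Proof.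
  intros HG Sf HA HB WA WB Ef; pose proof HG as [HV [Sg [Hg0 Hg1]]].
  assert (Fz : forall z, V z ->
    dz f z = ((A' z * Tc g z - Cconj (g z) * dz g z * A z + dz g z * Cconj (B z)) * / 2)%C).
  { intros z Hz.
    destruct (conformal_wirtinger HG Hz) as [Wg [_ _]].
    destruct (wirtinger_ext_eq HV Hz Ef (smoothC_wirtinger Sf Hz)
      (wirtinger_mult (wirtinger_plus (wirtinger_plus (WA z Hz) (wirtinger_conj (WA z Hz)))
        (wirtinger_plus (wirtinger_mult (wirtinger_conj Wg) (WB z Hz))
                        (wirtinger_mult Wg (wirtinger_conj (WB z Hz))))) (wirtinger_const (/ 2) z)))
      as [-> _].
    unfold Tc; conj_push; ring. }
  assert (EA : forall z, V z -> A' z =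
    ((2 * dz f z + Cconj (g z) * dz g z * A z - dz g z * Cconj (B z)) / Tc g z)%C).
  { intros z Hz; rewrite (Fz z Hz); field; apply Tc_neq_0. }
  assert (Sg1 := smoothC_dz HV Sg); assert (Sfz := smoothC_dz HV Sf).
  assert (SA' : forall k, Ck2 k V A -> Ck2 k V B -> Ck2 k V A').
  { intros k KA KB; apply (Ck2_ext HV (fun z Hz => eq_sym (EA z Hz))).
    apply Ck2_div; auto; [| apply Tc_smooth, HG | intros; apply Tc_neq_0].
    apply Ck2_minus; auto; [apply Ck2_plus; auto |];
      auto using Ck2_mult, Ck2_const, Ck2_conj. }
  (* A' is as regular as A and B are, so every round gains one order, starting from the continuity
     of complex differentiable functions. *)
  assert (X : forall k, Ck2 k V A /\ Ck2 k V B).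
  { induction k as [|k [KA KB]].
    - split; apply holomorphic_Ck2_0; assumption.
    - assert (KA' := SA' k KA KB).
      split; (eapply Ck2_intro; [exact HV | exact WA || exact WB | | apply (Ck2_const k 0 HV)]); auto.
      apply Ck2_minus; auto using Ck2_mult. }
  split; [intros k; apply X |]; split; [intros k; apply X |]; split; [| exact Fz].
  intros k; apply SA'; apply X.
Qed.

Lemma sphere_equation_of_data V g A B A' f z :
  conformal_map V g -> smoothC V f -> holomorphic V A -> holomorphic V B ->
  (forall z, V z -> wirtinger A z (A' z) 0) ->
  (forall z, V z -> wirtinger B z (A' z * g z - A z * dz g z) 0) ->
  (forall z, V z ->
     f z = ((A z + Cconj (A z) + (Cconj (g z) * B z + g z * Cconj (B z))) * / 2)%C) ->
  V z -> sphere_equation g f z.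
Proof.
  intros HG Sf HA HB WA WB Ef Hz; pose proof HG as [HV [Sg [Hg0 Hg1]]].
  destruct (holomorphic_data_smooth HG Sf HA HB WA WB Ef) as [SA [SB [SA' Fz]]].
  (* A' is known only through its values on V, where it coincides with [dz A]; its own derivative
     comes from that of [dz A]. *)
  assert (WA' : wirtinger A' z (dz A' z) 0).
  { apply (wirtinger_ext HV Hz (F := dz A)); [intros w Hw; apply (wirtinger_unique (WA w Hw)) |].
    assert (E : dz A' z = dz (dz A) z).
    { apply (dz_ext HV Hz); intros w Hw; symmetry; apply (wirtinger_unique (WA w Hw)). }
    rewrite E; apply (wirtinger_dz_holo HV SA); auto.
    intros w Hw; apply (wirtinger_unique (WA w Hw)). }
  destruct (conformal_wirtinger HG Hz) as [Wg [Wg1 WT]].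
  destruct (wirtinger_ext_eq HV Hz Ef (smoothC_wirtinger Sf Hz)
      (wirtinger_mult (wirtinger_plus (wirtinger_plus (WA z Hz) (wirtinger_conj (WA z Hz)))
        (wirtinger_plus (wirtinger_mult (wirtinger_conj Wg) (WB z Hz))
                        (wirtinger_mult Wg (wirtinger_conj (WB z Hz))))) (wirtinger_const (/ 2) z)))
      as [_ Fb].
  destruct (wirtinger_ext_eq HV Hz Fz (smoothC_wirtinger (smoothC_dz HV Sf) Hz)
    (wirtinger_mult (wirtinger_plus (wirtinger_minus (wirtinger_mult WA' WT)
       (wirtinger_mult (wirtinger_mult (wirtinger_conj Wg) Wg1) (WA z Hz)))
       (wirtinger_mult Wg1 (wirtinger_conj (WB z Hz)))) (wirtinger_const (/ 2) z))) as [_ Fzb].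
  unfold sphere_equation; rewrite Fzb, Fb, (Fz z Hz), (Ef z Hz).
  conj_push; unfold Tc; field; exact C_two_neq_0.
Qed.

(** * Translation into an equation for the Laplacian of h *)

Definition sphere_pde (g : C -> C) (h : C -> R) (z : C) : Prop :=
  Tfun g z ^ 2 * laplacian h z + 8 * Cmod (C_derive g z) ^ 2 * h z = 0.

Lemma Cmod_sqr (c : C) : Cmod c ^ 2 = Re c * Re c + Im c * Im c.
Proof.
  unfold Cmod; rewrite pow2_sqrt; unfold Re, Im; [ring | nra].
Qed.

Lemma Tfun_Tc g z : RtoC (Tfun g z) = Tc g z.
Proof. rewrite Tc_real; unfold Tfun; now rewrite Cmod_sqr. Qed.

Lemma dzb_dz_real V h z : open V -> smooth V h -> V z ->
  dzb (dz (fun w => RtoC (h w))) z = RtoC (laplacian h z / 4).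
Proof.
  intros HV Hh Hz.
  rewrite (dzb_dz_laplacian HV (Ck2_real HV (Hh 2%nat)) Hz); simpl.
  change (fun w => h w) with h; unfold laplacian.
  destruct (D_ext HV Hz (fun w _ => proj1 (partials_D (partials_const 0 w)))) as [-> _].
  destruct (D_ext HV Hz (fun w _ => proj2 (partials_D (partials_const 0 w)))) as [_ ->].
  destruct (partials_D (partials_const 0 z)) as [-> ->].
  apply injective_projections; simpl; field.
Qed.

(** For f = T h the first derivatives of h cancel: the difference of the two sides of
    [sphere_equation] is T^2 h_{z conj(z)} + 2 |g'|^2 h, a quarter of the left side of
    [sphere_pde]. *)
Lemma sphere_equation_scaled V g h z :
  conformal_map V g -> holomorphic V g -> smooth V h -> V z ->
  (sphere_equation g (fun w => Tc g w * RtoC (h w))%C z <-> sphere_pde g h z).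
Proof.
  intros HG HolG Hh Hz; pose proof HG as [HV [Sg [Hg0 Hg1]]].
  set (H := fun w => RtoC (h w)).
  assert (SH : smoothC V H) by (intros k; apply Ck2_real; auto).
  assert (WT := fun w Hw => proj2 (proj2 (conformal_wirtinger (z := w) HG Hw))).
  assert (WH := fun w Hw => smoothC_wirtinger (z := w) SH Hw).
  assert (WHz := smoothC_wirtinger (smoothC_dz HV SH) Hz).
  destruct (conformal_wirtinger HG Hz) as [Wg [Wg1 _]].
  set (f := fun w => (Tc g w * H w)%C).
  assert (Ff := fun w Hw => wirtinger_unique (wirtinger_mult (WT w Hw) (WH w Hw))).
  assert (Sf : smoothC V f) by (apply smoothC_mult; auto; apply Tc_smooth, HG).
  destruct (wirtinger_ext_eq HV Hz (fun w Hw => proj1 (Ff w Hw))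
    (smoothC_wirtinger (smoothC_dz HV Sf) Hz)
    (wirtinger_plus (wirtinger_mult (wirtinger_mult Wg1 (wirtinger_conj Wg)) (WH z Hz))
       (wirtinger_mult (WT z Hz) WHz))) as [_ Fzzb].
  assert (Key : (Tc g z * dzb (dz f) z -
      (g z * Cconj (dz g z) * dz f z + Cconj (g z) * dz g z * dzb f z - dz g z * Cconj (dz g z) * f z)
      = Tc g z * Tc g z * dzb (dz H) z + 2 * (dz g z * Cconj (dz g z)) * H z)%C).
  { unfold f at 2 3; destruct (Ff z Hz) as [-> ->]; rewrite Fzzb.
    unfold f; conj_push; unfold Tc; ring. }
  assert (Key2 : (Tc g z * Tc g z * dzb (dz H) z + 2 * (dz g z * Cconj (dz g z)) * H z)%C =
    RtoC ((Tfun g z ^ 2 * laplacian h z + 8 * Cmod (C_derive g z) ^ 2 * h z) / 4)).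
  { unfold H; rewrite (dzb_dz_real HV Hh Hz), <- Tfun_Tc.
    destruct (wirtinger_unique (C_derive_wirtinger HolG Hz)) as [E _]; rewrite <- E, <- Cmod2_conj.
    rewrite <- !RtoC_mult, <- RtoC_plus; f_equal; field. }
  change (fun w => (Tc g w * RtoC (h w))%C) with f.
  unfold sphere_equation, sphere_pde; rewrite Key2 in Key; split; intros X.
  - rewrite X in Key; match type of Key with (?a - ?a')%C = _ =>
      replace (a - a')%C with (RtoC 0) in Key by ring end.
    injection Key; intros; lra.
  - rewrite X in Key; replace (RtoC (0 / 4)) with (RtoC 0) in Key by (f_equal; field).
    match goal with |- ?a = ?b => transitivity (a - b + b)%C; [ring | rewrite Key; ring] end.
Qed.

Lemma data_formula g A B z (h : R) :
  h = (inner2 (RtoC 1) A + inner2 (g z) B) / (1 + Cmod (g z) ^ 2) <->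
  (Tc g z * h)%C = ((A + Cconj A + (Cconj (g z) * B + g z * Cconj B)) * / 2)%C.
Proof.
  assert (P : 0 < Tfun g z) by (unfold Tfun; rewrite Cmod_sqr; nra).
  assert (E : ((A + Cconj A + (Cconj (g z) * B + g z * Cconj B)) * / 2)%C =
              RtoC (inner2 (RtoC 1) A + inner2 (g z) B)).
  { rewrite <- RtoC_inv by lra; unfold inner2.
    apply injective_projections; simpl; unfold Re, Im; simpl; field. }
  rewrite E, <- Tfun_Tc, <- RtoC_mult; fold (Tfun g z); split.
  - intros ->; f_equal; field; lra.
  - intros X; apply RtoC_inj in X; rewrite <- X; field; lra.
Qed.

Lemma has_data_of_pde V g h :
  conformal_map V g -> holomorphic V g -> simply_connected V -> smooth V h ->
  (forall z, V z -> sphere_pde g h z) -> has_holomorphic_data V g h.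
Proof.
  intros HG HolG HS Hh PDE; pose proof HG as [HV [Sg [Hg0 Hg1]]].
  destruct (@sphere_equation_solve V g (fun w => Tc g w * RtoC (h w))%C)
    as [A [B [A' [SA [SB [WA [WB Ef]]]]]]]; auto.
  - apply smoothC_mult; auto; [now apply Tc_smooth |].
    intros k; apply Ck2_real; auto.
  - intros z Hz; conj_push; reflexivity.
  - intros z Hz; now apply (sphere_equation_scaled HG HolG Hh Hz), PDE.
  - assert (DA : forall z, V z -> @is_derive C_AbsRing C_NormedModule A z (A' z))
      by (intros z Hz; apply (Ck2_is_C_derive HV (SA 1%nat) Hz), WA, Hz).
    assert (DB : forall z, V z -> @is_derive C_AbsRing C_NormedModule B z
                   (A' z * g z - A z * dz g z)%C)
      by (intros z Hz; apply (Ck2_is_C_derive HV (SB 1%nat) Hz), WB, Hz).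
    (* The solution found satisfies B' = A' g - A g' exactly, so c_1 = 0 is a witness. *)
    exists A, B, 0; split; [| split; [| split]].
    + intros z Hz; eexists; apply DA, Hz.
    + intros z Hz; eexists; apply DB, Hz.
    + intros z Hz; rewrite (is_C_derive_unique _ _ _ (DA z Hz)).
      destruct (wirtinger_unique (C_derive_wirtinger HolG Hz)) as [E _]; rewrite <- E.
      replace (A' z * g z - A z * dz g z + Ci * 0 * dz g z)%C
        with (A' z * g z - A z * dz g z)%C by ring.
      apply DB, Hz.
    + intros z Hz; apply data_formula, Ef, Hz.
Qed.

Lemma pde_of_has_data V g h z :
  conformal_map V g -> holomorphic V g -> smooth V h ->
  has_holomorphic_data V g h -> V z -> sphere_pde g h z.
Proof.
  intros HG HolG Hh [A [B [c1 [HA [HB [DB Eh]]]]]] Hz; pose proof HG as [HV [Sg [Hg0 Hg1]]].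
  apply (sphere_equation_scaled HG HolG Hh Hz).
  (* Replacing A by A - i c_1 changes neither Re A nor A', and turns - A g' + i c_1 g' into - (A - i
     c_1) g'. *)
  assert (WA : forall w, V w -> wirtinger (fun w => A w - Ci * RtoC c1)%C w (C_derive A w) 0).
  { intros w Hw; apply (wirtinger_eq (wirtinger_minus (C_derive_wirtinger HA Hw)
      (wirtinger_const (Ci * RtoC c1) w))); ring. }
  assert (Eg : forall w, V w -> C_derive g w = dz g w).
  { intros w Hw; symmetry; apply (wirtinger_unique (C_derive_wirtinger HolG Hw)). }
  apply (@sphere_equation_of_data V g (fun w => A w - Ci * RtoC c1)%C B (C_derive A)); auto.
  - apply smoothC_mult; auto; [now apply Tc_smooth |].
    intros k; apply Ck2_real; auto.
  - intros w Hw; destruct (HA w Hw) as [l Hl]; exists l.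
    apply (is_derive_ext (fun w => minus (A w) (Ci * RtoC c1)%C)); [reflexivity |].
    replace l with (@minus C_AbelianGroup l zero) by apply minus_zero_r.
    apply (@is_derive_minus C_AbsRing C_NormedModule A (fun _ => (Ci * RtoC c1)%C)); [exact Hl |].
    apply @is_derive_const.
  - intros w Hw; apply (wirtinger_eq (C_is_derive_partials (DB w Hw))); [| reflexivity].
    rewrite (Eg w Hw); ring.
  - intros w Hw; rewrite (proj1 (data_formula g (A w) (B w) w (h w)) (Eh w Hw)).
    replace (Cconj (A w - Ci * RtoC c1))%C with (Cconj (A w) + Ci * RtoC c1)%C; [ring |].
    conj_push; replace (Cconj Ci) with (- Ci)%C; [ring |].
    apply injective_projections; simpl; ring.
Qed.

(** * Changes of parametrization *)

Definition jacobian (tau : C -> C) (w : C) (v : R * R) : R * R :=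
  (D1 (fun x => Re (tau x)) w * fst v + D2 (fun x => Re (tau x)) w * snd v,
   D1 (fun x => Im (tau x)) w * fst v + D2 (fun x => Im (tau x)) w * snd v).

Definition jacobian_det (tau : C -> C) (w : C) : R :=
  D1 (fun x => Re (tau x)) w * D2 (fun x => Im (tau x)) w -
  D2 (fun x => Re (tau x)) w * D1 (fun x => Im (tau x)) w.

(** The two transition maps are inverse to each other on the overlap, so the chain rule makes the
    product of their Jacobian determinants equal to 1. *)
Lemma transition_map (S : Type) (U V : C -> Prop) (phi psi : C -> S) w z :
  (forall x y, U x -> U y -> phi x = phi y -> x = y) ->
  (forall x y, V x -> V y -> psi x = psi y -> x = y) ->
  compatible smooth2 U phi V psi -> compatible smooth2 V psi U phi ->
  U w -> V z -> phi w = psi z ->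
  exists (W : C -> Prop) (tau : C -> C), open W /\ W w /\ smooth2 W tau /\ tau w = z /\
    jacobian_det tau w <> 0 /\
    forall x, W x -> U x /\ V (tau x) /\ psi (tau x) = phi x.
Proof.
  intros IU IV [OW [tau [St Ht]]] [OW' [sig [Ss Hs]]] Uw Vz E.
  set (W := fun x => U x /\ exists y, V y /\ psi y = phi x) in *.
  set (W' := fun x => V x /\ exists y, U y /\ phi y = psi x) in *.
  assert (Ww : W w) by (split; [exact Uw | exists z; auto]).
  assert (TW : forall x, W x -> W' (tau x)).
  { intros x Wx; destruct (Ht x Wx) as [A B]; split; [exact A |]; exists x; split; [apply Wx | auto]. }
  assert (ST : forall x, W x -> sig (tau x) = x).
  { intros x Wx; destruct (Ht x Wx) as [A B], (Hs _ (TW x Wx)) as [A' B'].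
    apply IU; [exact A' | apply Wx |]; now rewrite B', B. }
  exists W, tau; split; [exact OW | split; [exact Ww | split; [exact St | split; [| split]]]].
  - destruct (Ht w Ww) as [A B]; apply IV; auto; now rewrite B.
  - assert (PT1 := Ck_partials (k := 0) (proj1 St 1%nat) Ww).
    assert (PT2 := Ck_partials (k := 0) (proj2 St 1%nat) Ww).
    assert (C1 := partials_comp OW' (proj1 Ss 1%nat) (TW w Ww) PT1 PT2).
    assert (C2 := partials_comp OW' (proj2 Ss 1%nat) (TW w Ww) PT1 PT2).
    apply (partials_ext OW Ww (g := fun x => Re x)) in C1;
      [| intros x Wx; now rewrite ST].
    apply (partials_ext OW Ww (g := fun x => Im x)) in C2;
      [| intros x Wx; now rewrite ST].
    assert (I1 : partials (fun x => Re x) w 1 0)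
      by (split; simpl; [apply @is_derive_id | apply @is_derive_const]).
    assert (I2 : partials (fun x => Im x) w 0 1)
      by (split; simpl; [apply @is_derive_const | apply @is_derive_id]).
    destruct (partials_D C1) as [E1 E2], (partials_D C2) as [E3 E4].
    destruct (partials_D I1) as [F1 F2], (partials_D I2) as [F3 F4].
    rewrite F1 in E1; rewrite F2 in E2; rewrite F3 in E3; rewrite F4 in E4.
    clear F1 F2 F3 F4 C1 C2 I1 I2 PT1 PT2.
    unfold jacobian_det; revert E1 E2 E3 E4.
    generalize (D1 (fun x => Re (tau x)) w) (D2 (fun x => Re (tau x)) w)
      (D1 (fun x => Im (tau x)) w) (D2 (fun x => Im (tau x)) w).
    generalize (D1 (fun x => Re (sig x)) (tau w)) (D2 (fun x => Re (sig x)) (tau w))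
      (D1 (fun x => Im (sig x)) (tau w)) (D2 (fun x => Im (sig x)) (tau w)).
    intros a b c d a' b' c' d' E1 E2 E3 E4 D.
    assert ((a * d - b * c) * (a' * d' - b' * c') = 1).
    { transitivity ((a * a' + b * c') * (c * b' + d * d') - (a * b' + b * d') * (c * a' + d * c'));
        [ring | rewrite <- E1, <- E2, <- E3, <- E4; ring]. }
    rewrite D in H; lra.
  - intros x Wx; split; [apply Wx | apply Ht, Wx].
Qed.

Lemma jacobian_surjective tau w v : jacobian_det tau w <> 0 -> exists u, jacobian tau w u = v.
Proof.
  unfold jacobian_det, jacobian; intros D; destruct v as [v1 v2].
  set (a := D1 (fun x => Re (tau x)) w) in *; set (b := D2 (fun x => Re (tau x)) w) in *.
  set (c := D1 (fun x => Im (tau x)) w) in *; set (d := D2 (fun x => Im (tau x)) w) in *.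
  exists ((d * v1 - b * v2) / (a * d - b * c), (a * v2 - c * v1) / (a * d - b * c)); simpl.
  f_equal; field; exact D.
Qed.

Lemma jacobian_cross tau w u v :
  fst (jacobian tau w u) * snd (jacobian tau w v) - snd (jacobian tau w u) * fst (jacobian tau w v) =
  jacobian_det tau w * (fst u * snd v - snd u * fst v).
Proof. unfold jacobian, jacobian_det; simpl; ring. Qed.

Lemma smooth_comp (U W : C -> Prop) f tau :
  open U -> open W -> (forall z, W z -> U (tau z)) -> smooth U f -> smooth2 W tau ->
  smooth W (fun w => f (tau w)).
Proof. intros HU HW HT Hf [H1 H2] k; apply (Ck_comp HU HW HT); auto. Qed.

Lemma smooth_ext (U : C -> Prop) f g :
  open U -> (forall w, U w -> f w = g w) -> smooth U f -> smooth U g.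
Proof. intros HU E H k; apply (Ck_ext HU E), H. Qed.

Lemma smooth3_comp (U W : C -> Prop) F G tau :
  open U -> open W -> (forall z, W z -> U (tau z)) -> smooth3 U F -> smooth2 W tau ->
  (forall z, W z -> G z = F (tau z)) -> smooth3 W G.
Proof.
  intros HU HW HT [[F1 F2] F3] Ht E.
  split; [split |]; (eapply smooth_ext; [exact HW | intros w Hw; symmetry; rewrite (E w Hw); reflexivity |]).
  - apply (smooth_comp HU HW HT F1 Ht).
  - apply (smooth_comp HU HW HT F2 Ht).
  - apply (smooth_comp HU HW HT F3 Ht).
Qed.

Lemma diff3_comp (U W : C -> Prop) F G tau w v :
  open U -> open W -> (forall z, W z -> U (tau z)) -> smooth3 U F -> smooth2 W tau ->
  (forall z, W z -> G z = F (tau z)) -> W w ->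
  diff3 G w v = diff3 F (tau w) (jacobian tau w v).
Proof.
  intros HU HW HT [[F1 F2] F3] [Ht1 Ht2] E Ww.
  assert (PT1 := Ck_partials (k := 0) (Ht1 1%nat) Ww).
  assert (PT2 := Ck_partials (k := 0) (Ht2 1%nat) Ww).
  assert (X : forall (p : R3 -> R), smooth U (fun z => p (F z)) ->
    D1 (fun z => p (G z)) w = D1 (fun z => p (F z)) (tau w) * D1 (fun x => Re (tau x)) w +
                              D2 (fun z => p (F z)) (tau w) * D1 (fun x => Im (tau x)) w /\
    D2 (fun z => p (G z)) w = D1 (fun z => p (F z)) (tau w) * D2 (fun x => Re (tau x)) w +
                              D2 (fun z => p (F z)) (tau w) * D2 (fun x => Im (tau x)) w).
  { intros p Hp.
    assert (C1 := partials_comp HU (Hp 1%nat) (HT w Ww) PT1 PT2); apply partials_D.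
    apply (partials_ext HW Ww (f := fun z => p (F (tau z)))); [| exact C1].
    intros x Wx; now rewrite (E x Wx). }
  destruct (X (fun y => Re (fst y)) F1) as [A1 A2].
  destruct (X (fun y => Im (fst y)) F2) as [B1 B2].
  destruct (X (fun y => snd y) F3) as [C1 C2].
  unfold diff3, partial1, partial2; rewrite A1, A2, B1, B2, C1, C2.
  unfold jacobian, add3, scal3; simpl.
  apply injective_projections; [apply injective_projections |]; simpl; ring.
Qed.

(** * The conformal map to the sphere *)

Lemma inner3_add_l x y z : inner3 (add3 x y) z = inner3 x z + inner3 y z.
Proof. unfold inner3, add3, inner2; simpl; unfold Re, Im; ring. Qed.

Lemma inner3_scal_l a x y : inner3 (scal3 a x) y = a * inner3 x y.
Proof. unfold inner3, scal3, inner2; simpl; unfold Re, Im; ring. Qed.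

Lemma inner3_sym x y : inner3 x y = inner3 y x.
Proof. unfold inner3, inner2; ring. Qed.

Lemma inner3_add_r x y z : inner3 z (add3 x y) = inner3 z x + inner3 z y.
Proof. now rewrite inner3_sym, inner3_add_l, !(inner3_sym z). Qed.

Lemma inner3_scal_r a x y : inner3 y (scal3 a x) = a * inner3 y x.
Proof. now rewrite inner3_sym, inner3_scal_l, (inner3_sym y). Qed.

Lemma partials_inner3 (U : C -> Prop) F G z :
  smooth3 U F -> smooth3 U G -> U z ->
  partials (fun w => inner3 (F w) (G w)) z
    (inner3 (partial1 F z) (G z) + inner3 (F z) (partial1 G z))
    (inner3 (partial2 F z) (G z) + inner3 (F z) (partial2 G z)).
Proof.
  intros [[F1 F2] F3] [[G1 G2] G3] Hz.
  assert (P := fun f (Hf : smooth U f) => Ck_partials (k := 0) (Hf 1%nat) Hz).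
  unfold inner3, inner2.
  apply (partials_eq (partials_plus (partials_plus (partials_mult (P _ F1) (P _ G1))
    (partials_mult (P _ F2) (P _ G2))) (partials_mult (P _ F3) (P _ G3))));
    unfold partial1, partial2; simpl; ring.
Qed.

Lemma smooth_D1 (U : C -> Prop) f : smooth U f -> smooth U (D1 f).
Proof. intros H k; apply (H (S k)). Qed.

Lemma smooth_D2 (U : C -> Prop) f : smooth U f -> smooth U (D2 f).
Proof. intros H k; apply (H (S k)). Qed.

Lemma smooth3_partial1 U F : smooth3 U F -> smooth3 U (partial1 F).
Proof. intros [[H1 H2] H3]; split; [split |]; simpl; now apply smooth_D1. Qed.

Lemma smooth3_partial2 U F : smooth3 U F -> smooth3 U (partial2 F).
Proof. intros [[H1 H2] H3]; split; [split |]; simpl; now apply smooth_D2. Qed.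

Lemma partial12_comm U F z : open U -> smooth3 U F -> U z ->
  partial1 (partial2 F) z = partial2 (partial1 F) z.
Proof.
  intros HU [[H1 H2] H3] Hz; unfold partial1, partial2; simpl.
  apply injective_projections; [apply injective_projections |]; simpl.
  - apply (D1_D2_comm HU (H1 2%nat) Hz).
  - apply (D1_D2_comm HU (H2 2%nat) Hz).
  - apply (D1_D2_comm HU (H3 2%nat) Hz).
Qed.

Lemma smooth_plus U f g : open U -> smooth U f -> smooth U g -> smooth U (fun z => f z + g z).
Proof. intros HU Hf Hg k; apply Ck_plus; auto. Qed.

Lemma smooth_mult U f g : open U -> smooth U f -> smooth U g -> smooth U (fun z => f z * g z).
Proof. intros HU Hf Hg k; apply Ck_mult; auto. Qed.

Lemma smooth3_add U F G : open U -> smooth3 U F -> smooth3 U G -> smooth3 U (fun z => add3 (F z) (G z)).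
Proof.
  intros HU [[F1 F2] F3] [[G1 G2] G3]; split; [split |]; simpl; now apply smooth_plus.
Qed.

Lemma smooth3_scal U a F : open U -> smooth U a -> smooth3 U F -> smooth3 U (fun z => scal3 (a z) (F z)).
Proof.
  intros HU Ha [[F1 F2] F3]; split; [split |].
  - apply (smooth_ext (f := fun z => a z * Re (fst (F z)))); auto.
    + intros w _; unfold scal3; simpl; unfold Re, Im; ring.
    + now apply smooth_mult.
  - apply (smooth_ext (f := fun z => a z * Im (fst (F z)))); auto.
    + intros w _; unfold scal3; simpl; unfold Re, Im; ring.
    + now apply smooth_mult.
  - now apply smooth_mult.
Qed.

Lemma Tfun_pos g z : 0 < Tfun g z.
Proof. unfold Tfun; rewrite Cmod_sqr; nra. Qed.

Lemma Yfun_fst g z : fst (Yfun g z) = (2 * g z / Tc g z)%C.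
Proof.
  unfold Yfun, scal3; cbn [fst]; rewrite RtoC_inv, Tfun_Tc by (apply Rgt_not_eq, Tfun_pos).
  unfold Cdiv; ring.
Qed.

Lemma Yfun_snd g z : RtoC (snd (Yfun g z)) = (2 / Tc g z - 1)%C.
Proof.
  unfold Yfun, scal3; cbn [snd].
  rewrite RtoC_mult, RtoC_minus, RtoC_inv, Tfun_Tc by (apply Rgt_not_eq, Tfun_pos).
  field; apply Tc_neq_0.
Qed.

Lemma Yfun_wirtinger V g z : conformal_map V g -> V z ->
  wirtinger (fun w => fst (Yfun g w)) z (2 * dz g z / (Tc g z * Tc g z))
    (- (2 * g z * g z * Cconj (dz g z)) / (Tc g z * Tc g z)) /\
  wirtinger (fun w => RtoC (snd (Yfun g w))) z (- (2 * dz g z * Cconj (g z)) / (Tc g z * Tc g z))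
    (- (2 * g z * Cconj (dz g z)) / (Tc g z * Tc g z)).
Proof.
  intros HG Hz; pose proof HG as [HV _].
  destruct (conformal_wirtinger HG Hz) as [Wg [_ WT]].
  assert (N := @Tc_neq_0 g z).
  assert (WI := wirtinger_inv WT N).
  split.
  - apply (wirtinger_ext HV Hz (fun w _ => eq_sym (Yfun_fst g w))).
    apply (wirtinger_eq (wirtinger_mult (wirtinger_mult (wirtinger_const 2 z) Wg) WI)).
    + unfold Tc in *; field; exact N.
    + field; exact N.
  - apply (wirtinger_ext HV Hz (fun w _ => eq_sym (Yfun_snd g w))).
    apply (wirtinger_eq (wirtinger_minus (wirtinger_mult (wirtinger_const 2 z) WI) (wirtinger_const 1 z)));
      field; exact N.
Qed.

Lemma Yfun_smooth V g : conformal_map V g -> smooth3 V (Yfun g).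
Proof.
  intros HG; pose proof HG as [HV [Sg _]].
  assert (ST := Tc_smooth HG).
  assert (S1 : smoothC V (fun w => fst (Yfun g w))).
  { apply (smoothC_ext HV (fun w _ => eq_sym (Yfun_fst g w))).
    apply smoothC_div; auto; [apply smoothC_mult; auto; now apply smoothC_const |].
    intros; apply Tc_neq_0. }
  assert (S2 : smoothC V (fun w => RtoC (snd (Yfun g w)))).
  { apply (smoothC_ext HV (fun w _ => eq_sym (Yfun_snd g w))).
    apply smoothC_minus; auto; [| now apply smoothC_const].
    apply smoothC_div; auto; [now apply smoothC_const |]; intros; apply Tc_neq_0. }
  split; [split |]; intros k.
  - apply (S1 k).
  - apply (S1 k).
  - apply (S2 k).
Qed.

Definition conf_factor (g : C -> C) (z : C) : R := 4 * Cmod (C_derive g z) ^ 2 / Tfun g z ^ 2.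

Lemma Yfun_unit g z : inner3 (Yfun g z) (Yfun g z) = 1.
Proof.
  assert (P := Tfun_pos g z); unfold Yfun, inner3, inner2, scal3; simpl; unfold Re, Im; simpl.
  unfold Tfun in *; rewrite Cmod_sqr in *; unfold Re, Im in *; field; lra.
Qed.

Lemma Yfun_frame V g z : conformal_map V g -> holomorphic V g -> V z ->
  inner3 (partial1 (Yfun g) z) (partial1 (Yfun g) z) = conf_factor g z /\
  inner3 (partial2 (Yfun g) z) (partial2 (Yfun g) z) = conf_factor g z /\
  inner3 (partial1 (Yfun g) z) (partial2 (Yfun g) z) = 0 /\
  inner3 (partial1 (Yfun g) z) (Yfun g z) = 0 /\
  inner3 (partial2 (Yfun g) z) (Yfun g z) = 0 /\ 0 < conf_factor g z.
Proof.
  intros HG HolG Hz; pose proof HG as [HV [Sg [Hg0 Hg1]]].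
  destruct (Yfun_wirtinger HG Hz) as [[W1 W2] [W3 _]].
  destruct (partials_D W1) as [A1 A2], (partials_D W2) as [B1 B2], (partials_D W3) as [C1 C2].
  cbn [Re fst RtoC] in C1, C2.
  unfold conf_factor.
  destruct (wirtinger_unique (C_derive_wirtinger HolG Hz)) as [E _]; rewrite <- E.
  assert (N1 := C_sqnorm_neq_0 (Hg1 z Hz)).
  unfold partial1, partial2.
  change (fun w => fst (RtoC (snd (Yfun g w)))) with (fun w => snd (Yfun g w)) in *.
  rewrite A1, A2, B1, B2, C1, C2; clear A1 A2 B1 B2 C1 C2 W1 W2 W3 E.
  set (Tz := Tc g z) in *.
  assert (ET : (/ (Tz * Tz))%C = RtoC (/ (Tfun g z * Tfun g z))).
  { rewrite RtoC_inv, RtoC_mult, Tfun_Tc; [reflexivity |].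
    assert (P := Tfun_pos g z); nra. }
  unfold Cdiv; rewrite ET; clear ET Tz.
  assert (P := Tfun_pos g z).
  unfold Yfun; unfold Tfun in *; rewrite !Cmod_sqr in *.
  unfold inner3, inner2, scal3, Re, Im in *.
  destruct (g z) as [p q], (dz g z) as [r s]; simpl in *.
  assert (P2 : 0 < r * r + s * s) by nra.
  repeat split; try (field; lra).
  apply Rdiv_lt_0_compat; nra.
Qed.

(** The coordinates of the unit sphere are eigenfunctions of its Laplacian with eigenvalue -2. The
    computation goes through four times the mixed derivative in z and conj(z). *)
Lemma Yfun_laplacian V g z : conformal_map V g -> holomorphic V g -> V z ->
  add3 (partial1 (partial1 (Yfun g)) z) (partial2 (partial2 (Yfun g)) z) =
  scal3 (-2 * conf_factor g z) (Yfun g z).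
Proof.
  intros HG HolG Hz; pose proof HG as [HV [Sg [Hg0 Hg1]]].
  destruct (Yfun_smooth HG) as [[S1 S2] S3].
  destruct (conformal_wirtinger HG Hz) as [Wg [Wg1 WT]].
  assert (N := @Tc_neq_0 g z).
  assert (WI := wirtinger_inv (wirtinger_mult WT WT) (Cmult_neq_0 _ _ N N)).
  assert (L1 : dzb (dz (fun w => fst (Yfun g w))) z =
    (- (4 * dz g z * Cconj (dz g z) * g z) / (Tc g z * Tc g z * Tc g z))%C).
  { assert (W := wirtinger_mult (wirtinger_mult (wirtinger_const 2 z) Wg1) WI).
    apply (wirtinger_ext HV Hz (G := dz (fun w => fst (Yfun g w)))) in W.
    - destruct (wirtinger_unique W) as [_ ->]; unfold Cdiv; field; exact N.
    - intros w Hw; symmetry; apply (wirtinger_unique (proj1 (Yfun_wirtinger HG Hw))). }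
  assert (L2 : dzb (dz (fun w => RtoC (snd (Yfun g w)))) z =
    (- (2 * dz g z * Cconj (dz g z) * (2 - Tc g z)) / (Tc g z * Tc g z * Tc g z))%C).
  { assert (W := wirtinger_mult (wirtinger_opp (wirtinger_mult
      (wirtinger_mult (wirtinger_const 2 z) Wg1) (wirtinger_conj Wg))) WI).
    apply (wirtinger_ext HV Hz (G := dz (fun w => RtoC (snd (Yfun g w))))) in W.
    - destruct (wirtinger_unique W) as [_ ->]; unfold Tc in *; field; exact N.
    - intros w Hw; symmetry; apply (wirtinger_unique (proj2 (Yfun_wirtinger HG Hw))). }
  rewrite (dzb_dz_real HV S3 Hz) in L2.
  rewrite (dzb_dz_laplacian HV (F := fun w => fst (Yfun g w)) (conj (S1 2%nat) (S2 2%nat)) Hz) in L1.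
  assert (P := Tfun_pos g z).
  assert (EE : RtoC (conf_factor g z) = (4 * (dz g z * Cconj (dz g z)) / (Tc g z * Tc g z))%C).
  { unfold conf_factor; destruct (wirtinger_unique (C_derive_wirtinger HolG Hz)) as [E _].
    rewrite <- E, <- Tfun_Tc, <- Cmod2_conj, <- !RtoC_mult, <- RtoC_div by nra; f_equal; field; lra. }
  assert (K1 : (laplacian (fun w => Re (fst (Yfun g w))) z,
                laplacian (fun w => Im (fst (Yfun g w))) z) =
               (RtoC (-2 * conf_factor g z) * fst (Yfun g z))%C).
  { transitivity (4 * ((laplacian (fun w => Re (fst (Yfun g w))) z / 4)%R,
                (laplacian (fun w => Im (fst (Yfun g w))) z / 4)%R))%C;
      [apply injective_projections; simpl; field |].
    rewrite L1, RtoC_mult, EE, Yfun_fst.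
    match goal with |- ?a = ?b => change (@eq C a b) end; field; exact N. }
  assert (K2 : RtoC (laplacian (fun w => snd (Yfun g w)) z) =
               RtoC (-2 * conf_factor g z * snd (Yfun g z))).
  { transitivity (4 * RtoC (laplacian (fun w => snd (Yfun g w)) z / 4)%R)%C;
      [rewrite <- RtoC_mult; f_equal; field |].
    rewrite L2, !RtoC_mult, EE, Yfun_snd; field; exact N. }
  apply RtoC_inj in K2.
  apply injective_projections; [| exact K2].
  unfold scal3; cbn [fst]; rewrite <- K1; reflexivity.
Qed.

Lemma eta_smooth V g h : conformal_map V g -> holomorphic V g -> smooth V h ->
  smooth3 V (eta g h).
Proof.
  intros HG HolG Hh; pose proof HG as [HV [Sg [Hg0 Hg1]]].
  assert (SY := Yfun_smooth HG).
  unfold eta; apply smooth3_add; auto; [| now apply smooth3_scal].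
  unfold gradL; apply smooth3_scal; auto.
  (* The factor T^2 / (4 |g'|^2) is written with g' conj(g') in place of the squared modulus, so
     that the rules for smooth complex functions apply. *)
  - assert (SF : smoothC V (fun z => Tc g z * Tc g z / (4 * (dz g z * Cconj (dz g z))))%C).
    { assert (ST := Tc_smooth HG); assert (S1 := smoothC_dz HV Sg).
      apply smoothC_div; auto.
      - apply smoothC_mult; auto.
      - apply smoothC_mult; auto; [now apply smoothC_const |].
        apply smoothC_mult; auto; now apply smoothC_conj.
      - intros z Hz; apply Cmult_neq_0; [intros X; injection X; lra |].
        apply Cmult_neq_0; [auto | now apply Cconj_neq_0, Hg1]. }
    apply (smooth_ext (f := fun z => Re (Tc g z * Tc g z / (4 * (dz g z * Cconj (dz g z))))%C)); auto.
    + intros z Hz; destruct (wirtinger_unique (C_derive_wirtinger HolG Hz)) as [E _].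
      rewrite <- E, <- Tfun_Tc, <- Cmod2_conj, <- !RtoC_mult, <- RtoC_div.
      * simpl; unfold Rdiv; ring.
      * rewrite Cmod_sqr; assert (X := C_sqnorm_neq_0 (Hg1 z Hz)); lra.
    + intros k; apply (SF k).
  - apply smooth3_add; auto; apply smooth3_scal; auto.
    + now apply smooth_D1.
    + now apply smooth3_partial1.
    + now apply smooth_D2.
    + now apply smooth3_partial2.
Qed.

Lemma eta_inner V g h z : conformal_map V g -> holomorphic V g -> V z ->
  inner3 (eta g h z) (Yfun g z) = h z /\
  inner3 (eta g h z) (partial1 (Yfun g) z) = D1 h z /\
  inner3 (eta g h z) (partial2 (Yfun g) z) = D2 h z.
Proof.
  intros HG HolG Hz.
  destruct (Yfun_frame HG HolG Hz) as [E11 [E22 [E12 [E10 [E20 EP]]]]].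
  assert (E21 : inner3 (partial2 (Yfun g) z) (partial1 (Yfun g) z) = 0) by now rewrite inner3_sym.
  assert (E01 : inner3 (Yfun g z) (partial1 (Yfun g) z) = 0) by now rewrite inner3_sym.
  assert (E02 : inner3 (Yfun g z) (partial2 (Yfun g) z) = 0) by now rewrite inner3_sym.
  (* The factor in [gradL] is 1/E, which cancels the squared length E of Y_1 and Y_2. *)
  assert (Ph : Tfun g z ^ 2 / (4 * Cmod (C_derive g z) ^ 2) = / conf_factor g z).
  { unfold conf_factor in *; assert (P := Tfun_pos g z).
    assert (Cmod (C_derive g z) <> 0).
    { intros X; rewrite X in EP; unfold Rdiv in EP; rewrite pow_ne_zero in EP by lia; lra. }
    field; split; [lra | assumption]. }
  unfold eta, gradL; rewrite Ph.
  rewrite !inner3_add_l, !inner3_scal_l, !inner3_add_l, !inner3_scal_l.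
  rewrite E10, E20, E11, E22, E12, E21, E01, E02, Yfun_unit.
  repeat split; field; lra.
Qed.

(** Differentiating <eta, Y> = h gives <eta_i, Y> = h_i - <eta, Y_i> = 0. Differentiating <eta, Y_i>
    = h_i gives <eta_j, Y_i> = h_ij - <eta, Y_ij>, symmetric in i and j; its trace follows from the
    Laplacian of Y. *)
Lemma eta_derivative V g h z : conformal_map V g -> holomorphic V g -> smooth V h -> V z ->
  let Y := Yfun g in let e := eta g h in
  inner3 (partial1 e z) (Y z) = 0 /\ inner3 (partial2 e z) (Y z) = 0 /\
  inner3 (partial1 e z) (partial2 Y z) = inner3 (partial2 e z) (partial1 Y z) /\
  inner3 (partial1 e z) (partial1 Y z) + inner3 (partial2 e z) (partial2 Y z) =
    laplacian h z + 2 * conf_factor g z * h z.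
Proof.
  intros HG HolG Hh Hz Y e; pose proof HG as [HV _].
  assert (SY : smooth3 V Y) by apply (Yfun_smooth HG).
  assert (Se : smooth3 V e) by apply (eta_smooth HG HolG Hh).
  assert (SY1 := smooth3_partial1 SY); assert (SY2 := smooth3_partial2 SY).
  assert (I := fun w Hw => eta_inner (z := w) h HG HolG Hw).
  destruct (I z Hz) as [I0 [I1 I2]].
  assert (Q0 := partials_D (partials_inner3 Se SY Hz)).
  destruct (D_ext HV Hz (f := fun w => inner3 (e w) (Y w)) (g := h)) as [X1 X2];
    [intros w Hw; apply (I w Hw) |].
  assert (Q1 := partials_D (partials_inner3 Se SY1 Hz)).
  destruct (D_ext HV Hz (f := fun w => inner3 (e w) (partial1 Y w)) (g := D1 h)) as [X3 X4];
    [intros w Hw; apply (I w Hw) |].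
  assert (Q2 := partials_D (partials_inner3 Se SY2 Hz)).
  destruct (D_ext HV Hz (f := fun w => inner3 (e w) (partial2 Y w)) (g := D2 h)) as [X5 X6];
    [intros w Hw; apply (I w Hw) |].
  rewrite X1, X2 in Q0; rewrite X3, X4 in Q1; rewrite X5, X6 in Q2.
  assert (SC := D1_D2_comm HV (Hh 2%nat) Hz).
  assert (YC := partial12_comm HV SY Hz).
  assert (LY := f_equal (inner3 (e z)) (Yfun_laplacian HG HolG Hz)).
  rewrite inner3_add_r, inner3_scal_r in LY; fold Y in LY.
  fold e Y in I0, I1, I2; rewrite I0 in LY.
  destruct Q0 as [Q01 Q02], Q1 as [Q11 Q12], Q2 as [Q21 Q22].
  rewrite YC in Q21; unfold laplacian.
  repeat split; lra.
Qed.

(** * The differentials of X and N through a reflection *)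

Definition reflect (e x : R3) : R3 := sub3 x (scal3 (2 * inner3 x e / inner3 e e) e).

Lemma reflect_inj e x : inner3 e e <> 0 -> reflect e x = zero3 -> x = zero3.
Proof.
  intros He H.
  assert (X : inner3 (reflect e x) e = - inner3 x e).
  { unfold reflect, sub3; rewrite inner3_add_l, !inner3_scal_l; field; exact He. }
  rewrite H in X; assert (Z : inner3 zero3 e = 0)
    by (unfold inner3, inner2, zero3; simpl; ring).
  rewrite Z in X; unfold reflect in H.
  replace (inner3 x e) with 0 in H by lra.
  rewrite <- H; destruct x as [[a b] c], e as [[a' b'] c'].
  unfold sub3, add3, scal3; simpl; unfold Rdiv; rewrite !Rmult_0_r, !Rmult_0_l.
  apply injective_projections; [apply injective_projections |]; simpl; ring.
Qed.

Lemma reflect_lin e a x b y :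
  reflect e (add3 (scal3 a x) (scal3 b y)) = add3 (scal3 a (reflect e x)) (scal3 b (reflect e y)).
Proof.
  unfold reflect; rewrite inner3_add_l, !inner3_scal_l.
  destruct x as [[x1 x2] x3], y as [[y1 y2] y3], e as [[e1 e2] e3].
  generalize (inner3 (e1, e2, e3) (e1, e2, e3)); intros s.
  generalize (inner3 (x1, x2, x3) (e1, e2, e3)) (inner3 (y1, y2, y3) (e1, e2, e3)); intros p q.
  unfold sub3, add3, scal3, Rdiv; simpl.
  apply injective_projections; [apply injective_projections |]; simpl; ring.
Qed.

(** Besides Y_i - a eta_i, the derivative of Y - a eta contains - a_i eta. Because S_i = 2 <eta_i,
    eta> and <Y_i, eta> = h_i, the coefficient a_i is 2 <Y_i - a eta_i, eta> / S, which is precisely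
    the one in the reflection. *)
Lemma local_X_partials V g h c z : conformal_map V g -> holomorphic V g -> smooth V h ->
  V z -> h z <> 0 ->
  let e := eta g h in let a := 2 * (h z + c) / Sfun g h z in
  partial1 (local_X g h c) z = reflect (e z) (sub3 (partial1 (Yfun g) z) (scal3 a (partial1 e z))) /\
  partial2 (local_X g h c) z = reflect (e z) (sub3 (partial2 (Yfun g) z) (scal3 a (partial2 e z))).
Proof.
  intros HG HolG Hh Hz H0 e a; pose proof HG as [HV _].
  assert (SY : smooth3 V (Yfun g)) by apply (Yfun_smooth HG).
  assert (Se : smooth3 V e) by apply (eta_smooth HG HolG Hh).
  destruct (eta_inner h HG HolG Hz) as [I0 [I1 I2]]; fold e in I0, I1, I2.
  assert (NS : Sfun g h z <> 0).
  { unfold Sfun; fold e; intros X; apply H0; rewrite <- I0.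
    revert X; generalize (e z) (Yfun g z); intros [[x1 x2] x3] [[y1 y2] y3].
    unfold inner3, inner2; simpl; intros X.
    assert (x1 = 0) by nra; assert (x2 = 0) by nra; assert (x3 = 0) by nra; subst; ring. }
  assert (PS := partials_inner3 Se Se Hz).
  change (fun w => inner3 (e w) (e w)) with (Sfun g h) in PS.
  assert (Ph := Ck_partials (k := 0) (Hh 1%nat) Hz).
  assert (K := fun c => partials_const c z).
  (* The linear form pi stands for each of the three coordinates, so the computation is made
     once. *)
  assert (X : forall pi : R3 -> R,
    (forall x y, pi (add3 x y) = pi x + pi y) -> (forall t x, pi (scal3 t x) = t * pi x) ->
    smooth V (fun w => pi (Yfun g w)) -> smooth V (fun w => pi (e w)) ->
    pi (partial1 (Yfun g) z) = D1 (fun w => pi (Yfun g w)) z ->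
    pi (partial2 (Yfun g) z) = D2 (fun w => pi (Yfun g w)) z ->
    pi (partial1 e z) = D1 (fun w => pi (e w)) z ->
    pi (partial2 e z) = D2 (fun w => pi (e w)) z ->
    partials (fun w => pi (local_X g h c w)) z
      (pi (reflect (e z) (sub3 (partial1 (Yfun g) z) (scal3 a (partial1 e z)))))
      (pi (reflect (e z) (sub3 (partial2 (Yfun g) z) (scal3 a (partial2 e z)))))).
  { intros pi Ladd Lscal SpY Spe D1Y D2Y D1e D2e.
    assert (PY := Ck_partials (k := 0) (SpY 1%nat) Hz).
    assert (Pe := Ck_partials (k := 0) (Spe 1%nat) Hz).
    apply (partials_fun (f := fun w => pi (Yfun g w) +
      - (2 * (h w + c) * / Sfun g h w * pi (e w)))).
    { intros w; unfold local_X, sub3; rewrite Ladd, !Lscal; unfold Rdiv; fold e; ring. }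
    apply (partials_eq (partials_plus PY (partials_opp (partials_mult (partials_mult (partials_mult
      (K 2) (partials_plus Ph (K c))) (partials_inv PS NS)) Pe))));
    unfold reflect, sub3; rewrite !Ladd, !Lscal, ?Ladd, ?Lscal, !inner3_add_l, !inner3_scal_l;
    rewrite <- ?D1Y, <- ?D2Y, <- ?D1e, <- ?D2e.
    - rewrite (inner3_sym (partial1 (Yfun g) z) (e z)), I1; unfold a.
      change (inner3 (e z) (e z)) with (Sfun g h z).
      rewrite (inner3_sym (e z) (partial1 e z)); field; exact NS.
    - rewrite (inner3_sym (partial2 (Yfun g) z) (e z)), I2; unfold a.
      change (inner3 (e z) (e z)) with (Sfun g h z).
      rewrite (inner3_sym (e z) (partial2 e z)); field; exact NS. }
  destruct SY as [[Y1 Y2] Y3], Se as [[e1 e2] e3].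
  destruct (partials_D (X (fun x => Re (fst x))
    ltac:(intros; unfold add3, Re; simpl; reflexivity)
    ltac:(intros; unfold scal3, Re; simpl; ring) Y1 e1 eq_refl eq_refl eq_refl eq_refl)) as [A1 A2].
  destruct (partials_D (X (fun x => Im (fst x))
    ltac:(intros; unfold add3, Im; simpl; reflexivity)
    ltac:(intros; unfold scal3, Im; simpl; ring) Y2 e2 eq_refl eq_refl eq_refl eq_refl)) as [B1 B2].
  destruct (partials_D (X (fun x => snd x)
    ltac:(intros; reflexivity) ltac:(intros; reflexivity) Y3 e3 eq_refl eq_refl eq_refl eq_refl)) as [C1 C2].
  split.
  - unfold partial1 at 1; rewrite A1, B1, C1.
    apply injective_projections; [apply injective_projections |]; reflexivity.
  - unfold partial2 at 1; rewrite A2, B2, C2.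
    apply injective_projections; [apply injective_projections |]; reflexivity.
Qed.

(** * Principal curvatures *)

Definition lin2 (a b : R3) (v : R * R) : R3 := add3 (scal3 (fst v) a) (scal3 (snd v) b).

Lemma vec3_ext (x y : R3) :
  fst (fst x) = fst (fst y) -> snd (fst x) = snd (fst y) -> snd x = snd y -> x = y.
Proof.
  destruct x as [[a b] c], y as [[a' b'] c']; simpl; intros -> -> ->; reflexivity.
Qed.

(* Cramer's rule; the square of det(a, b, c) is the Gram determinant E^2. *)
Lemma orthogonal_frame_zero (a b c d : R3) (E : R) :
  0 < E -> inner3 a a = E -> inner3 b b = E -> inner3 c c = 1 ->
  inner3 a b = 0 -> inner3 a c = 0 -> inner3 b c = 0 ->
  inner3 d a = 0 -> inner3 d b = 0 -> inner3 d c = 0 -> d = zero3.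
Proof.
  destruct a as [[a1 a2] a3], b as [[b1 b2] b3], c as [[c1 c2] c3], d as [[d1 d2] d3].
  unfold inner3, inner2, Re, Im; cbn [fst snd]; intros HE Haa Hbb Hcc Hab Hac Hbc Hda Hdb Hdc.
  set (det := a1 * (b2 * c3 - b3 * c2) - a2 * (b1 * c3 - b3 * c1) + a3 * (b1 * c2 - b2 * c1)).
  assert (G : det * det = E * E).
  { transitivity ((a1*a1+a2*a2+a3*a3) * ((b1*b1+b2*b2+b3*b3) * (c1*c1+c2*c2+c3*c3)
      - (b1*c1+b2*c2+b3*c3) * (b1*c1+b2*c2+b3*c3))
      - (a1*b1+a2*b2+a3*b3) * ((a1*b1+a2*b2+a3*b3) * (c1*c1+c2*c2+c3*c3)
      - (b1*c1+b2*c2+b3*c3) * (a1*c1+a2*c2+a3*c3))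
      + (a1*c1+a2*c2+a3*c3) * ((a1*b1+a2*b2+a3*b3) * (b1*c1+b2*c2+b3*c3)
      - (b1*b1+b2*b2+b3*b3) * (a1*c1+a2*c2+a3*c3))); [unfold det; ring |].
    rewrite Haa, Hbb, Hcc, Hab, Hac, Hbc; ring. }
  assert (N : det <> 0) by (intros X; rewrite X in G; nra).
  assert (Z : forall x, x * det = 0 -> x = 0)
    by (intros x Hx; apply Rmult_integral in Hx as [Hx | Hx]; [exact Hx | contradiction]).
  apply vec3_ext; cbn [fst snd zero3 RtoC]; apply Z.
  - transitivity ((d1*a1+d2*a2+d3*a3) * (b2*c3-b3*c2) + (d1*b1+d2*b2+d3*b3) * (c2*a3-c3*a2)
      + (d1*c1+d2*c2+d3*c3) * (a2*b3-a3*b2)); [unfold det; ring | rewrite Hda, Hdb, Hdc; ring].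
  - transitivity ((d1*a1+d2*a2+d3*a3) * (b3*c1-b1*c3) + (d1*b1+d2*b2+d3*b3) * (c3*a1-c1*a3)
      + (d1*c1+d2*c2+d3*c3) * (a3*b1-a1*b3)); [unfold det; ring | rewrite Hda, Hdb, Hdc; ring].
  - transitivity ((d1*a1+d2*a2+d3*a3) * (b1*c2-b2*c1) + (d1*b1+d2*b2+d3*b3) * (c1*a2-c2*a1)
      + (d1*c1+d2*c2+d3*c3) * (a1*b2-a2*b1)); [unfold det; ring | rewrite Hda, Hdb, Hdc; ring].
Qed.

(** For a 2 by 2 matrix M, det(M v1, v2) + det(v1, M v2) is the trace of M times det(v1, v2). *)
Lemma trace_of_eigenbasis m11 m12 m21 m22 s1 s2 (v1 v2 : R * R) :
  fst v1 * snd v2 - snd v1 * fst v2 <> 0 ->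
  s1 * fst v1 = m11 * fst v1 + m12 * snd v1 -> s1 * snd v1 = m21 * fst v1 + m22 * snd v1 ->
  s2 * fst v2 = m11 * fst v2 + m12 * snd v2 -> s2 * snd v2 = m21 * fst v2 + m22 * snd v2 ->
  m11 + m22 = s1 + s2.
Proof.
  destruct v1 as [a b], v2 as [c d]; simpl; intros N H1 H2 H3 H4.
  apply (Rmult_eq_reg_r (a * d - b * c)); [| exact N].
  transitivity ((m11 * a + m12 * b) * d - (m21 * a + m22 * b) * c
    + a * (m21 * c + m22 * d) - b * (m11 * c + m12 * d)); [ring |].
  rewrite <- H1, <- H2, <- H3, <- H4; ring.
Qed.

Lemma traceless_symmetric_eigenbasis a b : exists l (v1 v2 : R * R),
  fst v1 * snd v2 - snd v1 * fst v2 <> 0 /\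
  l * fst v1 = a * fst v1 + b * snd v1 /\ l * snd v1 = b * fst v1 - a * snd v1 /\
  - l * fst v2 = a * fst v2 + b * snd v2 /\ - l * snd v2 = b * fst v2 - a * snd v2.
Proof.
  destruct (Req_dec b 0) as [-> | N].
  (* For b = 0 the general eigenvectors (b, l - a) and (b, - l - a) are dependent, but the matrix is
     already diagonal. *)
  - exists a, (1, 0), (0, 1); simpl; repeat split; lra.
  - set (l := sqrt (a * a + b * b)).
    assert (L : l * l = a * a + b * b) by (apply sqrt_sqrt; nra).
    assert (P : 0 < l) by (apply sqrt_lt_R0; nra).
    exists l, (b, l - a), (b, - l - a); simpl; repeat split; nra.
Qed.

(** Here <x, x> = 1 + 4c(h + c)/S and <x, n> = 1 + 2hc/S with S = <e, e>, so the denominator is a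
    nonzero multiple of hc. *)
Lemma radius_value (Y e : R3) (h c : R) :
  inner3 Y Y = 1 -> inner3 e Y = h -> inner3 e e <> 0 -> h <> 0 -> c <> 0 ->
  let x := sub3 Y (scal3 (2 * (h + c) / inner3 e e) e) in
  let n := sub3 Y (scal3 (2 * h / inner3 e e) e) in
  (1 - inner3 x x) / (2 * (inner3 x n - 1)) = - (h + c) / h.
Proof.
  intros HY He NS Nh Nc x n; unfold x, n, sub3.
  assert (He' : inner3 Y e = h) by now rewrite inner3_sym.
  rewrite !inner3_add_l, !inner3_scal_l, !inner3_add_r, !inner3_scal_r, HY, He, He'.
  set (S := inner3 e e) in *.
  assert (Z : h * c <> 0) by (apply Rmult_integral_contrapositive; auto).
  field_simplify_eq; [ring |].
  repeat split; try assumption.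
  replace (S + -1 * (2 * h * h) + -1 * (2 * (h + c) * (h + -1 * (2 * h))) - S) with (2 * (h * c)) by ring.
  apply Rmult_integral_contrapositive; split; [lra | exact Z].
Qed.

(** This lets one derivative formula, valid for every c, serve both X and N. *)
Lemma local_N_X g h z : local_N g h z = local_X g h 0 z.
Proof. unfold local_N, local_X; now rewrite Rplus_0_r. Qed.

Lemma smooth3_local (U : C -> Prop) F :
  (forall z, U z -> exists W : C -> Prop, W z /\ smooth3 W F) -> smooth3 U F.
Proof.
  intros H; split; [split |]; intros k; apply Ck_local; intros z Hz;
    destruct (H z Hz) as [W [Wz [[H1 H2] H3]]]; exists W; split; [exact Wz | apply H1 | exact Wz
    | apply H2 | exact Wz | apply H3].
Qed.

Lemma smooth3_ext U F G : open U -> (forall w, U w -> F w = G w) -> smooth3 U F -> smooth3 U G.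
Proof.
  intros HU E [[H1 H2] H3]; split; [split |].
  - apply (smooth_ext HU (fun w Hw => f_equal (fun x => Re (fst x)) (E w Hw)) H1).
  - apply (smooth_ext HU (fun w Hw => f_equal (fun x => Im (fst x)) (E w Hw)) H2).
  - apply (smooth_ext HU (fun w Hw => f_equal (fun x => snd x) (E w Hw)) H3).
Qed.

Lemma partial_ext U F G z : open U -> U z -> (forall w, U w -> F w = G w) ->
  partial1 F z = partial1 G z /\ partial2 F z = partial2 G z.
Proof.
  intros HU Hz E; unfold partial1, partial2.
  destruct (D_ext HU Hz (f := fun w => Re (fst (F w))) (g := fun w => Re (fst (G w)))) as [-> ->];
    [intros w Hw; now rewrite E |].
  destruct (D_ext HU Hz (f := fun w => Im (fst (F w))) (g := fun w => Im (fst (G w)))) as [-> ->];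
    [intros w Hw; now rewrite E |].
  destruct (D_ext HU Hz (f := fun w => snd (F w)) (g := fun w => snd (G w))) as [-> ->];
    [intros w Hw; now rewrite E | auto].
Qed.

Lemma chart_transition (Sigma : RiemannSurface) X N (P : LocalData Sigma) i w z :
  local_parametrization Sigma X N P -> ld_dom P w -> chart_dom Sigma i z ->
  chart_par Sigma i z = ld_par P w ->
  exists (W : C -> Prop) (tau : C -> C), open W /\ W w /\ smooth2 W tau /\ tau w = z /\
    jacobian_det tau w <> 0 /\
    forall x, W x -> ld_dom P x /\ chart_dom Sigma i (tau x) /\
                     chart_par Sigma i (tau x) = ld_par P x.
Proof.
  intros HP Hw Hz E; destruct (lp_diffeo HP i) as [C1 C2].
  apply (transition_map (lp_inj HP) (@chart_inj Sigma i) C1 C2 Hw Hz); now symmetry.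
Qed.

Lemma smooth3_pullback (Sigma : RiemannSurface) X N (P : LocalData Sigma) (F : Sigma -> R3) :
  local_parametrization Sigma X N P ->
  (forall i, smooth3 (chart_dom Sigma i) (fun z => F (chart_par Sigma i z))) ->
  smooth3 (ld_dom P) (fun w => F (ld_par P w)).
Proof.
  intros HP HF; apply smooth3_local; intros w Hw.
  destruct (@chart_cover Sigma (ld_par P w)) as [i [z [Hz E]]].
  destruct (chart_transition HP Hw Hz E) as [W [tau [OW [Ww [St [_ [_ Ht]]]]]]].
  exists W; split; [exact Ww |].
  apply (smooth3_comp (@chart_open Sigma i) OW (fun x Wx => proj1 (proj2 (Ht x Wx))) (HF i) St).
  intros x Wx; now rewrite (proj2 (proj2 (Ht x Wx))).
Qed.

(* Smoothness of g comes from that of Y = N + (h / c) (N - X). *)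
Lemma lp_conformal (Sigma : RiemannSurface) X N (P : LocalData Sigma) :
  immersion Sigma X -> gauss_map Sigma X N -> local_parametrization Sigma X N P ->
  conformal_map (ld_dom P) (ld_g P).
Proof.
  intros HX HN HP; assert (HU := lp_open HP).
  assert (SX := smooth3_pullback HP (fun i => proj1 (HX i))).
  assert (SN := smooth3_pullback HP (fun i => proj1 (HN i))).
  set (c := ld_c P); assert (Nc : c <> 0) by apply (lp_c_nz HP).
  assert (SY : smooth3 (ld_dom P) (Yfun (ld_g P))).
  { apply (smooth3_ext (F := fun w => add3 (N (ld_par P w)) (scal3 (ld_h P w * / c)
      (add3 (N (ld_par P w)) (scal3 (-1) (X (ld_par P w))))))); auto.
    - intros w Hw; rewrite (lp_X HP w Hw), (lp_N HP w Hw); fold c; unfold local_X, local_N, sub3, Rdiv.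
      generalize (/ Sfun (ld_g P) (ld_h P) w); intros r.
      generalize (eta (ld_g P) (ld_h P) w) (Yfun (ld_g P) w); intros e Y.
      unfold add3, scal3; apply vec3_ext; simpl; field; exact Nc.
    - apply smooth3_add; auto; apply smooth3_scal; auto.
      + apply smooth_mult; auto; [apply (lp_h_smooth HP) | intros k; apply Ck_const, HU].
      + apply smooth3_add; auto; apply smooth3_scal; auto; intros k; apply Ck_const, HU. }
  assert (Sg : smoothC (ld_dom P) (ld_g P)).
  { destruct SY as [[S1 S2] S3].
    assert (Sd : smoothC (ld_dom P) (fun w => 1 + RtoC (snd (Yfun (ld_g P) w)))%C).
    { apply smoothC_plus; auto; [now apply smoothC_const |].
      intros k; apply Ck2_real; auto. }
    assert (Ed : forall w, (1 + RtoC (snd (Yfun (ld_g P) w)))%C = (2 / Tc (ld_g P) w)%C)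
      by (intros w; rewrite Yfun_snd; ring).
    apply (smoothC_ext (F := fun w => (fst (Yfun (ld_g P) w) / (1 + RtoC (snd (Yfun (ld_g P) w))))%C)); auto.
    - intros w Hw; rewrite Ed, Yfun_fst; field; apply Tc_neq_0.
    - apply smoothC_div; auto; [intros k; split; auto |].
      intros w Hw; rewrite Ed; apply Cmult_neq_0; [exact C_two_neq_0 |].
      intros X0; apply C_two_neq_0; transitivity (2 * (/ Tc (ld_g P) w) * Tc (ld_g P) w)%C;
        [field; apply Tc_neq_0 | rewrite X0; ring]. }
  split; [exact HU | split; [exact Sg | split]]; intros z Hz;
    destruct (wirtinger_unique (C_derive_wirtinger (lp_g_holo HP) Hz)) as [E1 E2].
  - exact E2.
  - rewrite E1; apply (lp_g_deriv HP Hz).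
Qed.

Lemma reflect_scal e a x : reflect e (scal3 a x) = scal3 a (reflect e x).
Proof.
  transitivity (reflect e (add3 (scal3 a x) (scal3 0 x))).
  - f_equal; apply vec3_ext; simpl; ring.
  - rewrite reflect_lin; apply vec3_ext; simpl; ring.
Qed.

(** By linearity the hypothesis says that the reflection kills (1 + k) dY v - (aN + k aX) d(eta) v.
    The reflection is injective, so this vector is zero, and it is paired with Y1 and Y2. *)
Lemma eigenvector_coordinates (Y1 Y2 e e1 e2 : R3) (E aX aN k : R) (v : R * R) :
  inner3 Y1 Y1 = E -> inner3 Y2 Y2 = E -> inner3 Y1 Y2 = 0 -> inner3 e e <> 0 ->
  scal3 (-1) (reflect e (sub3 (lin2 Y1 Y2 v) (scal3 aN (lin2 e1 e2 v)))) =
  scal3 k (reflect e (sub3 (lin2 Y1 Y2 v) (scal3 aX (lin2 e1 e2 v)))) ->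
  (1 + k) * E * fst v = (aN + k * aX) * (inner3 e1 Y1 * fst v + inner3 e2 Y1 * snd v) /\
  (1 + k) * E * snd v = (aN + k * aX) * (inner3 e1 Y2 * fst v + inner3 e2 Y2 * snd v).
Proof.
  intros N11 N22 N12 NS; set (n := sub3 _ (scal3 aN _)); set (x := sub3 _ (scal3 aX _)); intros H.
  assert (Z : add3 (scal3 1 n) (scal3 k x) = zero3).
  { apply (reflect_inj NS); rewrite reflect_lin, <- H.
    apply vec3_ext; simpl; ring. }
  assert (Z0 : forall y, inner3 zero3 y = 0) by (intros y; unfold inner3, inner2; simpl; ring).
  assert (A1 := Z0 Y1); assert (A2 := Z0 Y2); rewrite <- Z in A1, A2.
  unfold n, x, sub3, lin2 in A1, A2.
  repeat rewrite ?inner3_add_l, ?inner3_scal_l in A1.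
  repeat rewrite ?inner3_add_l, ?inner3_scal_l in A2.
  rewrite (inner3_sym Y2 Y1), N12, N11 in A1; rewrite N12, N22 in A2.
  split; lra.
Qed.

(** Since d(eta) is tangent to the sphere, testing against the orthogonal frame Y1, Y2, Y promotes
    the two scalar relations to a vector identity. *)
Lemma eigenvector_vector (Y Y1 Y2 e1 e2 : R3) (E l : R) (v : R * R) :
  0 < E -> inner3 Y1 Y1 = E -> inner3 Y2 Y2 = E -> inner3 Y Y = 1 ->
  inner3 Y1 Y2 = 0 -> inner3 Y1 Y = 0 -> inner3 Y2 Y = 0 ->
  inner3 e1 Y = 0 -> inner3 e2 Y = 0 ->
  l * E * fst v = inner3 e1 Y1 * fst v + inner3 e2 Y1 * snd v ->
  l * E * snd v = inner3 e1 Y2 * fst v + inner3 e2 Y2 * snd v ->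
  lin2 e1 e2 v = scal3 l (lin2 Y1 Y2 v).
Proof.
  intros HE N11 N22 N00 N12 N10 N20 T1 T2 H1 H2.
  assert (Z : add3 (lin2 e1 e2 v) (scal3 (- l) (lin2 Y1 Y2 v)) = zero3).
  { apply (orthogonal_frame_zero HE N11 N22 N00 N12 N10 N20); unfold lin2;
      repeat rewrite ?inner3_add_l, ?inner3_scal_l;
      rewrite ?(inner3_sym Y2 Y1), ?N12, ?N11, ?N22, ?N10, ?N20, ?T1, ?T2; lra. }
  revert Z; generalize (lin2 e1 e2 v) (lin2 Y1 Y2 v); intros [[a b] c] [[a' b'] c'] Z.
  unfold add3, scal3, zero3, RtoC in Z; simpl in Z; injection Z; intros.
  apply vec3_ext; simpl; lra.
Qed.

Lemma lp_differentials (Sigma : RiemannSurface) X N (P : LocalData Sigma) w v :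
  conformal_map (ld_dom P) (ld_g P) -> local_parametrization Sigma X N P -> ld_dom P w ->
  let g := ld_g P in let h := ld_h P in let e := eta g h in
  let A := lin2 (partial1 (Yfun g) w) (partial2 (Yfun g) w) v in
  let B := lin2 (partial1 e w) (partial2 e w) v in
  diff3 (fun x => X (ld_par P x)) w v =
    reflect (e w) (sub3 A (scal3 (2 * (h w + ld_c P) / inner3 (e w) (e w)) B)) /\
  diff3 (fun x => N (ld_par P x)) w v =
    reflect (e w) (sub3 A (scal3 (2 * h w / inner3 (e w) (e w)) B)).
Proof.
  intros HG HP Hw g h e A B.
  assert (D : forall c, diff3 (local_X g h c) w v =
    reflect (e w) (sub3 A (scal3 (2 * (h w + c) / inner3 (e w) (e w)) B))).
  { intros c.
    destruct (local_X_partials c HG (lp_g_holo HP) (lp_h_smooth HP) Hw (lp_h_nz HP w Hw)) as [E1 E2].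
    unfold diff3; fold g h in E1, E2; rewrite E1, E2.
    change (Sfun g h w) with (inner3 (e w) (e w)); fold e.
    rewrite <- reflect_lin; f_equal; unfold A, B, lin2, sub3, add3, scal3.
    apply vec3_ext; simpl; ring. }
  split.
  - rewrite <- D; unfold diff3.
    destruct (partial_ext (lp_open HP) Hw (lp_X HP)) as [-> ->]; reflexivity.
  - rewrite <- (Rplus_0_r (h w)), <- D; unfold diff3.
    destruct (partial_ext (F := fun x : C => N (ld_par P x)) (G := local_X g h 0) (lp_open HP) Hw
      (fun x Hx => eq_trans (lp_N HP x Hx) (local_N_X _ _ _))) as [-> ->]; reflexivity.
Qed.

Lemma eigenvalue_relation (h c k S : R) :
  h <> 0 -> S <> 0 ->
  2 * h / S + k * (2 * (h + c) / S) = 2 * h / S * (1 - k * (- (h + c) / h)).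
Proof. intros; field; auto. Qed.

(** The same tau serves every F: dX and dN are transported by one linear isomorphism, so
    eigenvectors and eigenvalues correspond between the chart and the parametrization. *)
Lemma chart_diff3 (Sigma : RiemannSurface) X N (P : LocalData Sigma) i w z :
  local_parametrization Sigma X N P -> ld_dom P w -> chart_dom Sigma i z ->
  chart_par Sigma i z = ld_par P w ->
  exists tau : C -> C, jacobian_det tau w <> 0 /\
    forall F : Sigma -> R3,
      (forall i, smooth3 (chart_dom Sigma i) (fun x => F (chart_par Sigma i x))) ->
      forall v, diff3 (fun x => F (ld_par P x)) w v =
                diff3 (fun x => F (chart_par Sigma i x)) z (jacobian tau w v).
Proof.
  intros HP Hw Hz Ez.
  destruct (chart_transition HP Hw Hz Ez) as [W [tau [OW [Ww [St [<- [Jt Ht]]]]]]].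
  exists tau; split; [exact Jt |]; intros F HF v.
  apply (diff3_comp v (@chart_open Sigma i) OW (fun x Wx => proj1 (proj2 (Ht x Wx))) (HF i) St); auto.
  intros x Wx; now rewrite (proj2 (proj2 (Ht x Wx))).
Qed.

Lemma H1_at_point (Sigma : RiemannSurface) X N (P : LocalData Sigma) w :
  immersion Sigma X -> gauss_map Sigma X N -> local_parametrization Sigma X N P -> ld_dom P w ->
  (exists k1 k2, principal_curvatures Sigma X N (ld_par P w) k1 k2 /\
     spherical_mean_curvature (radius_function Sigma X N (ld_par P w)) k1 k2 = 0) <->
  sphere_pde (ld_g P) (ld_h P) w.
Proof.
  intros HX HN HP Hw.
  assert (HG := lp_conformal HX HN HP); assert (Hol := lp_g_holo HP); assert (Hh := lp_h_smooth HP).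
  destruct (Yfun_frame HG Hol Hw) as [N11 [N22 [N12 [N10 [N20 HE]]]]].
  assert (N00 := Yfun_unit (ld_g P) w).
  destruct (eta_inner (ld_h P) HG Hol Hw) as [I0 _].
  destruct (eta_derivative HG Hol Hh Hw) as [T1 [T2 [Sym Tr]]].
  assert (Nh := lp_h_nz HP w Hw); assert (Nc := lp_c_nz HP).
  assert (D := fun v => lp_differentials v HG HP Hw).
  assert (HT := Tfun_pos (ld_g P) w).
  assert (PDE : Tfun (ld_g P) w ^ 2 * (laplacian (ld_h P) w + 2 * conf_factor (ld_g P) w * ld_h P w)
    = Tfun (ld_g P) w ^ 2 * laplacian (ld_h P) w + 8 * Cmod (C_derive (ld_g P) w) ^ 2 * ld_h P w)
    by (unfold conf_factor; field; lra).
  rewrite <- Tr in PDE; clear Tr; unfold sphere_pde; rewrite <- PDE; clear PDE.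
  (* eta cannot vanish, because its product with Y is h. *)
  assert (NS : inner3 (eta (ld_g P) (ld_h P) w) (eta (ld_g P) (ld_h P) w) <> 0).
  { intros Z; apply Nh; rewrite <- I0; revert Z.
    generalize (eta (ld_g P) (ld_h P) w) (Yfun (ld_g P) w); intros [[x1 x2] x3] [[y1 y2] y3].
    unfold inner3, inner2; simpl; intros Z.
    assert (x1 = 0) by nra; assert (x2 = 0) by nra; assert (x3 = 0) by nra; subst; ring. }
  assert (HR : radius_function Sigma X N (ld_par P w) = - (ld_h P w + ld_c P) / ld_h P w).
  { unfold radius_function; rewrite (lp_X HP w Hw), (lp_N HP w Hw).
    exact (radius_value N00 I0 NS Nh Nc). }
  rewrite HR; clear HR.
  set (c := ld_c P) in *; set (h := ld_h P w) in *.
  set (E := conf_factor (ld_g P) w) in *.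
  set (T := Tfun (ld_g P) w) in *.
  set (Y := Yfun (ld_g P) w) in *.
  set (Y1 := partial1 (Yfun (ld_g P)) w) in *; set (Y2 := partial2 (Yfun (ld_g P)) w) in *.
  set (e := eta (ld_g P) (ld_h P) w) in *.
  set (e1 := partial1 (eta (ld_g P) (ld_h P)) w) in *.
  set (e2 := partial2 (eta (ld_g P) (ld_h P)) w) in *.
  set (S := inner3 e e) in *.
  cbv zeta in D; fold Y1 Y2 e1 e2 e h c S in D.
  split.
  - intros [k1 [k2 [[i [z [Hz [Ez [v1 [v2 [Det [V1 V2]]]]]]]] HM]]].
    destruct (chart_diff3 HP Hw Hz Ez) as [tau [Jt DF]].
    assert (DX := DF X (fun i => proj1 (HX i))); assert (DN := DF N (fun i => proj1 (HN i))); clear DF.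
    destruct (jacobian_surjective v1 Jt) as [u1 <-], (jacobian_surjective v2 Jt) as [u2 <-].
    rewrite <- DX, <- DN, (proj1 (D u1)), (proj2 (D u1)) in V1.
    rewrite <- DX, <- DN, (proj1 (D u2)), (proj2 (D u2)) in V2.
    rewrite jacobian_cross in Det.
    assert (Det' : fst u1 * snd u2 - snd u1 * fst u2 <> 0) by (intros Z; apply Det; rewrite Z; ring).
    apply (eigenvector_coordinates N11 N22 N12 NS) in V1, V2.
    rewrite (eigenvalue_relation c k1 Nh NS) in V1; rewrite (eigenvalue_relation c k2 Nh NS) in V2.
    set (r := - (h + c) / h) in *.
    assert (Nr : 1 + r <> 0).
    { unfold r; replace (1 + - (h + c) / h) with (- (c / h)) by (field; exact Nh).
      intros Z; apply Nc; apply (Rmult_eq_reg_r (/ h)); [unfold Rdiv in Z; lra | now apply Rinv_neq_0_compat]. }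
    (* If 1 - kR = 0, the eigenvector equations force (1 + k) E u = 0, hence k = -1 and 1 + R = 0.
       But 1 + R = - c/h is nonzero. *)
    assert (ND : forall k (u : R * R), (fst u <> 0 \/ snd u <> 0) ->
      (1 + k) * E * fst u = 2 * h / S * (1 - k * r) * (inner3 e1 Y1 * fst u + inner3 e2 Y1 * snd u) /\
      (1 + k) * E * snd u = 2 * h / S * (1 - k * r) * (inner3 e1 Y2 * fst u + inner3 e2 Y2 * snd u) ->
      1 - k * r <> 0).
    { intros k u Hu [U1 U2] Z; rewrite Z, !Rmult_0_r, !Rmult_0_l in U1, U2.
      assert (K : 1 + k = 0).
      { apply Rmult_integral in U1 as [U1 | U1]; [apply Rmult_integral in U1 as [U1 | U1]; lra |].
        apply Rmult_integral in U2 as [U2 | U2]; [apply Rmult_integral in U2 as [U2 | U2]; lra |].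
        destruct Hu; contradiction. }
      apply Nr; replace k with (-1) in Z by lra; lra. }
    assert (Hu1 : fst u1 <> 0 \/ snd u1 <> 0).
    { destruct (Req_dec (fst u1) 0) as [Z | Z]; [| auto]; right; intros Z'; apply Det'; rewrite Z, Z'; ring. }
    assert (Hu2 : fst u2 <> 0 \/ snd u2 <> 0).
    { destruct (Req_dec (fst u2) 0) as [Z | Z]; [| auto]; right; intros Z'; apply Det'; rewrite Z, Z'; ring. }
    assert (D1 := ND k1 u1 Hu1 V1); assert (D2 := ND k2 u2 Hu2 V2).
    unfold spherical_mean_curvature, spherical_curvature in HM.
    (* Multiplication by q = E / (2h/S) turns a spherical curvature into an eigenvalue of the matrix
       of products <eta_i, Y_j>, whose trace is sought. *)
    set (q := S * E / (2 * h)).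
    assert (Tr := @trace_of_eigenbasis (inner3 e1 Y1) (inner3 e2 Y1) (inner3 e1 Y2) (inner3 e2 Y2)
      (q * ((1 + k1) / (1 - k1 * r))) (q * ((1 + k2) / (1 - k2 * r))) u1 u2 Det').
    assert (Sol : forall a b x k, 1 - k * r <> 0 ->
      (1 + k) * E * x = 2 * h / S * (1 - k * r) * (a + b) -> q * ((1 + k) / (1 - k * r)) * x = a + b).
    { intros a b x k Hk Hx; unfold q.
      transitivity (S / (2 * h * (1 - k * r)) * ((1 + k) * E * x)); [field; auto | rewrite Hx; field; auto]. }
    rewrite Tr; try (apply Sol; [assumption | apply V1 || apply V2]).
    replace (q * ((1 + k1) / (1 - k1 * r)) + q * ((1 + k2) / (1 - k2 * r)))
      with (q * 2 * (/ 2 * ((1 + k1) / (1 - k1 * r) + (1 + k2) / (1 - k2 * r)))) by (field; auto).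
    rewrite HM; ring.
  - intros HT0; apply Rmult_integral in HT0 as [HT0 | HT0]; [exfalso; nra |].
    (* The matrix of products <eta_i, Y_j> is symmetric, and by the equation traceless. *)
    destruct (traceless_symmetric_eigenbasis (inner3 e1 Y1) (inner3 e2 Y1)) as
      [l [u1 [u2 [Det [A1 [A2 [B1 B2]]]]]]].
    destruct (@chart_cover Sigma (ld_par P w)) as [i [z [Hz Ez]]].
    destruct (chart_diff3 HP Hw Hz Ez) as [tau [Jt DF]].
    assert (DX := DF X (fun i => proj1 (HX i))); assert (DN := DF N (fun i => proj1 (HN i))); clear DF.
    set (aX := 2 * (h + c) / S) in *; set (aN := 2 * h / S) in *.
    (* If d(eta) u = t dY u, then dX u and dN u are the multiples 1 - aX t and 1 - aN t of one
       reflected vector, so u is an eigenvector with k = - (1 - aN t) / (1 - aX t). The denominator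
       is nonzero because X is an immersion. *)
    assert (Eig : forall t u, (fst u <> 0 \/ snd u <> 0) ->
      t * E * fst u = inner3 e1 Y1 * fst u + inner3 e2 Y1 * snd u ->
      t * E * snd u = inner3 e1 Y2 * fst u + inner3 e2 Y2 * snd u ->
      1 - aX * t <> 0 /\
      scal3 (-1) (diff3 (fun x => N (chart_par Sigma i x)) z (jacobian tau w u)) =
      scal3 (- (1 - aN * t) / (1 - aX * t))
        (diff3 (fun x => X (chart_par Sigma i x)) z (jacobian tau w u))).
    { intros t u Hu U1 U2.
      assert (F := eigenvector_vector HE N11 N22 N00 N12 N10 N20 T1 T2 U1 U2).
      destruct (D u) as [FX FN]; rewrite F in FX, FN.
      assert (Q : forall a, sub3 (lin2 Y1 Y2 u) (scal3 a (scal3 t (lin2 Y1 Y2 u))) =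
        scal3 (1 - a * t) (lin2 Y1 Y2 u)) by (intros a; apply vec3_ext; simpl; ring).
      rewrite Q, reflect_scal in FX, FN.
      rewrite <- DX, <- DN, FX, FN.
      assert (K : 1 - aX * t <> 0).
      { intros Z; rewrite Z in FX.
        assert (J0 : jacobian tau w u = (0, 0)).
        { apply (proj2 (HX i) z _ Hz); rewrite <- DX, FX; apply vec3_ext; simpl; ring. }
        (* Crossing with the two basis vectors extracts the coordinates of u, so a zero image under
           the invertible Jacobian forces u = 0. *)
        assert (C1 := jacobian_cross tau w u (0, 1)); assert (C2 := jacobian_cross tau w u (1, 0)).
        rewrite J0 in C1, C2; simpl in C1, C2; rewrite !Rmult_0_l, Rminus_0_r in C1, C2.
        symmetry in C1, C2.
        apply Rmult_integral in C1 as [C1 | C1]; [contradiction |].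
        apply Rmult_integral in C2 as [C2 | C2]; [contradiction |].
        destruct Hu as [Hu | Hu]; apply Hu; lra. }
      split; [exact K |].
      revert K; generalize (reflect e (lin2 Y1 Y2 u)) (1 - aX * t) (1 - aN * t).
      clear; intros [[x1 x2] x3] p q K; apply vec3_ext; simpl; field; exact K. }
    assert (Hu1 : fst u1 <> 0 \/ snd u1 <> 0).
    { destruct (Req_dec (fst u1) 0) as [Z | Z]; [| auto]; right; intros Z'; apply Det; rewrite Z, Z'; ring. }
    assert (Hu2 : fst u2 <> 0 \/ snd u2 <> 0).
    { destruct (Req_dec (fst u2) 0) as [Z | Z]; [| auto]; right; intros Z'; apply Det; rewrite Z, Z'; ring. }
    destruct (Eig (l / E) u1 Hu1) as [K1 F1].
    { transitivity (l * fst u1); [field; lra | exact A1]. }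
    { transitivity (l * snd u1); [field; lra |]; rewrite A2, Sym.
      replace (inner3 e2 Y2) with (- inner3 e1 Y1) by lra; ring. }
    destruct (Eig (- l / E) u2 Hu2) as [K2 F2].
    { transitivity (- l * fst u2); [field; lra | exact B1]. }
    { transitivity (- l * snd u2); [field; lra |]; rewrite B2, Sym.
      replace (inner3 e2 Y2) with (- inner3 e1 Y1) by lra; ring. }
    eexists; eexists; split.
    + exists i, z; split; [exact Hz | split; [exact Ez |]].
      exists (jacobian tau w u1), (jacobian tau w u2); split; [| split; [exact F1 | exact F2]].
      rewrite jacobian_cross; apply Rmult_integral_contrapositive; auto.
    + unfold spherical_mean_curvature, spherical_curvature.
      (* The spherical curvature attached to t is aN t; at the opposite values l / E and - l / E the
         two cancel. *)
      assert (SC : forall t, 1 - aX * t <> 0 ->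
        (1 + - (1 - aN * t) / (1 - aX * t)) /
        (1 - - (1 - aN * t) / (1 - aX * t) * (- (h + c) / h)) = aN * t).
      { intros t K.
        replace (1 + - (1 - aN * t) / (1 - aX * t)) with (- (2 * c / S) * t / (1 - aX * t))
          by (unfold aX, aN in *; field; split; [exact NS |]; intros Z; apply K;
              apply (Rmult_eq_reg_l S); [| exact NS]; rewrite Rmult_0_r, <- Z; field; exact NS).
        replace (1 - - (1 - aN * t) / (1 - aX * t) * (- (h + c) / h)) with (- (c / h) / (1 - aX * t))
          by (unfold aX, aN in *; field; repeat split; try assumption; intros Z; apply K;
              apply (Rmult_eq_reg_l S); [| exact NS]; rewrite Rmult_0_r, <- Z; field; exact NS).
        unfold aN; field; auto. }
      rewrite (SC _ K1), (SC _ K2); field; lra.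
Qed.

(** * Localization to discs and the theorem *)

Lemma ball_simply_connected (c : C) (e : posreal) : simply_connected (fun w : C => ball c e w).
Proof.
  split.
  - intros a b Ha Hb.
    exists (fun t => (fst a + t * (fst b - fst a), snd a + t * (snd b - snd a))).
    split; [| split; [| split]].
    + intros t; apply continuous_pair;
        apply (@ex_derive_continuous R_AbsRing R_NormedModule); auto_derive; exact I.
    + intros t Ht; now apply ball_segment.
    + rewrite !Rmult_0_l, !Rplus_0_r; now rewrite <- surjective_pairing.
    + apply injective_projections; simpl; ring.
  - intros gam Cg Vg Closed.
    exists (fun p => (fst (gam (snd p)) + fst p * (fst (gam 0) - fst (gam (snd p))),
                      snd (gam (snd p)) + fst p * (snd (gam 0) - snd (gam (snd p))))).
    assert (C0 : forall p : R * R, continuous (fun q : R * R => gam (snd q)) p).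
    { intros [s t]; apply (continuous_comp snd gam); [apply continuous_snd | apply Cg]. }
    assert (C1 : forall pi : C -> R, (forall x, continuous pi x) -> forall p : R * R,
      continuous (fun q : R * R => pi (gam (snd q)) + fst q * (pi (gam 0) - pi (gam (snd q)))) p).
    { intros pi Cpi p.
      assert (C2 : continuous (fun q : R * R => pi (gam (snd q))) p)
        by (apply (continuous_comp (fun q : R * R => gam (snd q)) pi); auto).
      apply (continuous_plus (fun q : R * R => pi (gam (snd q)))
        (fun q : R * R => fst q * (pi (gam 0) - pi (gam (snd q))))); [exact C2 |].
      apply (continuous_mult (fun q : R * R => fst q)
        (fun q : R * R => pi (gam 0) - pi (gam (snd q)))).
      - destruct p; apply continuous_fst.
      - apply (continuous_minus (fun _ : R * R => pi (gam 0)) (fun q : R * R => pi (gam (snd q))));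
          [apply continuous_const | exact C2]. }
    split; [| split; [| split]].
    + intros p; apply continuous_pair.
      * apply (C1 fst); intros [x y]; apply continuous_fst.
      * apply (C1 snd); intros [x y]; apply continuous_snd.
    + intros s t Hs Ht; simpl; apply ball_segment; auto; apply Vg; lra.
    + intros t Ht; simpl; split; apply injective_projections; simpl; ring.
    + intros s Hs; simpl; rewrite <- Closed; split; apply injective_projections; simpl; ring.
Qed.

Lemma holomorphic_sub (U V : C -> Prop) F :
  (forall z, V z -> U z) -> holomorphic U F -> holomorphic V F.
Proof. intros S H z Hz; apply H, S, Hz. Qed.

Lemma conformal_map_sub (U V : C -> Prop) g :
  open V -> (forall z, V z -> U z) -> conformal_map U g -> conformal_map V g.
Proof.
  intros HV S [_ [Sg [H0 H1]]]; split; [exact HV | split; [| split]]; auto.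
  intros k; destruct (Sg k) as [A B]; split; eapply Ck_sub; eauto.
Qed.

Theorem corollary3p4
  (Sigma : RiemannSurface) (X N : Sigma -> R3)
  (HX : immersion Sigma X) (HN : gauss_map Sigma X N)
  (HXN : forall p : Sigma, inner3 (X p) (N p) <> 1)
  (J : Type) (P : J -> LocalData Sigma)
  (HP : forall j : J, local_parametrization Sigma X N (P j))
  (Hcover : forall p : Sigma, exists (j : J) (z : C),
      ld_dom (P j) z /\ ld_par (P j) z = p) :
  is_H1_surface Sigma X N <->
  forall (j : J) (V : C -> Prop),
    open V -> (forall z, V z -> ld_dom (P j) z) -> simply_connected V ->
    has_holomorphic_data V (ld_g (P j)) (ld_h (P j)).
Proof.
  split.
  - intros H1 j V HV SV CV.
    apply has_data_of_pde; auto.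
    + apply (conformal_map_sub HV SV (lp_conformal HX HN (HP j))).
    + apply (holomorphic_sub SV (lp_g_holo (HP j))).
    + apply (smooth_sub SV (lp_h_smooth (HP j))).
    + intros z Hz; apply (H1_at_point HX HN (HP j) (SV z Hz)), H1.
  - intros HD p; destruct (Hcover p) as [j [z [Hz <-]]].
    apply (H1_at_point HX HN (HP j) Hz).
    (* The equation is local: holomorphic data on one small square around z, which is simply
       connected, already imply it at z. *)
    destruct (lp_open (HP j) z Hz) as [e He].
    assert (OB := @ball_open z e).
    apply (@pde_of_has_data (fun w : C => ball z e w)).
    + apply (conformal_map_sub OB He (lp_conformal HX HN (HP j))).
    + apply (holomorphic_sub He (lp_g_holo (HP j))).
    + apply (smooth_sub He (lp_h_smooth (HP j))).
    + apply (HD j _ OB He), ball_simply_connected.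
    + apply (@ball_center C_UniformSpace).
Qed.
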